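(* Assume $\mathsf{OCA}_{\mathrm T}+\mathsf{MA}_{\aleph_1}(\sigma\text{-linked})$. Let $\mathcal F_n$ and $\mathcal G_n$ ($n\in\mathbb N$) be fields, each finite or countably infinite. Then $\prod_n\mathcal F_n/\mathrm{Fin}$ and $\prod_n\mathcal G_n/\mathrm{Fin}$ are isomorphic if and only if they are obviously isomorphic. Moreover, every automorphism of such a reduced product, and every isomorphism between two such reduced products, is trivial.
   Context: For $\mathcal L$-structures $\mathcal M_n$ and an ideal $\mathcal I$ on $\mathbb N$, the reduced product $\prod_n\mathcal M_n/\mathcal I$ is the set of classes of $\prod_n\mathcal M_n$ under $a\sim b\iff\{n:a(n)\ne b(n)\}\in\mathcal I$, with function symbols interpreted coordinatewise and a relation $R(\bar a)$ holding iff $\{n:\mathcal M_n\not\models R(\bar a(n))\}\in\mathcal I$. $\mathrm{Fin}$ is the ideal of finite subsets of $\mathbb N$. Fields are considered in the language of rings. Two reduced products $\prod_n\mathcal M_n/\mathrm{Fin}$, $\prod_n\mathcal N_n/\mathrm{Fin}$ are obviously isomorphic if there is a bijection $f$ between cofinite subsets of $\mathbb N$ with $\mathcal M_{f(n)}\cong\mathcal N_n$ for all $n$ in the domain of $f$. A homomorphism $\Phi\colon\prod_n\mathcal M_n/\mathcal I\to\prod_n\mathcal N_n/\mathcal J$ is trivial if there are $f\colon\mathbb N\to\mathbb N$ and maps $h_n\colon\mathcal M_{f(n)}\to\mathcal N_n$ such that $a\mapsto(h_n(a(f(n))))_n$ lifts $\Phi$ (sends representatives of $x$ to representatives of $\Phi(x)$),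 and for every finite sublanguage $\mathcal L_0$ the set of $n$ for which $h_n$ is not a homomorphism of the $\mathcal L_0$-reducts belongs to $\mathcal J$. $\mathsf{OCA}_{\mathrm T}$: for every separable metric space $X$ and every open $K_0\subseteq[X]^2$ (unordered pairs of distinct points, topologized as symmetric subsets of $X^2$ minus the diagonal), either some uncountable $Y\subseteq X$ has $[Y]^2\subseteq K_0$, or $X=\bigcup_n X_n$ with $[X_n]^2\cap K_0=\emptyset$ for all $n$. $\mathsf{MA}_{\aleph_1}(\sigma\text{-linked})$: for every poset which is a countable union of sets of pairwise compatible elements and every family of $\aleph_1$ dense subsets, some filter meets all of them. *)

(* Defs.v *)
From HB Require Import structures.
From mathcomp Require Import all_boot all_order all_algebra.
From mathcomp Require Import all_classical all_reals topology.

Set Implicit Arguments.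
Unset Strict Implicit.
Unset Printing Implicit Defensive.

Import Order.TTheory GRing.Theory Num.Theory.
Local Open Scope classical_set_scope.
Local Open Scope quotient_scope.

(* First-order languages; constants are function symbols of arity 0, and
   equality is logical, so it is not among the relation symbols. *)
Record language := Language {
  fsym : Type;
  farity : fsym -> nat;
  rsym : Type;
  rarity : rsym -> nat }.

Record structure (L : language) := Structure {
  carrier :> Type;
  finterp : forall s : fsym L, ('I_(farity s) -> carrier) -> carrier;
  rinterp : forall s : rsym L, ('I_(rarity s) -> carrier) -> Prop }.

Record sublanguage (L : language) := Sublanguage {
  sub_fsym : set (fsym L);
  sub_rsym : set (rsym L) }.

Definition finite_sublanguage (L : language) (L0 : sublanguage L) : Prop :=
  finite_set (sub_fsym L0) /\ finite_set (sub_rsym L0).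

(* h is a homomorphism between the L0-reducts of M and N. *)
Definition reduct_homomorphism (L : language) (L0 : sublanguage L)
    (M N : structure L) (h : M -> N) : Prop :=
  (forall s, sub_fsym L0 s -> forall a : 'I_(farity s) -> M,
      h (finterp a) = finterp (h \o a)) /\
  (forall s, sub_rsym L0 s -> forall a : 'I_(rarity s) -> M,
      rinterp a -> rinterp (h \o a)).

Definition isomorphism (L : language) (M N : structure L) (h : M -> N) : Prop :=
  [/\ bijective h,
      forall s (a : 'I_(farity s) -> M), h (finterp a) = finterp (h \o a)
    & forall s (a : 'I_(rarity s) -> M), rinterp a <-> rinterp (h \o a)].

Definition isomorphic (L : language) (M N : structure L) : Prop :=
  exists h : M -> N, isomorphism h.

Record ideal := Ideal {
  ideal_sets :> set nat -> Prop;
  ideal0 : ideal_sets set0;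
  idealU : forall A B, ideal_sets A -> ideal_sets B -> ideal_sets (A `|` B);
  idealS : forall A B, A `<=` B -> ideal_sets B -> ideal_sets A }.

Lemma Fin_subset (A B : set nat) : A `<=` B -> finite_set B -> finite_set A.
Proof. exact: sub_finite_set. Qed.

Lemma Fin_setU (A B : set nat) :
  finite_set A -> finite_set B -> finite_set (A `|` B).
Proof. by move=> fA fB; rewrite finite_setU. Qed.

Definition Fin : ideal := Ideal (@finite_set0 nat) Fin_setU Fin_subset.

Section ReducedProduct.
Variables (L : language) (I : ideal) (M : nat -> structure L).

Definition req : rel {classic forall n, M n} :=
  fun a b => `[< I [set n | a n <> b n] >].

Lemma req_refl : reflexive req.
Proof.
move=> a; apply/asboolP; apply: idealS (ideal0 I) => n /= na; exact: na.
Qed.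

Lemma req_sym : symmetric req.
Proof.
by move=> a b; apply/asboolP/asboolP; apply: idealS => n /= ab /esym.
Qed.

Lemma req_trans : transitive req.
Proof.
move=> b a c /asboolP ab /asboolP bc; apply/asboolP.
apply: idealS (idealU ab bc) => n /= ac.
by have [e|] := pselect (a n = b n); [right; rewrite -e | left].
Qed.

Canonical req_equiv := EquivRel req req_refl req_sym req_trans.

Definition rprod_carrier : Type := {eq_quot req}.

Definition rclass (a : forall n, M n) : rprod_carrier := \pi_({eq_quot req}) a.

Definition rrepr (x : rprod_carrier) : forall n, M n :=
  repr (x : {eq_quot req}).

(* The interpretations are computed on chosen representatives; by
   rprod_finterpE and rprod_rinterpE below, any representatives will do. *)
Definition rprod : structure L := @Structure L rprod_carrier
  (fun s x => rclass (fun n => finterp (fun i => rrepr (x i) n)))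
  (fun s x => I [set n | ~ rinterp (fun i => rrepr (x i) n)]).

Lemma rclassP (a b : forall n, M n) :
  rclass a = rclass b <-> I [set n | a n <> b n].
Proof. by split=> [/eqmodP/asboolP//|ab]; apply/eqmodP/asboolP. Qed.

Lemma rreprK (x : rprod_carrier) : rclass (rrepr x) = x.
Proof. exact: reprK. Qed.

Lemma rrepr_fin k (a : 'I_k -> forall n, M n) :
  I [set n | (fun i => rrepr (rclass (a i)) n) <> a^~ n].
Proof.
have H (s : seq 'I_k) :
    I [set n | exists2 i, i \in s & rrepr (rclass (a i)) n <> a i n].
  elim: s => [|j s IH]; first by apply: idealS (ideal0 I) => n [].
  have /rclassP Ij := rreprK (rclass (a j)).
  apply: idealS (idealU Ij IH) => n [i]; rewrite inE => /orP[/eqP->|si] na.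
    by left.
  by right; exists i.
apply: idealS (H (enum 'I_k)) => n /= na.
apply: contrapT => nex; apply: na; apply/funext => i.
by apply: contrapT => nai; apply: nex; exists i => //; rewrite mem_enum.
Qed.

Lemma rprod_finterpE s (a : 'I_(farity s) -> forall n, M n) :
  @finterp L rprod s (fun i => rclass (a i)) =
  rclass (fun n => finterp (fun i => a i n)).
Proof.
apply/rclassP; apply: idealS (rrepr_fin a) => n /= na e; apply: na.
by rewrite e.
Qed.

Lemma rprod_rinterpE s (a : 'I_(rarity s) -> forall n, M n) :
  @rinterp L rprod s (fun i => rclass (a i)) <->
  I [set n | ~ rinterp (fun i => a i n)].
Proof.
split=> Ha; apply: idealS (idealU (rrepr_fin a) Ha) => n /= na;
by have [e|] := pselect ((fun i => rrepr (rclass (a i)) n) = a^~ n);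
  [right; rewrite ?e // -?e | left].
Qed.

End ReducedProduct.

Definition obviously_isomorphic (L : language) (M N : nat -> structure L) :
    Prop :=
  exists (A B : set nat) (f : nat -> nat),
    [/\ finite_set (~` A), finite_set (~` B), set_bij A B f
      & forall n, A n -> isomorphic (M (f n)) (N n)].

Definition trivial_hom (L : language) (I J : ideal) (M N : nat -> structure L)
    (Phi : rprod I M -> rprod J N) : Prop :=
  exists (f : nat -> nat) (h : forall n, M (f n) -> N n),
    (forall a : forall n, M n,
        Phi (rclass I a) = rclass J (fun n => h n (a (f n)))) /\
    (forall L0 : sublanguage L, finite_sublanguage L0 ->
        J [set n | ~ reduct_homomorphism L0 (h n)]).

Inductive ring_fsym := RZero | ROne | ROpp | RAdd | RMul.

Definition ring_farity (s : ring_fsym) : nat :=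
  match s with RZero | ROne => 0 | ROpp => 1 | RAdd | RMul => 2 end.

Definition ring_language : language :=
  Language ring_farity (fun s : Empty_set => match s return nat with end).

Definition ring_finterp (K : fieldType) (s : ring_fsym) :
    ('I_(ring_farity s) -> K) -> K :=
  match s return ('I_(ring_farity s) -> K) -> K with
  | RZero => fun _ => 0%R
  | ROne => fun _ => 1%R
  | ROpp => fun a => (- a ord0)%R
  | RAdd => fun a => (a ord0 + a ord_max)%R
  | RMul => fun a => (a ord0 * a ord_max)%R
  end.

Definition field_structure (K : fieldType) : structure ring_language :=
  @Structure ring_language K (@ring_finterp K)
    (fun s : Empty_set => match s with end).

(* A subset of [X]^2 is represented by a symmetric subset of X * X that misses
   the diagonal. Since X is Hausdorff the diagonal is closed, so being open in
   the complement of the diagonal amounts to being open in X * X. *)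
Definition open_pairs (R : realType) (X : metricType R) (K0 : set (X * X)) :
    Prop :=
  [/\ open K0, forall x y, K0 (x, y) -> K0 (y, x) & forall x, ~ K0 (x, x)].

Definition separable (T : topologicalType) : Prop :=
  exists2 D : set T, countable D & dense D.

Definition OCA_T (R : realType) : Prop :=
  forall (X : metricType R) (K0 : set (X * X)),
    separable X -> open_pairs K0 ->
    (exists2 Y : set X, ~ countable Y &
       forall x y, Y x -> Y y -> x <> y -> K0 (x, y)) \/
    (exists2 Z : nat -> set X, \bigcup_n Z n = [set: X] &
       forall n x y, Z n x -> Z n y -> x <> y -> ~ K0 (x, y)).

Section Posets.
Variables (d : Order.disp_t) (P : porderType d).

Definition compatible (p q : P) : Prop :=
  exists r : P, (r <= p)%O /\ (r <= q)%O.

Definition sigma_linked : Prop :=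
  exists2 A : nat -> set P, \bigcup_n A n = [set: P] &
    forall n p q, A n p -> A n q -> compatible p q.

Definition order_dense (D : set P) : Prop :=
  forall p : P, exists2 q, D q & (q <= p)%O.

Definition order_filter (G : set P) : Prop :=
  [/\ G !=set0,
      forall p q, G p -> (p <= q)%O -> G q
    & forall p q, G p -> G q -> exists2 r, G r & (r <= p)%O /\ (r <= q)%O].

End Posets.

(* [set: I] is uncountable and embeds into each of its uncountable subsets,
   i.e. I has the least uncountable cardinality. *)
Definition card_aleph1 (I : Type) : Prop :=
  ~ countable [set: I] /\
  forall A : set I, ~ countable A -> ([set: I] #<= A)%card.

Definition MA_aleph1_sigma_linked : Prop :=
  forall (d : Order.disp_t) (P : porderType d),
    [set: P] !=set0 -> sigma_linked P ->
    forall (I : Type) (D : I -> set P),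
      card_aleph1 I -> (forall i, order_dense (D i)) ->
      exists2 G : set P, order_filter G & forall i, G `&` D i !=set0.

(* Main.v *)
(* The idempotents of a reduced product of fields are the indicators of sets of
   integers modulo finite sets, so an isomorphism [Phi] induces an automorphism of
   [P(N)/Fin]. This is induced by a map [f] of the integers, which is then bijective up
   to finite sets. Hence [Phi a] on a set [D] depends only on [a] on [f @` D], up to
   finite sets, and such a [Phi] is given by maps [h n : F (f n) -> G n]. Almost all
   [h n] are isomorphisms, since infinitely many failures could be assembled into
   elements of the product at which [Phi] fails.

   Both liftings, [f] and [h], are found in the same way. Label integers by nodes of
   the binary tree, so that the branches become almost disjoint sets. The axiom [OCA_T],
   applied to triples (branch, subset of it, function), joined when their values
   contradict each other although the functions agree, gives a cover by countably many
   families free of contradictions: an uncountable homogeneous family would consist of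
   restrictions of a single function. By a category argument, all but countably many
   branches then carry a lifting. The partial liftings cohere modulo finite sets. A
   second use of [OCA_T] either covers them by countably many families which cohere
   uniformly, and these are amalgamated by a diagonal argument, or yields an uncountable
   incoherent family. In the latter case [MA_aleph1_sigma_linked] produces a labelling
   such that uncountably many of its branches meet the disagreements of uncountably many
   pairs of the family, which is absurd for a branch that carries a lifting. *)

From HB Require Import structures.
Require Import Defs.
From mathcomp Require Import all_boot all_order all_algebra.
From mathcomp Require Import all_classical all_reals topology.
From mathcomp Require Import zify.

Set Implicit Arguments.
Unset Strict Implicit.
Unset Printing Implicit Defensive.

Local Open Scope classical_set_scope.

(** Three obstacles shape the proof. The Boolean identities of an automorphism of [P(N)/Fin] hold
    off finite sets that depend on the arguments, so at a single integer no algebra is available.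
    Three-colorings cure this: that the images of the three classes partition almost all integers is
    one statement, category makes it uniform, and a rule that sends such colorings to colors
    continuously, class by class, is constant or evaluates at one point; with two colors a majority
    of three points would survive. Next, what is found for [alpha] lives on [alpha] of a branch,
    whereas gluing needs liftings on the branches themselves; so a section of the map found is used,
    and it lifts the inverse [beta]. Finally, when two forcing conditions are merged, many pairs
    need disagreements at once, and an integer cannot serve two branches that split within its
    label. One disagreement per pair is too little: pairs splitting at [k] must have [k.+1]
    disagreements from [k] on, or else a number of them that is the same for all pairs. This is why
    open coloring is used for a sequence of relations. *)

(** * Almost all and infinitely many integers; countability *)

Definition agree {C : Type} (k : nat) (f g : nat -> C) : Prop :=
  forall i, i < k -> f i = g i.

Definition aa (P : nat -> Prop) : Prop := exists N, forall n, N <= n -> P n.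

Definition io (P : nat -> Prop) : Prop := forall N, exists2 n, N <= n & P n.

Lemma agree_refl C k (f : nat -> C) : agree k f f. Proof. by []. Qed.

Lemma agree_sym C k (f g : nat -> C) : agree k f g -> agree k g f.
Proof. by move=> h i /h. Qed.

Lemma agree_trans C k (g f h : nat -> C) : agree k f g -> agree k g h -> agree k f h.
Proof. by move=> fg gh i ik; rewrite fg // gh. Qed.

Lemma agreeW C k j (f g : nat -> C) : j <= k -> agree k f g -> agree j f g.
Proof. by move=> jk h i ij; apply: h; apply: leq_trans jk. Qed.

Lemma agree_mkseq C k (f g : nat -> C) : agree k f g <-> mkseq f k = mkseq g k.
Proof.
split=> [h|h i ik].
  apply: (@eq_from_nth _ (f 0)); rewrite ?size_mkseq // => i ik.
  by rewrite !nth_mkseq // h.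
have := congr1 (fun s => nth (f 0) s i) h.
by rewrite nth_mkseq // nth_mkseq.
Qed.

Definition patch {C : Type} (k : nat) (x y : nat -> C) : nat -> C :=
  fun i => if i < k then x i else y i.

Lemma agree_patch C k (x y : nat -> C) : agree k x (patch k x y).
Proof. by move=> i ik; rewrite /patch ik. Qed.

Lemma aaW (P Q : nat -> Prop) : (forall n, P n -> Q n) -> aa P -> aa Q.
Proof. by move=> PQ [N h]; exists N => n /h /PQ. Qed.

Lemma aaT (P : nat -> Prop) : (forall n, P n) -> aa P.
Proof. by move=> h; exists 0 => n _. Qed.

Lemma aa_and (P Q : nat -> Prop) : aa P -> aa Q -> aa (fun n => P n /\ Q n).
Proof.
move=> [N h] [M g]; exists (maxn N M) => n; rewrite geq_max => /andP[a b].
by split; [exact: h|exact: g].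
Qed.

Lemma aa_ge N : aa (fun n => N <= n). Proof. by exists N. Qed.

Lemma aa_ltn_all K (P : nat -> nat -> Prop) :
  (forall i, i < K -> aa (P i)) -> aa (fun n => forall i, i < K -> P i n).
Proof.
elim: K => [|K IH] h; first exact: aaT.
have /IH hK : forall i, i < K -> aa (P i) by move=> i /ltnW; apply: h.
apply: aaW (aa_and hK (h K (ltnSn K))) => n [h1 h2] i.
by rewrite ltnS leq_eqVlt => /orP[/eqP->|/h1].
Qed.

Lemma not_aa (P : nat -> Prop) : ~ aa P -> io (fun n => ~ P n).
Proof.
move=> h N; apply: contrapT => g; apply: h; exists N => n Nn.
by apply: contrapT => nP; apply: g; exists n.
Qed.

Lemma not_io (P : nat -> Prop) : ~ io P -> aa (fun n => ~ P n).
Proof.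
move=> h; apply: contrapT => /not_aa g; apply: h => N.
by have [n Nn /contrapT] := g N; exists n.
Qed.

Lemma io_aa (P Q : nat -> Prop) : io P -> aa Q -> io (fun n => P n /\ Q n).
Proof.
move=> hP [M hQ] N; have [n] := hP (maxn N M).
by rewrite geq_max => /andP[a b] Pn; exists n => //; split=> //; exact: hQ.
Qed.

Lemma ioW (P Q : nat -> Prop) : (forall n, P n -> Q n) -> io P -> io Q.
Proof. by move=> PQ h N; have [n Nn /PQ] := h N; exists n. Qed.

Lemma aa_io_false (P : nat -> Prop) : aa (fun n => ~ P n) -> io P -> False.
Proof. by move=> h /io_aa/(_ h)/(_ 0)[n _ []]. Qed.

Lemma aa_finite (P : nat -> Prop) : aa P <-> finite_set [set n | ~ P n].
Proof.
split=> [[N h]|h].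
  apply: (@sub_finite_set _ _ `I_N); last exact: finite_II.
  by move=> n /= nP; rewrite ltnNge; apply/negP => /h.
have [N hN] : exists N, forall n, ~ P n -> n < N.
  move/finite_seqP : h => [s hs]; exists (\max_(i <- s) i).+1 => n nP.
  have ns : n \in s by have : [set n | ~ P n] n by []; rewrite hs.
  by rewrite ltnS; exact: leq_bigmax_seq.
by exists N => n Nn; apply: contrapT => /hN; rewrite ltnNge Nn.
Qed.

Lemma countableE T (A : set T) :
  countable A <-> exists f : T -> nat, forall x y, A x -> A y -> f x = f y -> x = y.
Proof.
split=> [/countable_injP[f fi]|[f fi]].
  by exists f => x y Ax Ay; apply: fi; rewrite inE.
by apply/countable_injP; exists f => x y; rewrite !inE; exact: fi.
Qed.

Lemma countableS T (A B : set T) : A `<=` B -> countable B -> countable A.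
Proof.
move=> AB /countableE[f fi]; apply/countableE; exists f => x y Ax Ay.
by apply: fi; exact: AB.
Qed.

Lemma uncountable_pair T (C : countType) (Y : set T) (F : T -> C) :
  ~ countable Y -> exists x y, [/\ Y x, Y y, x <> y & F x = F y].
Proof.
move=> uY; apply: contrapT => h; apply: uY; apply/countableE.
exists (pickle \o F) => x y Yx Yy /(pcan_inj pickleK) e.
by apply: contrapT => nxy; apply: h; exists x, y.
Qed.

Lemma uncountable_pair_rel T (C : countType) (Y : set T) (F : T -> C -> Prop) :
  ~ countable Y -> (forall x, Y x -> exists c, F x c) ->
  exists x y c, [/\ Y x, Y y, x <> y, F x c & F y c].
Proof.
move=> uY h.
have [x0 Yx0] : exists x, Y x.
  by apply: contrapT => h0; apply: uY; apply/countableE; exists (fun=> 0) => x y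
    Yx; case: h0; exists x.
have [c0 _] := h _ Yx0.
have /choice[f fP] : forall x, exists c, Y x -> F x c.
  by move=> x; have [/h[c hc]|nY] := pselect (Y x); [exists c|exists c0].
have [x [y [Yx Yy nxy e]]] := uncountable_pair f uY.
by exists x, y, (f x); split=> //; [|rewrite e]; exact: fP.
Qed.

Lemma uncountable_fiber T (C : countType) (Y : set T) (F : T -> C -> Prop) :
  ~ countable Y -> (forall x, Y x -> exists c, F x c) ->
  exists c, ~ countable [set x | Y x /\ F x c].
Proof.
move=> uY h; apply: contrapT => g; apply: uY.
apply: (@countableS _ _ (\bigcup_(c in [set: C]) [set x | Y x /\ F x c])).
  by move=> x Yx; have [c hc] := h _ Yx; exists c.
apply: bigcup_countable => // c _; apply: contrapT => nc; apply: g; exists c.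
exact: nc.
Qed.

Lemma uncountableD T (A B : set T) :
  ~ countable A -> countable B -> ~ countable [set x | A x /\ ~ B x].
Proof.
move=> uA cB cAB; apply: uA.
apply: (@countableS _ _ (\bigcup_(b in [set: bool])
   (if b then [set x | A x /\ ~ B x] else B))).
  by move=> x Ax; have [Bx|nBx] := pselect (B x); [exists false|exists true].
by apply: bigcup_countable => // -[].
Qed.

Lemma uncountable_ex T (A : set T) : ~ countable A -> exists x, A x.
Proof.
move=> uA; apply: contrapT => h; apply: uA; apply/countableE; exists (fun=> 0).
by move=> x y Ax; case: h; exists x.
Qed.

Lemma uncountable_inj T U (A : set T) (B : set U) (f : T -> U) :
  ~ countable A -> (forall x, A x -> B (f x)) ->
  (forall x y, A x -> A y -> f x = f y -> x = y) -> ~ countable B.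
Proof.
move=> uA AB fi /countableE[h hi]; apply: uA; apply/countableE.
exists (h \o f) => x y Ax Ay /hi e; apply: fi => //; apply: e; exact: AB.
Qed.

(** Run through all pairs [(e, M)], so that each [e] is the target infinitely often, and pick
    strictly increasing [u i], each in the set that is its target; [r] sends [u i] back to that
    target. *)
Lemma io_disjointify (V : nat -> nat -> Prop) :
  (forall e, io (V e)) -> exists r : nat -> nat, forall e, io (fun n => V e n /\ r n = e).
Proof.
move=> hV.
pose tgt i := (odflt (0, 0) (@unpickle (nat * nat)%type i)).1.
have /choice[s hs] : forall Ni : nat * nat, exists n, Ni.1 <= n /\ V (tgt Ni.2) n.
  by move=> [N i]; have [n] := hV (tgt i) N; exists n.
pose u := fix u i := if i is j.+1 then s ((u j).+1, i) else s (0, 0).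
have uV i : V (tgt i) (u i).
  by case: i => [|i] /=; [case: (hs (0,0))|case: (hs ((u i).+1, i.+1))].
have uS i : u i < u i.+1 by rewrite /=; case: (hs ((u i).+1, i.+1)).
have umono i j : i < j -> u i < u j.
  elim: j => // j IH; rewrite ltnS leq_eqVlt => /orP[/eqP->|/IH h] //.
  exact: ltn_trans h _.
have uge i : i <= u i by elim: i => // i IH; apply: leq_ltn_trans IH (uS i).
have uinj i j : u i = u j -> i = j.
  by case: (ltngtP i j) => // /umono; lia.
have /choice[r hr] : forall n, exists e, forall i, u i = n -> tgt i = e.
  move=> n; have [[i ui]|h] := pselect (exists i, u i = n).
    by exists (tgt i) => j uj; congr tgt; apply: uinj; rewrite ui.
  by exists 0 => i ui; case: h; exists i.
exists r => e N; pose pk M := @pickle (nat * nat)%type (e, M).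
have ti M : tgt (pk M) = e by rewrite /tgt pickleK.
have [M hM] : exists M, N <= pk M.
  apply: contrapT => h.
  have hlt M : pk M < N by rewrite ltnNge; apply/negP => ?; apply: h; exists M.
  have inj : injective (fun M : 'I_N.+1 => Ordinal (hlt M)).
    by move=> a b /(congr1 val) /= /(pcan_inj pickleK) [] /val_inj.
  by have := leq_card _ inj; rewrite !card_ord ltnn.
exists (u (pk M)); first exact: leq_trans hM (uge _).
by split; [rewrite -{1}(ti M); exact: uV|rewrite -(hr _ _ erefl) ti].
Qed.

(** * Open coloring for sequences of relations *)

Section CodeSpace.
Import Order.TTheory GRing.Theory Num.Theory.
Variables (R : realType) (C : countType) (P : set (nat -> C)).

Definition code_space : Type := {classic {f : nat -> C | P f}}.

HB.instance Definition _ := Choice.on code_space.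

Let seqof (x : code_space) : nat -> C := sval (x : {f : nat -> C | P f}).

Let delta (x y : code_space) : nat :=
  if pselect (exists n, `[< seqof x n <> seqof y n >]) is left h
  then ex_minn h else 0.

Let seqof_inj x y : seqof x = seqof y -> x = y.
Proof. by case: x y => [x px] [y py] /= e; apply: eq_exist. Qed.

(** An ultrametric: sequences that first differ at [n] have distance [1 / n.+1], so the closed ball
    of radius [1 / k.+1] is the cylinder of sequences with the same values below [k]. *)
Definition code_dist (x y : code_space) : R :=
  if `[< x = y >] then 0%R else ((delta x y).+1%:R^-1)%R.

Let code_dist_agree k x y :
  (code_dist x y <= k.+1%:R^-1)%R <-> agree k (seqof x) (seqof y).
Proof.
rewrite /code_dist; case: asboolP => [->|nxy]; first by rewrite invr_ge0 ler0n.
rewrite /delta; case: pselect => [h|h]; last first.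
  by case: nxy; apply: seqof_inj; apply/funext => n; apply: contrapT => g; apply: h;
    exists n; apply/asboolP.
case: ex_minnP => m /asboolP hm hmin.
rewrite lef_pV2 ?posrE ?ltr0n // ler_nat ltnS; split=> [km i ik|hk].
  apply: contrapT => g; have := hmin i (introT (asboolP _) g); lia.
by rewrite leqNgt; apply/negP => mk; apply: hm; exact: hk.
Qed.

Let code_distxx x : code_dist x x = 0%R.
Proof. by rewrite /code_dist; case: asboolP. Qed.

Let code_dist_pos x y : code_dist x y = 0%R -> x = y.
Proof.
rewrite /code_dist; case: asboolP => // _ /eqP.
by rewrite invr_eq0 pnatr_eq0.
Qed.

Let code_dist_sym x y : code_dist x y = code_dist y x.
Proof.
suff h u v : (code_dist u v <= code_dist v u)%R by apply: le_anti; rewrite !h.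
have [->//|nuv] := pselect (u = v).
rewrite {2}/code_dist; case: asboolP => [/esym//|_].
apply/code_dist_agree/agree_sym/code_dist_agree.
by rewrite /code_dist; case: asboolP => [/esym//|_].
Qed.

Let code_dist_tri y x z : (code_dist x z <= code_dist x y + code_dist y z)%R.
Proof.
have dE u v : u = v \/ exists k, code_dist u v = (k.+1%:R^-1)%R.
  by rewrite /code_dist; case: asboolP => [|_]; [left|right; exists (delta u v)].
have [->|[j hj]] := dE x y; first by rewrite code_distxx add0r.
have [->|[k hk]] := dE y z; first by rewrite code_distxx addr0.
have axy : agree j (seqof x) (seqof y) by apply/code_dist_agree; rewrite hj.
have ayz : agree k (seqof y) (seqof z) by apply/code_dist_agree; rewrite hk.
have axz : (code_dist x z <= (minn j k).+1%:R^-1)%R.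
  by apply/code_dist_agree; apply: agree_trans (agreeW _ axy) (agreeW _ ayz);
    [exact: geq_minl|exact: geq_minr].
apply: le_trans axz _; rewrite hj hk; rewrite minnE.
have [jk|kj] := leqP j k.
  by rewrite (_ : j - (j - k) = j) ?lerDl ?invr_ge0 ?ler0n //; lia.
by rewrite (_ : j - (j - k) = k) ?lerDr ?invr_ge0 ?ler0n //; lia.
Qed.

HB.instance Definition _ := isMetric.Build R code_space
  code_distxx code_dist_pos code_dist_sym code_dist_tri.

Lemma code_space_separable : separable code_space.
Proof.
have [[x0]|nX] := pselect (exists x : code_space, True); last first.
  exists set0; first exact: countable0.
  by move=> O [x _]; case: nX; exists x.
have /choice[e he] : forall s : seq C, exists x : code_space,
    (exists y : code_space, mkseq (seqof y) (size s) = s) ->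
    mkseq (seqof x) (size s) = s.
  move=> s; have [[y hy]|h] := pselect (exists y : code_space,
    mkseq (seqof y) (size s) = s); by [exists y|exists x0].
exists (range e).
  apply: sub_countable (card_image_le _ _) _; exact: countableP.
move=> O [x Ox] oO.
have /nbhs_ballP[d /= d0 hd] : nbhs x O by apply: open_nbhs_nbhs.
have [k hk] : exists k, (k.+1%:R^-1 < d)%R.
  have := @archimedean.Num.Theory.truncnS_gt R (d^-1)%R => h.
  exists (archimedean.Num.trunc d^-1%R); rewrite invf_plt ?posrE ?ltr0n //.
pose y := e (mkseq (seqof x) k); exists y; split; last by exists (mkseq (seqof x) k).
apply: hd; rewrite ballEmdist /=; apply: le_lt_trans hk.
apply/code_dist_agree/agree_mkseq.
have := he (mkseq (seqof x) k); rewrite size_mkseq => -> //; by exists x.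
Qed.

Lemma code_space_open (K : set (code_space * code_space)) :
  (forall x y, K (x, y) -> exists k, forall x' y', agree k (seqof x) (seqof x') ->
     agree k (seqof y) (seqof y') -> K (x', y')) -> open K.
Proof.
move=> h; rewrite openE => -[x y] /h[k hk].
have k0 : (0 < k.+1%:R^-1 :> R)%R by rewrite invr_gt0 ltr0n.
exists (ball x k.+1%:R^-1%R, ball y k.+1%:R^-1%R); first by split; exact: nbhsx_ballx.
move=> [x' y'] [/= ]; rewrite !ballEmdist /= => /ltW bx /ltW by'.
by apply: hk; apply/code_dist_agree.
Qed.

End CodeSpace.

(** The points of the space are the codes. Elements with equal codes are never related, since [K]
    passes along equal codes and is irreflexive; so a choice of one element per code loses
    nothing. *)
Lemma OCA_coded (R : realType) (hOCA : OCA_T R) (T : Type) (C : countType)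
    (code : T -> nat -> C) (K : T -> T -> Prop) :
  (forall x y, K x y -> K y x) -> (forall x, ~ K x x) ->
  (forall x y, K x y -> exists k, forall x' y', agree k (code x) (code x') ->
     agree k (code y) (code y') -> K x' y') ->
  (exists2 Y : set T, ~ countable Y & forall x y, Y x -> Y y -> x <> y -> K x y) \/
  (exists2 Z : nat -> set T, (forall x, exists n, Z n x) &
     forall n x y, Z n x -> Z n y -> ~ K x y).
Proof.
move=> Ksym Kirr Kopen.
pose P f := exists x, code x = f.
pose X := code_space P.
pose seqof (u : X) : nat -> C := sval (u : {f | P f}).
have Kcode x y x' y' : code x = code x' -> code y = code y' -> K x y -> K x' y'.
  by move=> ex ey /Kopen[k]; apply; rewrite ?ex ?ey.
pose emb (x : T) : X := exist P (code x) (ex_intro _ x erefl).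
have /choice[rep hrep] : forall u : X, exists x, code x = seqof u.
  by move=> [f [x hx]]; exists x.
have embrep u : emb (rep u) = u.
  case: u (hrep u) => [f pf] /= h; rewrite /emb; apply: eq_exist; exact: h.
pose K0 : set (X * X) := [set uv | K (rep uv.1) (rep uv.2)].
have K0emb x y : K0 (emb x, emb y) <-> K x y.
  by split; apply: Kcode => //=; rewrite !hrep.
have oK : @open_pairs R X K0.
  split=> [|u v|u]; [|exact: Ksym|exact: Kirr].
  apply: (@code_space_open R) => u v /= /Kopen[k hk]; exists k => u' v' uu' vv'.
  by apply: hk; rewrite !hrep.
have [[Y uY hY]|[Z cZ hZ]] := hOCA X K0 (code_space_separable R P) oK.
  left; exists (rep @` Y) => [cY|_ _ [u Yu <-] [v Yv <-] nuv].
    apply: uY; apply: countableS (_ : Y `<=` emb @` (rep @` Y)) _.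
      by move=> u Yu; exists (rep u); [exists u|].
    exact: sub_countable (card_image_le _ _) cY.
  by apply: hY => // e; apply: nuv; rewrite e.
right; exists (fun n => [set x | Z n (emb x)]) => [x|n x y Zx Zy Kxy].
  have : [set: X] (emb x) by []. by rewrite -cZ => -[n _ h]; exists n.
have [e|e] := pselect (emb x = emb y); last by apply: (hZ _ _ _ Zx Zy e); apply/K0emb.
by have /K0emb := Kxy; rewrite e => /K0emb /Kirr.
Qed.

(** * Baire category *)

Section Category.
Variable A : Type.
Implicit Types (H M : set (nat -> A)) (x y z : nat -> A).

(** Here and below a pair [k], [x] stands for the cylinder of sequences that agree with [x] below
    [k]; the topology is the product of discrete ones. *)
Definition dense_at H k x : Prop :=
  forall j y, k <= j -> agree k x y -> exists2 z, agree j y z & H z.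

Definition nowhere_dense H : Prop :=
  forall k x, exists j y, [/\ k <= j, agree k x y & forall z, agree j y z -> ~ H z].

Definition meager M : Prop :=
  exists2 N : nat -> set (nat -> A), (forall j, nowhere_dense (N j)) &
    forall z, M z -> exists j, N j z.

Definition heavy H k x : Prop :=
  forall j y, k <= j -> agree k x y -> ~ meager [set z | H z /\ agree j y z].

Lemma not_nowhere_dense H : ~ nowhere_dense H -> exists k x, dense_at H k x.
Proof.
move=> h; apply: contrapT => g; apply: h => k x.
apply: contrapT => h; apply: g; exists k, x => j y kj xy.
by apply: contrapT => g; apply: h; exists j, y; split=> // z yz Hz; apply: g; exists z.
Qed.

Lemma baire (N : nat -> set (nat -> A)) k x :
  (forall j, nowhere_dense (N j)) -> exists2 z, agree k x z & forall j, ~ N j z.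
Proof.
move=> hN.
have /choice[s hs] : forall u : nat * (nat * (nat -> A)), exists v : nat * (nat -> A),
   [/\ u.2.1 < v.1, agree u.2.1 u.2.2 v.2 & forall z, agree v.1 v.2 z -> ~ N u.1 z].
  move=> [i [j y]]; have [l [w [jl yw hw]]] := hN i j.+1 y.
  exists (l, w); split=> //=; exact: agreeW yw.
pose u := fix u i := if i is j.+1 then s (j, u j) else (k, x).
have uS i : [/\ (u i).1 < (u i.+1).1, agree (u i).1 (u i).2 (u i.+1).2 &
   forall z, agree (u i.+1).1 (u i.+1).2 z -> ~ N i z] by case: (hs (i, u i)).
have uge i : i + k <= (u i).1.
  by elim: i => // i IH; have [h _ _] := uS i; apply: leq_ltn_trans h.
have umono i j : i <= j -> (u i).1 <= (u j).1.
  move=> /subnKC <-; elim: (j - i) => [|d IHd]; first by rewrite addn0.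
  rewrite addnS; have [h2 _ _] := uS (i + d).
  by apply: leq_trans IHd _; apply: ltnW.
have uagree i j : i <= j -> agree (u i).1 (u i).2 (u j).2.
  elim: j => [|j IH]; first by rewrite leqn0 => /eqP ->.
  rewrite leq_eqVlt => /orP[/eqP->//|]; rewrite ltnS => ij.
  have [h h' _] := uS j; apply: agree_trans (IH ij) (agreeW _ h').
  exact: umono.
pose z n := (u n.+1).2 n.
have zu i : agree (u i).1 (u i).2 z.
  move=> n ni; rewrite /z; have [h|h] := leqP i n.+1; first exact: uagree.
  apply/esym/(uagree _ _ (ltnW h)); have := uge n.+1; lia.
exists z => [|j Nj]; first exact: (zu 0).
by have [_ _ h] := uS j; apply: (h z) => //; exact: zu.
Qed.

Lemma baire_meager M k x : meager M -> exists2 z, agree k x z & ~ M z.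
Proof.
move=> [N hN MN]; have [z xz nN] := baire k x hN; exists z => // /MN[j].
exact: nN.
Qed.

Lemma meagerS H M : H `<=` M -> meager M -> meager H.
Proof. by move=> HM [N hN MN]; exists N => // z /HM /MN. Qed.

Lemma nowhere_dense_meager H : nowhere_dense H -> meager H.
Proof. by move=> h; exists (fun=> H) => // z; exists 0. Qed.

Lemma nowhere_dense0 : nowhere_dense set0.
Proof. by move=> k x; exists k, x; split=> // z _ []. Qed.

Lemma meager0 : meager set0. Proof. exact/nowhere_dense_meager/nowhere_dense0. Qed.

Lemma meager_bigcup (C : countType) (M : C -> set (nat -> A)) :
  (forall c, meager (M c)) -> meager [set z | exists c, M c z].
Proof.
move=> hM; have /choice[N hN] : forall c, exists N : nat -> set (nat -> A),
   (forall j, nowhere_dense (N j)) /\ forall z, M c z -> exists j, N j z.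
  by move=> c; have [N h1 h2] := hM c; exists N.
exists (fun n => if @unpickle (C * nat)%type n is Some cj then N cj.1 cj.2 else set0).
  move=> n; case: unpickle => [[c j]|]; last exact: nowhere_dense0.
  exact: (hN c).1.
move=> z [c /(hN c).2[j Nj]]; exists (@pickle (C * nat)%type (c, j)).
by rewrite pickleK.
Qed.

Lemma meagerU M M' : meager M -> meager M' -> meager (M `|` M').
Proof.
move=> h h'; apply: meagerS (@meager_bigcup _ (fun b : bool => if b then M else M') _).
  by move=> z [?|?]; [exists true|exists false].
by case.
Qed.

Lemma dense_at_ex H k x : dense_at H k x -> exists2 z, agree k x z & H z.
Proof. by move=> /(_ k x (leqnn k) (@agree_refl _ _ _)). Qed.

Lemma dense_atS H H' k x : H `<=` H' -> dense_at H k x -> dense_at H' k x.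
Proof. by move=> HH h j y kj xy; have [z yz /HH] := h j y kj xy; exists z. Qed.

Lemma heavy_sub H k x j y : k <= j -> agree k x y -> heavy H k x -> heavy H j y.
Proof.
move=> kj xy h l z jl yz; apply: h; first exact: leq_trans jl.
exact: agree_trans xy (agreeW kj yz).
Qed.

Lemma heavy_diff H k x M : heavy H k x -> meager M -> exists2 z, agree k x z & H z /\ ~ M z.
Proof.
move=> h hM; apply: contrapT => g; apply: (h k x) => //.
apply: meagerS hM => z /= [Hz xz]; apply: contrapT => nM; apply: g.
by exists z.
Qed.

Lemma heavy_dense H k x : heavy H k x -> dense_at H k x.
Proof.
move=> h j y kj xy; have [z yz [Hz _]] := heavy_diff (heavy_sub kj xy h) meager0.
by exists z.
Qed.

End Category.

(** Some piece [H] is nonmeager. Its points with a neighborhood in which [H] is meager form a meager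
    set, there being countably many cylinders. The remaining points are dense in some cylinder, and
    inside it [H] is nonmeager everywhere. *)
Lemma nonmeager_heavy (A C : countType) (R : set (nat -> A)) (Q : C -> set (nat -> A)) :
  ~ meager R -> (forall z, R z -> exists c, Q c z) ->
  exists c k x, heavy [set z | R z /\ Q c z] k x.
Proof.
move=> nR RQ.
have [c nH] : exists c, ~ meager [set z | R z /\ Q c z].
  apply: contrapT => h; apply: nR.
  apply: meagerS (@meager_bigcup _ C (fun c => [set z | R z /\ Q c z]) _).
    by move=> z Rz; have [c Qc] := RQ z Rz; exists c.
  by move=> c; apply: contrapT => g; apply: h; exists c.
set H := [set z | R z /\ Q c z] in nH *.
pose light := [set z | H z /\ exists k, meager [set w | H w /\ agree k z w]].
have mlight : meager light.
  pose M (s : seq A) := [set z | [/\ H z, mkseq z (size s) = s &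
     meager [set w | H w /\ agree (size s) z w]]].
  apply: meagerS (@meager_bigcup _ (seq A) M _).
    move=> z [Hz [k mk]]; exists (mkseq z k); split=> //; first by rewrite size_mkseq.
    by rewrite size_mkseq.
  move=> s; have [[z0 [Hz0 z0s mz0]]|nz] := pselect (exists z, M s z); last first.
    by apply: meagerS (@meager0 _) => z Mz; apply: nz; exists z.
  apply: meagerS mz0 => z [Hz zs _]; split=> //.
  by apply/agree_mkseq; rewrite zs.
have [k [x hx]] : exists k x, dense_at [set z | H z /\ ~ light z] k x.
  apply: not_nowhere_dense => /nowhere_dense_meager h; apply: nH.
  apply: meagerS (meagerU h mlight) => z Hz.
  by have [l|l] := pselect (light z); [right|left].
exists c, k, x => j y kj xy mj.
have [z yz [Hz nl]] := hx j y kj xy; apply: nl; split=> //; exists j.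
apply: meagerS mj => w [Hw zw]; split=> //; exact: agree_trans yz zw.
Qed.

Lemma cover_dense_at (A C : countType) (Q : C -> set (nat -> A)) (x0 : nat -> A) :
  (forall z, exists c, Q c z) -> exists c k x, dense_at (Q c) k x.
Proof.
move=> hQ; have nT : ~ meager [set: nat -> A].
  by move=> /(baire_meager 0 x0)[z _]; apply.
have [c [k [x /heavy_dense h]]] := nonmeager_heavy nT (fun z _ => hQ z).
by exists c, k, x; apply: dense_atS h => z [].
Qed.

(* Todorcevic's axiom yields its uniform version for a sequence of open
   relations: apply it to pairs [(x, p)] with [x] in the Cantor space, joined
   according to the relation whose index is the place where the reals split. *)
Lemma OCA_splitting (R : realType) (hOCA : OCA_T R) (T : Type) (C : countType)
    (code : T -> nat -> C) (K : nat -> T -> T -> Prop) :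
  (forall k x y, K k x y -> K k y x) ->
  (forall k x y, K k x y -> exists l, forall x' y', agree l (code x) (code x') ->
     agree l (code y) (code y') -> K k x' y') ->
  (exists2 Y : set ((nat -> bool) * T), ~ countable Y &
     forall u v, Y u -> Y v -> u <> v ->
       exists k, [/\ agree k u.1 v.1, u.1 k <> v.1 k & K k u.2 v.2]) \/
  (exists2 Z : nat -> set T, (forall x, exists n, Z n x) &
     forall n, exists k, forall x y, Z n x -> Z n y -> ~ K k x y).
Proof.
move=> Ksym Kopen.
pose T' := ((nat -> bool) * T)%type.
pose K' (u v : T') := exists k, [/\ agree k u.1 v.1, u.1 k <> v.1 k & K k u.2 v.2].
pose code' (u : T') n : bool * C := (u.1 n, code u.2 n).
have [| | |[Y uY hY]|[Z cZ hZ]] := @OCA_coded R hOCA T' _ code' K'.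
- move=> u v [k [h1 h2 h3]]; exists k; split; first exact: agree_sym.
    exact: nesym.
  exact: Ksym.
- by move=> u [k [_]].
- move=> u v [k [h1 h2 /Kopen[l hl]]]; exists (maxn k.+1 l) => u' v' uu' vv'.
  have e1 i : i < maxn k.+1 l -> u.1 i = u'.1 i by move=> /uu' [].
  have e2 i : i < maxn k.+1 l -> v.1 i = v'.1 i by move=> /vv' [].
  exists k; split.
  + move=> i ik; rewrite -e1 ?leq_max ?(ltnW ik) // -?e2 ?h1 // ?leq_max;
    by rewrite ltnS (ltnW ik).
  + by rewrite -e1 ?leq_max ?leqnn // -e2 ?leq_max ?leqnn.
  + apply: hl => i il.
      by have /uu'[] : i < maxn k.+1 l by rewrite leq_max il orbT.
    by have /vv'[] : i < maxn k.+1 l by rewrite leq_max il orbT.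
- by left; exists Y.
right.
(* By category in the Cantor factor, each [p] has a piece [m] whose section is dense over a cylinder
   [s]; the pair names the class of [p]. *)
pose E (ms : nat * seq bool) : set T := [set p |
  forall j y, size ms.2 <= j -> mkseq y (size ms.2) = ms.2 ->
    exists2 z : nat -> bool, agree j y z & Z ms.1 (z, p)].
exists (fun n => if unpickle n is Some ms then E ms else set0).
  move=> p; have [m [k [x hx]]] := @cover_dense_at bool nat
    (fun m => [set z | Z m (z, p)]) (fun=> false) (fun z => cZ (z, p)).
  exists (pickle (m, mkseq x k)); rewrite pickleK /E /= size_mkseq => j y kj.
  by move=> /agree_mkseq/agree_sym; exact: hx.
move=> n; case: unpickle => [[m s]|]; last by exists 0.
exists (size s) => p q Ep Eq Kpq.
(* Two reals that continue [s] with different bits split exactly at [size s], the index of the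
   relation that is to fail. *)
pose x b i := if i < size s then nth false s i else b.
have xs b : mkseq (x b) (size s) = s.
  apply: (@eq_from_nth _ false); rewrite size_mkseq // => i si.
  by rewrite nth_mkseq // /x si.
have [z xz Zz] := Ep (size s).+1 (x true) (leqnSn _) (xs _).
have [w xw Zw] := Eq (size s).+1 (x false) (leqnSn _) (xs _).
apply: (hZ m _ _ Zz Zw); exists (size s); split=> //=.
  by move=> i si; rewrite -xz ?ltnS 1?ltnW // -xw ?ltnS 1?ltnW // /x si.
by rewrite -xz // -xw // /x ltnn.
Qed.

(** * Liftings on the branches of a tree *)

Definition finite_fibers (g : nat -> option (seq bool)) : Prop :=
  forall t, aa (fun n => g n <> Some t).

(* The branch of the tree-like almost disjoint family given by [g]. *)
Definition branch (g : nat -> option (seq bool)) (x : nat -> bool) (n : nat) : bool :=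
  if g n is Some t then t == mkseq x (size t) else false.

(** A common integer has a label of length at most [k], since a longer one would see the splitting;
    there remain the [k.+1] short initial segments of [x], each used finitely often. That the bound
    depends only on [x] and [k] makes [conflict] open. *)
Lemma branch_bound g : finite_fibers g -> forall x k, exists K, forall x' y' n,
  agree k x x' -> agree k x y' -> x' k <> y' k -> branch g x' n -> branch g y' n -> n < K.
Proof.
move=> hg x k.
have [K hK] : aa (fun n => forall i, i < k.+1 -> g n <> Some (mkseq x i)).
  by apply: aa_ltn_all => i _; exact: hg.
exists K => x' y' n xx' xy' nx'y'; rewrite /branch; case gn: (g n) => [t|//].
move=> /eqP tx' /eqP ty'; rewrite ltnNge; apply/negP => Kn.
have [tk|kt] := leqP (size t) k.
  apply: (hK n Kn (size t)); rewrite ?ltnS // gn {1}tx'; congr Some.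
  by apply/agree_mkseq/agree_sym/(agreeW tk).
apply: nx'y'; have : agree (size t) x' y' by apply/agree_mkseq; rewrite -tx' -ty'.
exact.
Qed.

Lemma split_ex (x y : nat -> bool) : x <> y -> exists2 k, agree k x y & x k <> y k.
Proof.
move=> nxy; have h : exists n, `[< x n <> y n >].
  apply: contrapT => h; apply: nxy; apply/funext => n; apply: contrapT => g.
  by apply: h; exists n; apply/asboolP.
case: (ex_minnP h) => k /asboolP hk hmin; exists k => // i ik.
apply: contrapT => g; have := hmin i (introT (asboolP _) g); lia.
Qed.

Lemma branch_almost_disjoint g x y : finite_fibers g -> x <> y ->
  exists K, forall n, branch g x n -> branch g y n -> n < K.
Proof.
move=> hg /split_ex[k xy nxy]; have [K hK] := branch_bound hg x k.
by exists K => n; apply: hK.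
Qed.

(** * Covers without conflicts *)

Section BranchCover.
Variables (R : realType) (hOCA : OCA_T R) (g : nat -> option (seq bool)).
Variables (S S' : countType) (phi : (nat -> S) -> nat -> S').
Variable sigma : (nat -> bool) -> nat -> bool.
Hypothesis fg : finite_fibers g.
Hypothesis phi_sigma : forall (D : nat -> bool) a b, (forall n, D n -> a n = b n) ->
  aa (fun n => sigma D n -> phi a n = phi b n).

Let T := ((nat -> bool) * (nat -> bool) * (nat -> S))%type.

Definition support (x D : nat -> bool) : nat -> bool := fun n => branch g x n && D n.

Definition conflict (u v : T) : Prop := exists k,
  [/\ agree k u.1.1 v.1.1, u.1.1 k <> v.1.1 k,
      forall n, branch g u.1.1 n -> branch g v.1.1 n ->
        u.1.2 n = v.1.2 n /\ (u.1.2 n -> u.2 n = v.2 n)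
    & exists n, [/\ sigma (support u.1.1 u.1.2) n, sigma (support v.1.1 v.1.2) n
        & phi u.2 n <> phi v.2 n]].

(** The values of [phi] and [sigma] belong to the code because neither map is continuous; with them
    [conflict] becomes an open relation. *)
Let code (u : T) n := (u.1.1 n, u.1.2 n, u.2 n, phi u.2 n, sigma (support u.1.1 u.1.2) n).

(* All the functions of a homogeneous family are restrictions of a single one,
   so an uncountable one contains two which agree with it from the same place on. *)
Lemma no_uncountable_conflict (Y : set T) : ~ countable Y ->
  (forall u v, Y u -> Y v -> u <> v -> conflict u v) -> False.
Proof.
move=> uY hY.
have [u0 _] := uncountable_ex uY.
have /choice[c hc] : forall n, exists s, forall u, Y u -> support u.1.1 u.1.2 n -> u.2 n = s.
  move=> n; have [[u [Yu un]]|h] := pselect (exists u, Y u /\ support u.1.1 u.1.2 n).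
    exists (u.2 n) => v Yv vn; have [->//|nvu] := pselect (v = u).
    have [k [_ _ h _]] := hY _ _ Yv Yu nvu.
    move: un vn => /andP[ux uD] /andP[vx vD].
    by have [_ /(_ vD)] := h n vx ux.
  by exists (u0.2 0) => u Yu un; case: h; exists u.
have hl u : Y u -> exists lw, agree lw.1 (phi u.2) (fun i => nth (phi u.2 0) lw.2 i) /\
    size lw.2 = lw.1 /\
    forall n, lw.1 <= n -> sigma (support u.1.1 u.1.2) n -> phi c n = phi u.2 n.
  move=> Yu; have [l hl] := @phi_sigma (support u.1.1 u.1.2) c u.2
    (fun n un => esym (hc n u Yu un)).
  exists (l, mkseq (phi u.2) l); split=> [i /= il|]; first by rewrite nth_mkseq.
  by rewrite size_mkseq; split.
have [u [v [[l w] [Yu Yv nuv [au [su hu]] [av [sv hv]]]]]] := uncountable_pair_rel uY hl.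
have [k [_ _ _ [n [un vn e]]]] := hY u v Yu Yv nuv.
apply: e; have [ln|nl] := leqP l n; first by rewrite -hu // -hv.
by rewrite (au n nl) (av n nl); apply: set_nth_default; rewrite [size _]su.
Qed.

Lemma conflict_cover : exists2 H : nat -> set T,
  (forall u, exists m, H m u) & forall m u v, H m u -> H m v -> ~ conflict u v.
Proof.
have [| | |[Y uY hY]|//] := @OCA_coded R hOCA T _ code conflict.
- move=> u v [k [h1 h2 h3 [n [n1 n2 n3]]]]; exists k; split.
  + exact: agree_sym.
  + exact: nesym.
  + by move=> i vi ui; have [e1 e2] := h3 i ui vi; split=> // Di; rewrite e2 // e1.
  + by exists n; split=> //; exact: nesym.
- by move=> u [k [_]].
- move=> u v [k [h1 h2 h3 [n [n1 n2 n3]]]].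
  have [K hK] := branch_bound fg u.1.1 k.
  exists (maxn K (maxn k n)).+1 => u' v' uu' vv'.
  set L := (maxn _ _).+1 in uu' vv'.
  have hu i : i < L -> [/\ u.1.1 i = u'.1.1 i, u.1.2 i = u'.1.2 i, u.2 i = u'.2 i,
     phi u.2 i = phi u'.2 i & sigma (support u.1.1 u.1.2) i = sigma (support u'.1.1 u'.1.2) i].
    by move=> /uu'[].
  have hv i : i < L -> [/\ v.1.1 i = v'.1.1 i, v.1.2 i = v'.1.2 i, v.2 i = v'.2 i,
     phi v.2 i = phi v'.2 i & sigma (support v.1.1 v.1.2) i = sigma (support v'.1.1 v'.1.2) i].
    by move=> /vv'[].
  have kL : k < L by rewrite /L; lia.
  have nL : n < L by rewrite /L; lia.
  have [ku _ _ _ _] := hu k kL; have [kv _ _ _ _] := hv k kL.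
  have au : agree k u.1.1 u'.1.1 by move=> i ik; have [] := hu i (ltn_trans ik kL).
  have av : agree k v.1.1 v'.1.1 by move=> i ik; have [] := hv i (ltn_trans ik kL).
  exists k; split.
  + exact: agree_trans (agree_sym au) (agree_trans h1 av).
  + by rewrite -ku -kv.
  + move=> i ui vi.
    (* Only integers below [K] are common to the new branches, and their labels have length at most
       [k], where old and new reals agree. So the clause on common integers is inherited. *)
    have iK : i < K.
      apply: (hK u'.1.1 v'.1.1) => //; first exact: agree_trans h1 av.
      by rewrite -ku -kv.
    have iL : i < L by rewrite /L; lia.
    have brE (y y' : nat -> bool) : agree k y y' -> y k = y' k -> branch g y' i ->
        (forall t, g i = Some t -> size t <= k) -> branch g y i.
      move=> yy' _; rewrite /branch; case: (g i) => // t /eqP e ht.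
      apply/eqP; rewrite {1}e; apply/agree_mkseq/agree_sym.
      exact: agreeW (ht t erefl) yy'.
    have ht t : g i = Some t -> size t <= k.
      move=> gi; rewrite leqNgt; apply/negP => kt.
      move: ui vi; rewrite /branch gi => /eqP e1 /eqP e2.
      have : agree (size t) u'.1.1 v'.1.1 by apply/agree_mkseq; rewrite -e1 -e2.
      by move=> /(_ k kt); rewrite -ku -kv.
    have [e1 e2] := h3 i (brE _ _ au ku ui ht) (brE _ _ av kv vi ht).
    have [_ eu1 eu2 _ _] := hu i iL; have [_ ev1 ev2 _ _] := hv i iL.
    by rewrite -eu1 -ev1 -eu2 -ev2.
  + have [_ _ _ eu1 eu2] := hu n nL; have [_ _ _ ev1 ev2] := hv n nL.
    by exists n; rewrite -eu1 -eu2 -ev1 -ev2.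
- by case: (no_uncountable_conflict uY hY).
Qed.

End BranchCover.

(** * Coordinatewise liftings on a branch *)

Section LocalCoordinatewise.
Variables (R : realType) (hOCA : OCA_T R) (g : nat -> option (seq bool)).
Variable phi : (nat -> nat) -> nat -> nat.
Hypothesis fg : finite_fibers g.
Hypothesis phi_coord : forall (D : nat -> bool) a b, (forall n, D n -> a n = b n) ->
  aa (fun n => D n -> phi a n = phi b n).

(** Given a common index [e] on two different branches, density of the sections lets both sets [D]
    be cut down to one common integer [n] beyond the cylinder. Absence of conflicts then makes the
    value at [n] depend only on [e], [n] and [a n], and it can be read off from another branch. *)
Lemma coordinatewise_on_branch (Z : set (nat -> bool)) : ~ countable Z ->
  exists2 x, Z x & exists h : nat -> nat -> nat,
    forall a, aa (fun n => branch g x n -> phi a n = h n (a n)).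
Proof.
move=> uZ.
have [H cH hH] := @conflict_cover R hOCA g nat nat phi id fg phi_coord.
pose I := (nat * seq bool * seq nat)%type.
pose E (e : I) (x : nat -> bool) (a : nat -> nat) := mkseq a (size e.1.2) = e.2 /\
  forall j y, size e.1.2 <= j -> mkseq y (size e.1.2) = e.1.2 ->
    exists2 D, agree j y D & H e.1.1 (x, D, a).
have hE x a : exists e, E e x a.
  have [m [k [s hs]]] := @cover_dense_at bool nat
    (fun m => [set D | H m (x, D, a)]) (fun=> false) (fun D => cH (x, D, a)).
  exists (m, mkseq s k, mkseq a k); rewrite /E /= size_mkseq; split=> // j y kj.
  by move=> /agree_mkseq/agree_sym; exact: hs.
have EE e x y a b n : E e x a -> E e y b -> x <> y -> branch g x n -> branch g y n ->
    size e.1.2 <= n -> a n = b n -> phi a n = phi b n.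
  move=> [ae He] [be He'] nxy xn yn en ab; apply: contrapT => nphi.
  have [K hK] := branch_almost_disjoint fg nxy.
  set s := e.1.2 in ae be He He' en.
  (* Beyond the cylinder [D0] contains only [n], so [a] and [b] need not agree at other common
     integers; inside it they agree by [ae] and [be]. *)
  pose D0 i := if i < size s then nth false s i else i == n.
  have D0s : mkseq D0 (size s) = s.
    apply: (@eq_from_nth _ false); rewrite size_mkseq // => i si.
    by rewrite nth_mkseq // /D0 si.
  have [D D0D HD] := He (maxn (size s) (maxn n.+1 K)) D0 (leq_maxl _ _) D0s.
  have [D' D0D' HD'] := He' (maxn (size s) (maxn n.+1 K)) D0 (leq_maxl _ _) D0s.
  apply: (hH _ _ _ HD HD'); have [k xy nk] := split_ex nxy; exists k; split=> //=.
    move=> i xi yi; have iK := hK i xi yi.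
    rewrite -(D0D i) ?leq_max ?iK ?orbT // -(D0D' i) ?leq_max ?iK ?orbT //; split=> //.
    rewrite /D0; case: ifP => [si _|_ /eqP -> //].
    by apply: (iffRL (agree_mkseq (size s) a b)) => //; rewrite ae.
  have nm : n < maxn (size s) (maxn n.+1 K) by rewrite !leq_max ltnSn orbT.
  exists n; rewrite /support /= xn yn -(D0D n nm) -(D0D' n nm) /D0 ltnNge en /=.
  by rewrite eqxx; split.
pose P (i : I * nat * nat) (yb : (nat -> bool) * (nat -> nat)) :=
  [/\ E i.1.1 yb.1 yb.2, branch g yb.1 i.1.2 & yb.2 i.1.2 = i.2].
have /choice[rep hrep] : forall i, exists yb, (exists yb', P i yb') -> P i yb.
  move=> i; have [[yb hyb]|h] := pselect (exists yb, P i yb); first by exists yb.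
  by exists (fun=> false, fun=> 0).
(* The representatives use countably many branches, so [x] can be taken off all of them and compared
   with each. *)
have cC : countable (range (fun i => (rep i).1)).
  apply: sub_countable (card_image_le _ _) _; exact: countableP.
have [x [Zx nCx]] := uncountable_ex (uncountableD uZ cC).
pose h e n v := phi (rep (e, n, v)).2 n.
have hh e a n : E e x a -> branch g x n -> size e.1.2 <= n -> phi a n = h e n (a n).
  move=> Ea xn en; have [|Ey yn yv] := hrep (e, n, a n); first by exists (x, a).
  apply: (EE e x (rep (e, n, a n)).1) => // exy.
  by apply: nCx; exists (e, n, a n).
exists x => //; apply: contrapT => nh.
(* If no [h e] served every function, one function that copies [bad e] on infinitely many failures
   of [h e], for every [e], would have no index at all. *)
have /choice[bad hbad] : forall e, exists a,
    io (fun n => branch g x n /\ phi a n <> h e n (a n)).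
  move=> e; apply: contrapT => g'; apply: nh; exists (h e) => a.
  apply: contrapT => /not_aa h'; apply: g'; exists a; apply: ioW h' => n hn.
  by split; [apply: contrapT => xn; apply: hn|move=> e'; apply: hn].
pose V (i : nat) n := if unpickle i is Some e then
   branch g x n /\ phi (bad e) n <> h e n (bad e n) else True.
have [r hr] : exists r : nat -> nat, forall i, io (fun n => V i n /\ r n = i).
  apply: io_disjointify => i; rewrite /V; case: unpickle => [e|] //.
  by move=> N; exists N.
pose a n := if unpickle (r n) is Some e then bad e n else 0.
have [e Ea] := hE x a.
have ha n : r n == pickle e -> a n = bad e n by move=> /eqP rn; rewrite /a rn pickleK.
have := io_aa (io_aa (hr (pickle e)) (phi_coord ha)) (aa_ge (size e.1.2)).
move=> /(_ 0)[n _ [[[Vn rn] hphi] en]].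
have := hphi (introT eqP rn); move: Vn; rewrite /V pickleK => -[xn +] phin.
by rewrite -phin -ha ?rn // => nn; apply: nn; apply: hh.
Qed.

End LocalCoordinatewise.

(** * Continuous rules on three-colorings *)

Definition color1 : 'I_3 := @Ordinal 3 1 isT.

Lemma color_third (i j : 'I_3) : exists t, t != i /\ t != j.
Proof.
suff [v vi vj] : exists2 v, v < 3 & v != i :> nat /\ v != j :> nat.
  by case: vj => vj vj'; exists (Ordinal vi).
have := ltn_ord i; have := ltn_ord j; case: (nat_of_ord i) => [|[|[|]]] //;
  case: (nat_of_ord j) => [|[|[|]]] // _ _;
  by [exists 0|exists 1|exists 2].
Qed.

Lemma color_cases (i j k x : 'I_3) : i != j -> i != k -> j != k ->
  [\/ x = i, x = j | x = k].
Proof.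
move=> ij ik jk; have [->|xi] := eqVneq x i; first by constructor 1.
have [->|xj] := eqVneq x j; first by constructor 2.
constructor 3; apply: val_inj => /=; move: ij ik jk xi xj.
rewrite -!val_eqE /=; have := ltn_ord i; have := ltn_ord j; have := ltn_ord k.
have := ltn_ord x; lia.
Qed.

Section Dictator.
Variables (R : set (nat -> 'I_3)) (k0 : nat) (D0 : nat -> 'I_3).
Hypothesis dR : dense_at R k0 D0.
Variable chi : (nat -> 'I_3) -> 'I_3.
Let N D := R D /\ agree k0 D0 D.
Hypothesis chi_cont : forall D, N D -> exists k, forall D' i, N D' ->
  (forall j, j < k -> (D j == i) = (D' j == i)) -> (chi D == i) = (chi D' == i).

Let forces (i : 'I_3) k (u : nat -> bool) := forall D, N D ->
  (forall j, k0 <= j -> j < k -> (D j == i) = u j) -> chi D = i.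

Let forces_self D : N D -> exists k, forces (chi D) k (fun j => D j == chi D).
Proof.
move=> ND; have [k hk] := chi_cont ND; exists k => D' ND' h.
have : (chi D == chi D) = (chi D' == chi D).
  apply: hk => // j jk; have [jk0|k0j] := ltnP j k0; last by rewrite h.
  by case: ND ND' => [_ a] [_ b]; rewrite -a // -b.
by rewrite eqxx => /esym/eqP.
Qed.

Let find k (w : nat -> 'I_3) : exists2 D, N D & forall j, k0 <= j -> j < k -> D j = w j.
Proof.
have [D wD RD] := dR (leq_maxl k0 k) (@agree_patch _ _ D0 w).
exists D.
  by split=> // i ik; rewrite -wD ?leq_max ?ik // /patch ik.
by move=> j kj jk; rewrite -wD ?leq_max ?jk ?orbT // /patch ltnNge kj.
Qed.

(** Give one set the color [i], the other the color [j], and everything else a third color: the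
    coloring would be sent to both [i] and [j]. Two colors would not suffice here. *)
Let forces_disjoint i j k k' u v : i != j -> forces i k u -> forces j k' v ->
  (forall n, k0 <= n -> n < k -> n < k' -> u n -> v n -> False) -> False.
Proof.
move=> ij fu fv disj; have [t [ti tj]] := color_third i j.
pose w n := if (n < k) && u n then i else if (n < k') && v n then j else t.
have [D ND wD] := find (maxn k k') w.
have e1 : chi D = i.
  apply: fu => // n kn nk; rewrite wD ?leq_max ?nk // /w nk /=.
  by case: ifP => un; rewrite ?eqxx //; case: ifP => _; apply: negbTE => //; rewrite eq_sym.
have e2 : chi D = j.
  apply: fv => // n kn nk; rewrite wD ?leq_max ?nk ?orbT // /w nk /=.
  case: ifP => [/andP[nk' un]|_].
    by rewrite (negbTE ij); case vn : (v n) => //; case: (disj n).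
  by case: ifP => // _; rewrite ?eqxx //; apply: negbTE.
by move: ij; rewrite -e1 -e2 eqxx.
Qed.

(** Recolor one coordinate at a time from [i'] to [i]; the pivot [p] is where the value [i] first
    becomes possible. Changing [Ea] at [p] alone gives [Eb], so the class that decides [Ea] and the
    class that decides [Eb] can meet only at [p]. As classes deciding different colors must meet,
    every deciding class is then shown to contain [p]. *)
Lemma dictator :
  (exists i, forall D, R D -> agree k0 D0 D -> chi D = i) \/
  (exists2 p, k0 <= p & forall D, R D -> agree k0 D0 D -> chi D = D p).
Proof.
have [[i hi]|nc] := pselect (exists i, forall D, R D -> agree k0 D0 D -> chi D = i).
  by left; exists i.
right.
have [D ND _] := find 0 D0; set i := chi D.
have [D' ND' nD'] : exists2 D', N D' & chi D' != i.
  apply: contrapT => h; apply: nc; exists i => E RE aE; apply/eqP/negPn/negP => Ei.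
  by apply: h; exists E.
set i' := chi D' in nD'.
have [k fk] := forces_self ND; have [k' fk'] := forces_self ND'.
set K := maxn k0 (maxn k k').
pose w j (n : nat) := if n < j then i else i'.
pose ext j E := forall n, k0 <= n -> n < K -> E n = w j n.
have extK E : N E -> ext K E -> chi E = i.
  move=> NE eE; apply/eqP/negPn/negP => ci; have [l fl] := forces_self NE.
  apply: (forces_disjoint _ fk fl) => [|n k0n nk nl _ /eqP En]; first by rewrite eq_sym.
  have nK : n < K by rewrite !leq_max nk orbT.
  by move: ci; rewrite -En eE // /w nK eqxx.
have ext0 E : N E -> ext k0 E -> chi E = i'.
  move=> NE eE; apply/eqP/negPn/negP => ci; have [l fl] := forces_self NE.
  apply: (forces_disjoint _ fk' fl) => [|n k0n nk nl _ /eqP En]; first by rewrite eq_sym.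
  have nK : n < K by rewrite !leq_max nk !orbT.
  by move: ci; rewrite -En eE // /w ltnNge k0n eqxx.
have exj : exists j, (k0 <= j) && `[< exists2 E, N E & ext j E /\ chi E = i >].
  exists K; rewrite leq_maxl /=; apply/asboolP.
  have [E NE eE] := find K (w K); exists E => //; split=> //; exact: extK.
case: (ex_minnP exj) => -[|p] /andP[k0j /asboolP[Ea NEa [eEa chia]]] jmin.
  have e0 : ext k0 Ea by move=> n a b; rewrite eEa // /w; move: k0j; rewrite leqn0 => /eqP->.
  by move: nD'; rewrite -/i' -(ext0 Ea) // chia eqxx.
have k0p : k0 <= p.
  rewrite leqNgt; apply/negP => pk0.
  have ek : p.+1 = k0 by lia.
  by move: nD'; rewrite -/i' -(ext0 Ea) ?chia ?eqxx // -ek.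
have noti E : N E -> ext p E -> chi E != i.
  move=> NE eE; apply/negP => /eqP ci.
  suff : p.+1 <= p by rewrite ltnn.
  by apply: jmin; rewrite k0p /=; apply/asboolP; exists E.
have [ka fa] := forces_self NEa; rewrite chia in fa.
have [Eb NEb eEb] := find (maxn K ka) (fun n => if n == p then i' else Ea n).
have Ebp : ext p Eb.
  move=> n k0n nK; rewrite (eEb n k0n (leq_trans nK (leq_maxl _ _))) /w.
  have [->|np] := eqVneq n p; first by rewrite ltnn.
  by rewrite eEa // /w ltnS leq_eqVlt (negbTE np).
have nbi := noti _ NEb Ebp.
have [kb fb] := forces_self NEb.
have AB n : k0 <= n -> n < ka -> Ea n == i -> Eb n == chi Eb -> n = p.
  move=> k0n nka /eqP ai /eqP bc; have [//|np] := eqVneq n p.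
  by move: nbi; rewrite -bc eEb ?leq_max ?nka ?orbT // (negbTE np) ai eqxx.
set c' := chi Eb in fb AB nbi.
exists p => // D1 RD1 aD1; have ND1 : N D1 by [].
apply/eqP/negPn/negP => cp; set c := chi D1 in cp.
have [kc fc] := forces_self ND1; rewrite -/c in fc.
have [o1 [o1c' _]] := color_third c' c'.
have [o2 [o2c' o2o1]] := color_third c' o1.
have [j [j' [jc' j'c' jj' j'c]]] : exists j j', [/\ j != c', j' != c', j != j' & j' != c].
  have [e|ne] := eqVneq o1 c; last by exists o2, o1.
  by exists o1, o2; split; rewrite -?e // eq_sym.
(* No color is possible for [E]: the class of [c'] misses the one deciding [Ea], because [D1 p] is
   not [c]; the class of [j] misses the one deciding [Eb], and the class of [j'] the one deciding
   [D1]. *)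
have [E NE eE] := find (maxn ka (maxn kb kc))
  (fun n => if D1 n == c then (if Eb n == c' then c' else j) else j').
have [ke fe] := forces_self NE.
have c'j : c' != j by rewrite eq_sym.
have c'j' : c' != j' by rewrite eq_sym.
have [ce|ce|ce] := color_cases (chi E) c'j c'j' jj'; rewrite ce in fe.
- apply: (forces_disjoint nbi fe fa) => n k0n _ na + ai.
  rewrite eE ?leq_max ?na //; case: ifP => [/eqP D1n|_]; last by rewrite (negbTE j'c').
  case: ifP => [bn _|_]; last by rewrite (negbTE jc').
  by move: cp; rewrite -(AB n k0n na ai bn) D1n eqxx.
- apply: (forces_disjoint jc' fe fb) => n k0n _ nb + /eqP bn.
  rewrite eE ?leq_max ?nb ?orbT // bn eqxx; case: ifP => _; first by rewrite (negbTE c'j).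
  by rewrite eq_sym (negbTE jj').
- apply: (forces_disjoint j'c fe fc) => n k0n _ nc' + /eqP D1n.
  rewrite eE ?leq_max ?nc' ?orbT // D1n eqxx; case: ifP => _; first by rewrite (negbTE c'j').
  by rewrite (negbTE jj').
Qed.

End Dictator.

(** * Boolean maps modulo finite sets and their liftings on a branch *)

Definition boolean_mod_fin (alpha : (nat -> bool) -> nat -> bool) : Prop :=
  [/\ forall a b, aa (fun n => a n = b n) -> aa (fun n => alpha a n = alpha b n),
      forall a b, aa (fun n => alpha (fun j => a j && b j) n = alpha a n && alpha b n)
    & forall a, aa (fun n => alpha (fun j => ~~ a j) n = ~~ alpha a n)].

Definition inverse_mod_fin (alpha beta : (nat -> bool) -> nat -> bool) : Prop :=
  forall b, aa (fun n => alpha (beta b) n = b n).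

Section BooleanModFin.
Variable alpha : (nat -> bool) -> nat -> bool.
Hypothesis halpha : boolean_mod_fin alpha.

Lemma bmf_ext a b : aa (fun n => a n = b n) -> aa (fun n => alpha a n = alpha b n).
Proof. by case: halpha => h _ _; exact: h. Qed.

Lemma bmf_and a b : aa (fun n => alpha (fun j => a j && b j) n = alpha a n && alpha b n).
Proof. by case: halpha => _ h _; exact: h. Qed.

Lemma bmf_neg a : aa (fun n => alpha (fun j => ~~ a j) n = ~~ alpha a n).
Proof. by case: halpha => _ _; apply. Qed.

Lemma bmf_false : aa (fun n => alpha (fun=> false) n = false).
Proof.
apply: aaW (aa_and (bmf_and (fun=> false) (fun=> ~~ false)) (bmf_neg (fun=> false))).
by move=> n [e1 e2]; rewrite e2 !andbN in e1.
Qed.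

Lemma bmf_if c u v :
  aa (fun n => alpha (fun j => if c j then u j else v j) n =
               if alpha c n then alpha u n else alpha v n).
Proof.
pose p j := ~~ (c j && u j); pose q j := ~~ (~~ c j && v j).
have e : (fun j => if c j then u j else v j) = (fun j => ~~ (p j && q j)).
  by apply/funext => j; rewrite /p /q; case: (c j); case: (u j); case: (v j).
rewrite e.
have h1 := aa_and (bmf_neg (fun j => p j && q j)) (bmf_and p q).
have h2 := aa_and (bmf_neg (fun j => c j && u j)) (bmf_neg (fun j => ~~ c j && v j)).
have h3 := aa_and (bmf_and c u) (bmf_and (fun j => ~~ c j) v).
apply: aaW (aa_and (aa_and h1 h2) (aa_and h3 (bmf_neg c))).
move=> n [[[-> ->] [e1 e2]] [[e3 e4] e5]].
rewrite /p /q e1 e2 e3 e4 e5.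
by case: (alpha c n); case: (alpha u n); case: (alpha v n).
Qed.

Lemma bmf_agree_on (D : nat -> bool) a b : (forall n, D n -> a n = b n) ->
  aa (fun n => alpha D n -> alpha a n = alpha b n).
Proof.
move=> h; have e : (fun j => D j && a j) = (fun j => D j && b j).
  by apply/funext => j; case: (boolP (D j)) => //= /h.
have := bmf_and D b; rewrite -e => hb.
by apply: aaW (aa_and (bmf_and D a) hb) => n [-> +] Dn; rewrite Dn.
Qed.

End BooleanModFin.

Lemma inverse_mod_fin_false alpha beta a : boolean_mod_fin beta ->
  inverse_mod_fin beta alpha -> aa (fun n => alpha a n = false) ->
  aa (fun n => a n = false).
Proof.
move=> hb ba h; have := bmf_ext hb h => h1.
apply: aaW (aa_and (aa_and (ba a) h1) (bmf_false hb)) => n [[<- ->]].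
exact.
Qed.

Section LocalBoolean.
Variables (R : realType) (hOCA : OCA_T R) (g : nat -> option (seq bool)).
Variables alpha beta : (nat -> bool) -> nat -> bool.
Hypothesis fg : finite_fibers g.
Hypothesis halpha : boolean_mod_fin alpha.
Hypothesis hbeta : boolean_mod_fin beta.
Hypothesis alphaK : inverse_mod_fin beta alpha.
Hypothesis betaK : inverse_mod_fin alpha beta.

Let color := 'I_3.
Let part (i : color) (D : nat -> color) : nat -> bool := fun j => D j == i.
(** The swap of two colors on a set [c] makes [alpha c] visible: it moves the color that [alpha]
    gives to [n] exactly when [n] is in [alpha c], up to finitely many [n]. *)
Let sw (i : color) : color := if i == ord0 then color1 else if i == color1 then ord0 else i.
Let swap (c : nat -> bool) (D : nat -> color) : nat -> color :=
  fun j => if c j then sw (D j) else D j.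

Let swK i : sw (sw i) = i.
Proof.
rewrite /sw; have [->|i0] := eqVneq i ord0; first by [].
by have [->|i1] := eqVneq i color1; rewrite ?eqxx // (negbTE i0) (negbTE i1).
Qed.

Let part_nowhere_dense i M : nowhere_dense M -> nowhere_dense [set D | M (part i D)].
Proof.
move=> hM k D; have [j [y [kj Dy hy]]] := hM k (part i D).
have [t [ti _]] := color_third i i.
exists j, (fun n => if n < k then D n else if y n then i else t); split=> //.
  by move=> n nk; rewrite nk.
move=> z yz; apply: hy => n nj; rewrite /part -yz //.
case: ifP => nk; first by rewrite -Dy.
by case: (y n); rewrite ?eqxx ?(negbTE ti).
Qed.

Let swap_nowhere_dense c M : nowhere_dense M -> nowhere_dense [set D | M (swap c D)].
Proof.
move=> hM k D; have [j [y [kj Dy hy]]] := hM k (swap c D).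
exists j, (swap c y); split=> //.
  by move=> n nk; rewrite /swap -Dy // /swap; case: (c n); rewrite ?swK.
by move=> z yz; apply: hy => n nj; rewrite /swap -yz // /swap; case: (c n); rewrite ?swK.
Qed.

Let swap_meager c M : meager M -> meager [set D | M (swap c D)].
Proof.
move=> [N hN MN]; exists (fun j => [set D | N j (swap c D)]).
  by move=> j; apply: swap_nowhere_dense.
by move=> D /MN.
Qed.

Let three_parts D : aa (fun n => exists i, forall j, alpha (part j D) n = (j == i)).
Proof.
pose p0 := part ord0 D; pose p1 := part color1 D; pose p2 := part ord_max D.
have cases j : [\/ D j = ord0, D j = color1 | D j = ord_max].
  exact: color_cases.
have e2 : p2 = (fun j => ~~ p0 j && ~~ p1 j).
  by apply/funext => j; rewrite /p2 /p0 /p1 /part; case: (cases j) => ->.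
have e01 : (fun=> false) = (fun j => p0 j && p1 j).
  by apply/funext => j; rewrite /p0 /p1 /part; case: (cases j) => ->.
have h2 := bmf_and halpha (fun j => ~~ p0 j) (fun j => ~~ p1 j).
have h01 := bmf_and halpha p0 p1; rewrite -e01 in h01.
have hn := aa_and (bmf_neg halpha p0) (bmf_neg halpha p1).
apply: aaW (aa_and (aa_and h2 hn) (aa_and h01 (bmf_false halpha))).
move=> n [[+ [n0 n1]] [+ hf]]; rewrite hf n0 n1 -e2 => a2 /esym a01.
have jc (j : color) : [\/ j = ord0, j = color1 | j = ord_max] by exact: color_cases.
have [a0|a0] := boolP (alpha p0 n).
  exists ord0 => j; case: (jc j) => ->; rewrite -/p0 -/p1 -/p2 ?a0 ?a2 ?a0 //.
  by move: a01; rewrite a0.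
have [a1|a1] := boolP (alpha p1 n).
  by exists color1 => j; case: (jc j) => ->; rewrite -/p0 -/p1 -/p2 ?a2 ?a1 ?(negbTE a0).
exists ord_max => j; case: (jc j) => ->; rewrite -/p0 -/p1 -/p2 ?a2 ?a1 ?a0 //;
  exact: negbTE.
Qed.

Section OnBranch.
Variables (H : nat -> set ((nat -> bool) * (nat -> bool) * (nat -> bool))).
Hypothesis cH : forall u, exists m, H m u.
Hypothesis hH : forall m u v, H m u -> H m v -> ~ conflict g alpha alpha u v.

Let full : nat -> bool := fun=> true.

Let supp_full x : support g x full = branch g x.
Proof. by apply/funext => n; rewrite /support andbT. Qed.

(* [(y, b)] shows the value of [alpha a] on [alpha (branch g x)] below [k]
   to be determined by [a] on the finite set [branch g x n && branch g y n]. *)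
Let witness x m k (a : nat -> bool) := exists y b,
  [/\ H m (y, full, b), y <> x,
      forall n, branch g x n -> branch g y n -> b n = a n,
      agree k (alpha b) (alpha a) & agree k (alpha (branch g y)) (alpha (branch g x))].

Let good x m a := H m (x, full, a) /\ forall k, witness x m k a.

Let bad x (i : nat * nat * (seq bool * seq bool)) : set (nat -> bool) :=
  [set a | [/\ H i.1.1 (x, full, a), mkseq (alpha a) i.1.2 = i.2.1,
     mkseq (alpha (branch g x)) i.1.2 = i.2.2 & ~ witness x i.1.1 i.1.2 a]].

(** Otherwise two branches of [Z] share an index and a cylinder where their bad sets are dense.
    Choose a member of each so that they agree on the finite common part of the branches; the index
    fixes the relevant values of [alpha], so one is a witness for the other. *)
Let bad_nowhere_dense (Z : set (nat -> bool)) : ~ countable Z ->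
  exists2 x, Z x & forall i, nowhere_dense (bad x i).
Proof.
move=> uZ; apply: contrapT => h.
have hx x : Z x -> exists is', exists2 y0,
    mkseq y0 (size is'.2) = is'.2 & dense_at (bad x is'.1) (size is'.2) y0.
  move=> Zx; apply: contrapT => h1; apply: h; exists x => // i; apply: contrapT => nd.
  have [k [y0 hd]] := not_nowhere_dense nd; apply: h1.
  by exists (i, mkseq y0 k), y0; rewrite size_mkseq.
have [x [y [[i s] [Zx Zy nxy [x0 x0s dx] [y0 y0s dy]]]]] := uncountable_pair_rel uZ hx.
have xy0 : agree (size s) x0 y0 by apply/agree_mkseq; rewrite x0s y0s.
have [K hK] := branch_almost_disjoint fg nxy.
set j := maxn (size s) K; have sj : size s <= j by apply: leq_maxl.
have [a x0a [Ha a1 a2 nw]] := dx j x0 sj (@agree_refl _ _ _).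
have [b x0b [Hb b1 b2 _]] := dy j x0 sj (agree_sym xy0).
apply: nw; exists y, b; split=> //; first exact: nesym.
- by move=> n xn yn; rewrite -x0a -?x0b // leq_max hK ?orbT.
- by apply/agree_mkseq; rewrite a1 b1.
- by apply/agree_mkseq; rewrite a2 b2.
Qed.

Section FixedBranch.
Variable x : nat -> bool.
Hypothesis hx : forall i, nowhere_dense (bad x i).

Let A := branch g x.

Let Bad : set (nat -> color) := [set D | exists i, forall m, ~ good x m (part i D)].

Let Bad_meager : meager Bad.
Proof.
pose M (ic : color * (nat * nat * (seq bool * seq bool))) :=
  [set D | bad x ic.2 (part ic.1 D)].
apply: meagerS (@meager_bigcup _ _ M _); last first.
  by move=> ic; apply/nowhere_dense_meager/part_nowhere_dense.
move=> D [i hi]; have [m Hm] := cH (x, full, part i D).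
have [k hk] : exists k, ~ witness x m k (part i D).
  apply: contrapT => h; apply: (hi m); split=> // k; apply: contrapT => nw.
  by apply: h; exists k.
exists (i, (m, k, (mkseq (alpha (part i D)) k, mkseq (alpha (branch g x)) k))).
by split.
Qed.

Let Q (e : {ffun color -> nat} * nat) : set (nat -> color) :=
  [set D | (forall i, good x (e.1 i) (part i D)) /\
     forall n, e.2 <= n -> exists i, forall j, alpha (part j D) n = (j == i)].

Let Q_cover D : ~ Bad D -> exists e, Q e D.
Proof.
move=> nB; have /choice[m hm] : forall i, exists m, good x m (part i D).
  move=> i; apply: contrapT => h; apply: nB; exists i => m hm; apply: h.
  by exists m.
have [l hl] := three_parts D; exists ([ffun i => m i], l); split=> // i.
by rewrite ffunE.
Qed.

Let chi n (D : nat -> color) : color :=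
  if alpha (part ord0 D) n then ord0 else if alpha (part color1 D) n then color1 else ord_max.

Let chiE e D n j : Q e D -> e.2 <= n -> alpha (part j D) n = (j == chi n D).
Proof.
move=> [_ h] /h[i hi]; rewrite hi /chi !hi.
have [<-//|i0] := eqVneq ord0 i; have [<-//|i1] := eqVneq color1 i.
have [//|e1|->//] : [\/ i = ord0, i = color1 | i = ord_max] by exact: color_cases.
  by move=> e0; rewrite e0 eqxx in i0.
by rewrite e1 eqxx in i1.
Qed.

(** A witness [b] on another branch has the value of the class at [n]. Any class that agrees with it
    on the finite common part of the two branches is comparable with [b] too, and by absence of
    conflicts has that value. *)
Let cont e D n : Q e D -> alpha A n -> exists k, forall D' i, Q e D' ->
  (forall j, j < k -> (D j == i) = (D' j == i)) ->
  alpha (part i D) n = alpha (part i D') n.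
Proof.
move=> [hD _] An.
have /choice[kk hk] : forall i, exists k, forall D', Q e D' ->
    (forall j, j < k -> (D j == i) = (D' j == i)) ->
    alpha (part i D) n = alpha (part i D') n.
  move=> i; have [_ /(_ n.+1)[y [b [Hb nyx ab abk Ak]]]] := hD i.
  have [K hK] := branch_almost_disjoint fg nyx.
  exists K => D' [hD' _] DD'; have [HD' _] := hD' i.
  rewrite -(abk n) //; apply: contrapT => nab.
  apply: (hH Hb HD'); have [k yx nk] := split_ex nyx; exists k; split=> //=.
    move=> j yj xj; split=> // _; rewrite ab // /part DD' //; exact: hK.
  by exists n; rewrite !supp_full (Ak n) //; split.
exists (\max_i kk i) => D' i QD' h; apply: hk => // j jk.
by apply: h; apply: leq_trans jk (leq_bigmax _).
Qed.

Let exists_heavy : exists e k0 D0, heavy [set D | ~ Bad D /\ Q e D] k0 D0.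
Proof.
apply: nonmeager_heavy Q_cover => h.
have [D _] := baire_meager 0 (fun=> ord0) (meagerU Bad_meager h).
by apply; have [?|?] := pselect (Bad D); [left|right].
Qed.

Section Heavy.
Variables (e : {ffun color -> nat} * nat) (k0 : nat) (D0 : nat -> color).
Let RR : set (nat -> color) := [set D | ~ Bad D /\ Q e D].
Hypothesis hRR : heavy RR k0 D0.

(* Otherwise the colorings in question would all have color [i] on the infinite set
   [beta V], which a generic one does not. *)
Let not_constant j D1 i : k0 <= j -> agree k0 D0 D1 ->
  aa (fun n => ~ (alpha A n /\ forall D, RR D -> agree j D1 D -> chi n D = i)).
Proof.
move=> kj DD; apply: contrapT => /not_aa ioV.
pose P n := alpha A n /\ forall D, RR D -> agree j D1 D -> chi n D = i.
have {}ioV : io P by apply: ioW ioV => n /contrapT.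
pose V n := `[< P n >]; pose G := beta V.
have ioG : io (fun n => G n).
  apply: contrapT => /not_io h.
  have GF : aa (fun n => G n = (fun=> false) n) by apply: aaW h => n /negP/negbTE.
  apply: aa_io_false ioV.
  apply: aaW (aa_and (aa_and (betaK V) (bmf_ext halpha GF)) (bmf_false halpha)).
  by move=> n [[VE e1] e2] Pn; move: VE; rewrite -/G e1 e2 => /esym/asboolP.
pose M N : set (nat -> color) := [set D | forall n, N <= n -> G n -> D n = i].
have mM : meager [set D | exists N, M N D].
  apply: meager_bigcup => N; apply: nowhere_dense_meager => k D.
  have [n] := ioG (maxn k N); rewrite geq_max => /andP[kn Nn] Gn.
  have [t [ti _]] := color_third i i.
  exists n.+1, (patch n D (fun=> t)); split; first exact: leqW.
    exact: agreeW (agree_patch _ _).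
  move=> z /(_ n (ltnSn n)) zn /(_ n Nn Gn) zi.
  by move: ti; rewrite -zi -zn /patch ltnn eqxx.
have [D D1D [RD nMD]] := heavy_diff (heavy_sub kj DD hRR) mM.
apply: nMD; have [N hN] : aa (fun n => G n && ~~ part i D n = false).
  apply: inverse_mod_fin_false hbeta alphaK _.
  have h1 := aa_and (bmf_and halpha G (fun n => ~~ part i D n)) (bmf_neg halpha (part i D)).
  apply: aaW (aa_and (aa_and h1 (betaK V)) (aa_ge e.2)) => n [[[-> ->] ->] en].
  rewrite (chiE _ RD.2 en) /V; case: asboolP => //= -[_ h].
  by rewrite h // eqxx.
exists N => n Nn Gn; have := hN n Nn; rewrite Gn /= => /negbFE.
by move/eqP.
Qed.

Let dict n p := k0 <= p /\ forall D, RR D -> agree k0 D0 D -> chi n D = D p.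

(** [not_constant] leaves the other alternative of [dictator]. The dictator tends to infinity with
    [n]: a fixed [p] would make the rule constant on the smaller cylinder where the color of [p] is
    prescribed. *)
Let dict_large M : aa (fun n => alpha A n -> exists p, dict n p) /\
  aa (fun n => alpha A n -> forall p, p < M -> ~ dict n p).
Proof.
split.
  have h : aa (fun n => forall i, i < 3 -> ~ (alpha A n /\ forall D, RR D ->
      agree k0 D0 D -> chi n D = inord i)).
    by apply: aa_ltn_all => i _; apply: not_constant.
  apply: aaW (aa_and h (aa_ge e.2)) => n [hn en] An.
  have [|[i hi]|[p k0p hp]] := @dictator RR k0 D0 (heavy_dense hRR) (chi n).
  - move=> D [[_ QD] _]; have [k hk] := cont QD An; exists k => D' i [[_ QD'] _] DD'.
    by rewrite ![chi n _ == _]eq_sym -(chiE _ QD en) -(chiE _ QD' en); apply: hk.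
  - by case: (hn i (ltn_ord i)); split=> // D RD aD; rewrite inord_val; apply: hi.
  - by exists p; split.
have h : aa (fun n => forall p, p < M -> alpha A n -> ~ dict n p).
  apply: aa_ltn_all => p _; have [pk0|k0p] := ltnP p k0.
    by apply: aaT => n _ []; rewrite leqNgt pk0.
  have := @not_constant p.+1 (patch p D0 (fun=> ord0)) ord0 (leqW k0p)
    (agreeW k0p (agree_patch _ _)).
  apply: aaW => n hn An [_ hp]; apply: hn; split=> // D RD aD.
  rewrite hp // -?(aD p) // /patch ?ltnn // => i ik0.
  rewrite -aD ?(leq_trans ik0) 1?leqW // /patch; case: ifP => //.
  by rewrite (leq_trans ik0).
by apply: aaW h => n hn An p pM; apply: hn.
Qed.

Let swap_parts c D :
  aa (fun n => alpha (part ord0 (swap c D)) n =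
      (if alpha c n then alpha (part color1 D) n else alpha (part ord0 D) n) /\
    alpha (part color1 (swap c D)) n =
      (if alpha c n then alpha (part ord0 D) n else alpha (part color1 D) n)).
Proof.
have cases j : [\/ D j = ord0, D j = color1 | D j = ord_max] by exact: color_cases.
apply: aa_and.
  rewrite (_ : part ord0 (swap c D) =
    fun j => if c j then part color1 D j else part ord0 D j); first exact: bmf_if.
  by apply/funext => j; rewrite /part /swap /sw; case: (c j); case: (cases j) => ->.
rewrite (_ : part color1 (swap c D) =
    fun j => if c j then part ord0 D j else part color1 D j); first exact: bmf_if.
by apply/funext => j; rewrite /part /swap /sw; case: (c j); case: (cases j) => ->.
Qed.

Let T (c : nat -> bool) (i : ({ffun color -> nat} * nat) * nat) : set (nat -> color) :=
  [set D | Q i.1 (swap c D) /\ forall n, i.2 <= n ->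
     chi n (swap c D) = if alpha c n then sw (chi n D) else chi n D].

Let T_cover c D : RR D -> ~ Bad (swap c D) -> exists i, T c i D.
Proof.
move=> [_ QD] /Q_cover[e' Qe']; have [l hl] := aa_and (swap_parts c D) (aa_ge e.2).
exists (e', l); split=> // n /hl[[h0 h1] en].
rewrite /chi h0 h1; have E j := chiE j QD en; move: (E ord0) (E color1); clear E.
rewrite /chi; case: (alpha c n); case: (alpha (part ord0 D) n) => //;
  by case: (alpha (part color1 D) n).
Qed.

Let swap_heavy c : exists i k x, heavy
  [set D | [/\ RR D, agree k0 D0 D & ~ Bad (swap c D)] /\ T c i D] k x.
Proof.
apply: (nonmeager_heavy (R := [set D | [/\ RR D, agree k0 D0 D & ~ Bad (swap c D)]])).
  move=> h; apply: (hRR (leqnn k0) (@agree_refl _ _ _)).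
  apply: meagerS (meagerU h (swap_meager c Bad_meager)) => D [RD aD].
  by have [b|b] := pselect (Bad (swap c D)); [right|left].
by move=> D [RD _ nB]; apply: T_cover.
Qed.

(** [f n] is the dictator of [n]. If [alpha c n] and [c (f n)] differed, the color of [n] for a
    swapped coloring would be [sw] of its color at [f n]. Changing the latter from [color1] to
    [ord_max] turns the former from [ord0] into [ord_max], although the class of [ord0] stays the
    same as far as [cont] looks. *)
Lemma heavy_determines : exists f : nat -> nat,
  forall c, aa (fun n => alpha A n -> alpha c n = c (f n)).
Proof.
have /choice[f hf] : forall n, exists p, (exists p', dict n p') -> dict n p.
  by move=> n; have [[p hp]|h] := pselect (exists p, dict n p); [exists p|exists 0].
exists f => c; have [[e' l'] [k1 [x1 hS]]] := swap_heavy c.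
set S := [set D | _] in hS; have dS := heavy_dense hS.
have [z xz Sz] := dense_at_ex dS.
pose j1 := maxn k0 k1.
have dSz : dense_at S j1 z.
  move=> j y jj zy; apply: dS; first exact: leq_trans (leq_maxr _ _) jj.
  exact: agree_trans xz (agreeW (leq_maxr _ _) zy).
have [h1 h2] := dict_large j1.
have h3 := aa_and (aa_ge e.2) (aa_and (aa_ge e'.2) (aa_ge l')).
apply: aaW (aa_and (aa_and h1 h2) h3) => n [[ex nl] [en [e'n l'n]]] An.
have [k0p dp] := hf n (ex An); set p := f n in k0p dp *.
have j1p : j1 <= p by rewrite leqNgt; apply/negP => pj; apply: (nl An p pj).
apply/eqP/negPn/negP => ncp.
have flip D : S D -> chi n (swap c D) = sw (swap c D p).
  move=> [[RD aD nB] [QD' hD]]; rewrite hD // dp // /swap.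
  by move: ncp; case: (alpha c n); case: (c p) => //= _; rewrite swK.
(* The value at [p] is chosen so that it becomes [v] after the swap. *)
pose w y (v : color) j := if j < p then y j else if j == p then swap c (fun=> v) p else y j.
have wlt y v : agree p y (w y v) by move=> i ip; rewrite /w ip.
have [D wD SD] := dSz p.+1 (w z color1) (leqW j1p) (agreeW j1p (wlt _ _)).
have zD : agree p z D := agree_trans (wlt _ _) (agreeW (leqnSn p) wD).
have Dp : swap c D p = color1.
  rewrite /swap -(wD p (ltnSn p)) /w ltnn eqxx /swap.
  by case: (c p); rewrite ?swK.
have [[RD aD nB] [QD' hD]] := SD.
have [k hk] := cont QD' An.
have [D' wD' SD'] := dSz (maxn k p.+1) (w D ord_max)
  (leq_trans (leqW j1p) (leq_maxr _ _))
  (agreeW j1p (agree_trans zD (wlt _ _))).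
have D'p : swap c D' p = ord_max.
  rewrite /swap -(wD' p) ?leq_max ?ltnSn ?orbT // /w ltnn eqxx /swap.
  by case: (c p).
have [_ [QD'' _]] := SD'.
have := hk (swap c D') ord0 QD''.
rewrite (chiE _ QD' e'n) (chiE _ QD'' e'n) flip // flip // Dp D'p => h.
suff : true = false by [].
apply: h => j jk; have [->|jp] := eqVneq j p; first by rewrite Dp D'p.
rewrite /swap -(wD' j) ?leq_max ?jk // /w.
by rewrite (negbTE jp) if_same.
Qed.

End Heavy.

Lemma bad_determined : exists f : nat -> nat, forall c,
  aa (fun n => alpha A n -> alpha c n = c (f n)).
Proof. by have [e [k0 [D0 h]]] := exists_heavy; exact: heavy_determines h. Qed.

End FixedBranch.

Lemma ad_family_determined (Z : set (nat -> bool)) : ~ countable Z ->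
  exists2 x, Z x & exists f : nat -> nat,
    forall c, aa (fun n => alpha (branch g x) n -> alpha c n = c (f n)).
Proof.
by move=> /bad_nowhere_dense[x Zx hx]; exists x => //; exact: bad_determined.
Qed.

End OnBranch.

(* The [f] of [ad_family_determined] is onto [branch g x] modulo a finite set, and
   a section of it works for [beta]. *)
Lemma boolean_on_branch (Z : set (nat -> bool)) : ~ countable Z ->
  exists2 x, Z x & exists e : nat -> nat,
    forall b, aa (fun j => branch g x j -> beta b j = b (e j)).
Proof.
move=> uZ; have [H cH hH] := conflict_cover hOCA fg (bmf_agree_on halpha).
have [x Zx [f hf]] := ad_family_determined cH hH uZ; exists x => //.
set A := branch g x in hf *.
have /choice[e he] : forall j, exists n,
    (exists n', alpha A n' /\ f n' = j) -> alpha A n /\ f n = j.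
  move=> j; have [[n hn]|h] := pselect (exists n, alpha A n /\ f n = j); first by exists n.
  by exists 0.
pose u j := A j && ~~ `[< exists n, alpha A n /\ f n = j >].
have hu : aa (fun j => u j = false).
  apply: inverse_mod_fin_false hbeta alphaK _.
  have e1 : u = (fun j => A j && u j) by apply/funext => j; rewrite /u; case: (A j).
  have h2 := bmf_and halpha A u; rewrite -e1 in h2.
  apply: aaW (aa_and h2 (hf u)) => n [e2 fn]; rewrite e2.
  case: (boolP (alpha A n)) => //= An.
  rewrite fn // /u; apply/negbTE; rewrite negb_and negbK orbC; apply/orP; left.
  by apply/asboolP; exists n.
exists e => b; have [N hN] := aa_and (hf (beta b)) (betaK b).
(* Since [f (e j) = j], the values [e j] tend to infinity along the branch, so what holds for almost
   all [n] may be used at [e j]. *)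
have hE : aa (fun j => A j -> N <= e j).
  have h : aa (fun j => forall n, n < N -> ~ (A j /\ e j = n /\ f n = j)).
    apply: aa_ltn_all => n _; exists (f n).+1 => j jf [_ [_ fn]]; move: jf.
    by rewrite fn ltnn.
  apply: aaW (aa_and h hu) => j [hj uj] Aj; rewrite leqNgt; apply/negP => eN.
  apply: (hj _ eN); split=> //; split=> //; move: uj; rewrite /u Aj /=.
  by move=> /negbFE/asboolP/he[].
apply: aaW (aa_and hE hu) => j [eN + ] Aj; rewrite /u Aj /= => /negbFE/asboolP/he[Ae fe].
have [h1 h2] := hN _ (eN Aj).
by rewrite -{1}fe -h1 // h2.
Qed.

End LocalBoolean.

(** * Gluing by Martin's axiom *)

Definition omega1_like (I : Type) (lt : I -> I -> Prop) : Prop :=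
  [/\ well_founded lt, forall i j, i <> j -> lt i j \/ lt j i,
      forall i j, lt i j -> ~ lt j i, forall i, countable [set j | lt j i]
    & ~ countable [set: I]].

Lemma well_order_exists (S : Type) : exists lt : S -> S -> Prop,
  [/\ well_founded lt, forall i j, i <> j -> lt i j \/ lt j i
    & forall i j, lt i j -> ~ lt j i].
Proof.
have [r wo] := wochoice.well_ordering_principle {classic S}.
have rmin (P : S -> Prop) : (exists x, P x) -> exists2 m, P m & forall x, P x -> r m x.
  move=> [x Px]; have [|m [[Pm hm] _]] := wo [pred z : {classic S} | `[< P z >]].
    by exists x; apply/asboolP.
  exists m; first exact/asboolP.
  by move=> y Py; apply: hm; apply/asboolP.
have ranti x y : r x y -> r y x -> x = y.
  move=> xy yx; have [|m [_ hm]] := wo [pred z : {classic S} | `[< z = x \/ z = y >]].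
    by exists x; apply/asboolP; left.
  have rr z : r z z by have [|w -> h] := rmin (fun w => w = z); [exists z|exact: h].
  have mx : m = x.
    by apply: hm; split=> [|z /asboolP[->|->] //]; apply/asboolP; left.
  have my : m = y.
    by apply: hm; split=> [|z /asboolP[->|->] //]; apply/asboolP; right.
  by rewrite -mx.
exists (fun x y : S => r x y /\ x <> y); split.
- move=> x; apply: contrapT => nx.
  have [|m nm hm] := rmin (fun x => ~ Acc (fun x y : S => r x y /\ x <> y) x); first by exists x.
  apply: nm; constructor => y [ym nym]; apply: contrapT => ny.
  by apply: nym; apply: ranti => //; exact: hm.
- move=> i j nij; have [|m [->|->] hm] := rmin (fun z => z = i \/ z = j).
  + by exists i; left.
  + by left; split=> //; apply: hm; right.
  + by right; split; [apply: hm; left|exact: nesym].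
- by move=> i j [ij nij] [ji _]; apply: nij; exact: ranti.
Qed.

(** In a well-ordering of [Y], the least point with uncountably many predecessors cuts off a segment
    as required; if there is no such point, the whole order will do. *)
Lemma omega1_subset T (Y : set T) : ~ countable Y ->
  exists (I : Type) (y : I -> T) (lt : I -> I -> Prop),
    [/\ omega1_like lt, forall i j, y i = y j -> i = j & forall i, Y (y i)].
Proof.
move=> uY; pose S := {x | Y x}.
have [lt [wf tot asym]] := well_order_exists S.
have uS : ~ countable [set: S].
  move=> /countableE[f fi]; apply: uY; apply/countableE.
  have /choice[h hh] : forall x, exists n, forall Yx : Y x, f (exist _ x Yx) = n.
    move=> x; have [Yx|nY] := pselect (Y x); last by exists 0.
    by exists (f (exist _ x Yx)) => Yx'; rewrite (Prop_irrelevance Yx Yx').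
  exists h => x x' Yx Yx'; rewrite -(hh _ Yx) -(hh _ Yx') => e.
  by have [] := fi _ _ I I e.
have [[m0 hm0]|h] := pselect (exists m, ~ countable [set j | lt j m]); last first.
  exists S, sval, lt; split=> [|[x px] [y py] /= e|[x px]] //; last exact: eq_exist.
  by split=> // i; apply: contrapT => hi; apply: h; exists i.
have [m [hm hmin]] : exists m, ~ countable [set j | lt j m] /\
    forall j, lt j m -> countable [set i | lt i j].
  elim/(well_founded_ind wf): m0 hm0 => m IH hm.
  have [[j [jm nj]]|h] := pselect (exists j, lt j m /\ ~ countable [set i | lt i j]).
    exact: IH nj.
  by exists m; split=> // j jm; apply: contrapT => nj; apply: h; exists j.
pose I0 := {j : S | lt j m}.
exists I0, (fun i => sval (sval i)), (fun i j => lt (sval i) (sval j)).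
have inj (i j : I0) : sval i = sval j -> i = j.
  by case: i j => [i pi] [j pj] /= e; exact: eq_exist.
split; last 2 first.
- by move=> i j e; apply: inj; move: e; case: (sval i) (sval j) => [a pa] [b pb] /= e;
    exact: eq_exist.
- by move=> i; case: (sval i).
split.
- suff acc s : Acc lt s -> forall i : I0, sval i = s ->
      Acc (fun i j : I0 => lt (sval i) (sval j)) i by move=> i; exact: acc (wf _) _ erefl.
  elim=> {}s _ IH i si; constructor => j; rewrite si => ji; exact: IH ji _ erefl.
- by move=> i j nij; apply: tot => /inj.
- by move=> i j; exact: asym.
- move=> i; have /countableE[f fi] := hmin (sval i) (svalP i).
  apply/countableE; exists (f \o sval) => a b /= ai bi e; apply: inj; exact: fi.
- move=> /countableE[f fi]; apply: hm; apply/countableE.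
  have /choice[h hh] : forall j, exists n, forall p : lt j m, f (exist _ j p) = n.
    move=> j; have [p|np] := pselect (lt j m); last by exists 0.
    by exists (f (exist _ j p)) => p'; rewrite (Prop_irrelevance p p').
  exists h => a b pa pb; rewrite -(hh _ pa) -(hh _ pb) => e.
  by have [] := fi _ _ I I e.
Qed.

Section Omega1.
Variables (I : Type) (lt : I -> I -> Prop).
Hypothesis hI : omega1_like lt.

Lemma omega1_above i : ~ countable [set j | lt i j].
Proof.
case: hI => wf tot asym cnt unc h; apply: unc.
apply: (@countableS _ _ (\bigcup_(k in [set: option bool]) match k with
  | None => [set i] | Some true => [set j | lt j i] | _ => [set j | lt i j] end)).
  move=> j _; have [->|ne] := pselect (j = i); first by exists None.
  by have [?|?] := tot j i ne; [exists (Some true)|exists (Some false)].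
apply: bigcup_countable => // -[[]|] _ //; exact: countable1.
Qed.

Lemma omega1_unbounded (A : set I) i : ~ countable A -> exists2 j, A j & lt i j.
Proof.
case: hI => wf tot asym cnt unc uA; apply: contrapT => h; apply: uA.
apply: (@countableS _ _ (\bigcup_(k in [set: bool])
  if k then [set i] else [set j | lt j i])).
  move=> j Aj; have [->|ne] := pselect (j = i); first by exists true.
  exists false => //=; have [//|ij] := tot j i ne; by case: h; exists j.
apply: bigcup_countable => // -[] _ //; exact: countable1.
Qed.

(** By recursion [f i] is a point of [A] different from all earlier values, which are countably
    many. *)
Lemma omega1_card_aleph1 : card_aleph1 I.
Proof.
case: hI => wf tot asym cnt unc; split=> // A uA.
pose step (i : I) (rec : forall j, lt j i -> I) : I :=
  if pselect (exists a, A a /\ forall j h, rec j h <> a) is left h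
  then sval (cid h) else i.
pose f := Fix wf (fun=> I) step.
have fE i : f i = step i (fun j _ => f j).
  rewrite /f Fix_eq // => x u v uv; congr step.
  by apply: functional_extensionality_dep => y; apply: functional_extensionality_dep => p.
have fP i : A (f i) /\ forall j, lt j i -> f j <> f i.
  rewrite fE /step; case: pselect => [h|h].
    by case: (cid h) => a [Aa ha] /=; split=> // j ji; exact: ha ji.
  exfalso; apply: h.
  have cim : countable (f @` [set j | lt j i]).
    exact: sub_countable (card_image_le _ _) (cnt i).
  have [a [Aa na]] := uncountable_ex (uncountableD uA cim).
  by exists a; split=> // j ji e; apply: na; exists j.
have finj : injective f.
  move=> i j e; apply: contrapT => /tot[h|h].
    by have [_ /(_ _ h)] := fP j.
  by have [_ /(_ _ h)] := fP i; rewrite e.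
have e : (f @` [set: I] #= [set: I])%card by apply: inj_card_eq => ? ? _ _; exact: finj.
rewrite -(card_le_eql e).
by apply: subset_card_le => _ [i _ <-]; case: (fP i).
Qed.

(* Ulam's matrix: fix injections [e i] of the initial segments into [nat]; for each [j]
   some [n] has [e i j = n] for uncountably many [i], and some [n] serves
   uncountably many [j]. *)
Lemma omega1_partition : exists (chi : I -> I),
  ~ countable [set j | ~ countable [set i | chi i = j]].
Proof.
case: hI => wf tot asym cnt unc.
have /choice[e he] : forall i, exists f : I -> nat, forall j j', lt j i -> lt j' i ->
    f j = f j' -> j = j' by move=> i; have /countableE[f fi] := cnt i; exists f.
have /choice[n hn] : forall j, exists n, ~ countable [set i | lt j i /\ e i j = n].
  by move=> j; apply: (uncountable_fiber (@omega1_above j)) => i _; exists (e i j).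
have [N hN] : exists N, ~ countable [set j | [set: I] j /\ n j = N].
  by apply: uncountable_fiber unc _ => j _; exists (n j).
have /choice[chi hchi] : forall i, exists j, forall j',
    n j' = N -> lt j' i -> e i j' = N -> j = j'.
  move=> i; have [[j [j1 j2 j3]]|h] := pselect (exists j, [/\ n j = N, lt j i & e i j = N]).
    by exists j => j' h1 h2 h3; apply: (he i) => //; rewrite h3.
  by exists i => j' h1 h2 h3; case: h; exists j'.
exists chi => cJ; apply: hN; apply: countableS cJ => j [_ nj] /= cf.
apply: (hn j); rewrite nj; apply: countableS cf => i [ji eij] /=.
exact: hchi.
Qed.

End Omega1.

(* Martin's axiom for preorders: the order on [P * nat] in which every proper extension
   increases the second component is antisymmetric. *)
Lemma martin_preorder (hMA : MA_aleph1_sigma_linked) (P : Type) (le : P -> P -> Prop)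
    (C : countType) (cls : P -> C -> Prop) (I : Type) (D : I -> set P) :
  (forall p, le p p) -> (forall p q r, le p q -> le q r -> le p r) ->
  (exists p : P, True) -> (forall p, exists c, cls p c) ->
  (forall p q c, cls p c -> cls q c -> exists r, le r p /\ le r q) ->
  card_aleph1 I -> (forall i p, exists2 q, D i q & le q p) ->
  exists G : set P, [/\ exists p, G p,
     forall p q, G p -> G q -> exists2 r, G r & le r p /\ le r q
   & forall i, exists2 p, D i p & G p].
Proof.
move=> rf tr [p0 _] hcls compat cI hD.
pose T := {classic (P * nat)%type}.
pose leT (u v : T) : bool := `[< u = v \/ v.2 < u.2 /\ le u.1 v.1 >].
have leTP u v : leT u v <-> u = v \/ v.2 < u.2 /\ le u.1 v.1.
  by split=> [/asboolP|h]; [|apply/asboolP].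
have rT : reflexive leT by move=> u; apply/leTP; left.
have aT : antisymmetric leT.
  move=> u v /andP[/leTP[//|[h _]] /leTP[//|[h' _]]].
  by have := ltn_trans h h'; rewrite ltnn.
have tT : transitive leT.
  move=> v u w /leTP[->//|[h1 h2]] /leTP[<-|[h3 h4]]; apply/leTP; right; split=> //.
    exact: ltn_trans h1.
  exact: tr h2 h4.
pose d := Order.Disp tt tt.
pose B := Order.Le_isPOrder.Build d T rT aT tT.
pose T' : porderType d := HB.pack T B.
have leE (u v : T') : (u <= v)%O = leT u v by [].
have up (p q : P) (n m : nat) : m < n -> le p q -> leT (p, n) (q, m).
  by move=> mn pq; apply/leTP; right.
have down (u v : T) : leT u v -> le u.1 v.1 by move=> /leTP[->|[]].
have sl : sigma_linked T'.
  exists (fun n => [set u : T' | exists2 c, unpickle n = Some c & cls u.1 c]).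
    rewrite -subTset => -[p n] _; have [c hc] := hcls p.
    by exists (pickle c) => //; exists c; rewrite ?pickleK.
  move=> n [p k] [q l] [c nc hp] [c' nc' hq].
  have ecc : c = c' by move: nc'; rewrite nc => -[].
  have [r [rp rq]] : exists r, le r p /\ le r q by apply: compat hp _; rewrite ecc.
  by exists (r, (maxn k l).+1); split; apply: up => //=; lia.
have [G [[[p Gp] _ Gdir] Gdense]] : exists G : set T', order_filter G /\
    forall i, G `&` [set u | D i u.1] !=set0.
  have [|i [p n]|G Gf Gd] := hMA d T' _ sl I (fun i => [set u | D i u.1]) cI.
  - by exists (p0, 0).
  - by have [q Dq qp] := hD i p; exists (q, n.+1) => //; exact: up.
  - by exists G.
exists [set p | exists n, G (p, n)]; split.
- by case: p Gp => p n; exists p, n.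
- move=> p1 p2 [n1 G1] [n2 G2]; have [[r n] Gr [r1 r2]] := Gdir _ _ G1 G2.
  by exists r; [exists n|split; [exact: (down _ _ r1)|exact: (down _ _ r2)]].
- by move=> i; have [[q n] [Gq Dq]] := Gdense i; exists q => //; exists n.
Qed.

(** * Forcing a labelling whose branches meet disagreements *)

Definition split_level (x y : nat -> bool) : nat :=
  if pselect (exists n, `[< x n <> y n >]) is left h then ex_minn h else 0.

Lemma split_level_le x y k : x k <> y k -> split_level x y <= k.
Proof.
move=> xyk; rewrite /split_level; case: pselect => // h; case: ex_minnP => m _; apply.
exact/asboolP.
Qed.

Lemma split_levelP x y : x <> y ->
  agree (split_level x y) x y /\ x (split_level x y) <> y (split_level x y).
Proof.
move=> /split_ex[k xy nk]; rewrite /split_level; case: pselect => [h|[]]; last first.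
  by exists k; apply/asboolP.
case: ex_minnP => m /asboolP nm hm; split=> // i im; apply: contrapT => ni.
by have := hm i (introT (asboolP _) ni); lia.
Qed.

Lemma agree_split_level x y k : x <> y -> agree k x y -> k <= split_level x y.
Proof.
by move=> /split_levelP[_ n] h; rewrite leqNgt; apply/negP => /h.
Qed.

Lemma split_level_sym x y : split_level x y = split_level y x.
Proof.
have [->//|nxy] := pselect (x = y).
apply/eqP; rewrite eqn_leq; apply/andP; split; apply: split_level_le.
  by have [_ /nesym] := split_levelP (nesym nxy).
by have [_ /nesym] := split_levelP nxy.
Qed.

Lemma aa_all_seq (T : eqType) (s : seq T) (P : T -> nat -> Prop) :
  (forall x, x \in s -> aa (P x)) -> aa (fun n => forall x, x \in s -> P x n).
Proof.
elim: s => [|y s IH] h; first exact: aaT.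
have h1 : aa (P y) by apply: h; rewrite mem_head.
have h2 : aa (fun n => forall x, x \in s -> P x n).
  by apply: IH => x xs; apply: h; rewrite inE xs orbT.
apply: aaW (aa_and h1 h2) => n [Py Ps] x; rewrite inE => /orP[/eqP->//|].
exact: Ps.
Qed.

Lemma countable_mem_seq (T : eqType) (s : seq T) : countable [set x | x \in s].
Proof. by apply/countableE; exists (index^~ s) => x y xs ys; exact: index_inj. Qed.

Section GenericFamily.
Variables (hMA : MA_aleph1_sigma_linked) (I : eqType) (lt : I -> I -> Prop).
Hypothesis hI : omega1_like lt.
Variables (C : countType) (code : I -> nat -> C) (x : I -> nat -> bool).
Variable W : I -> I -> nat -> Prop.
Let dl i j := split_level (x i) (x j).
Hypothesis x_inj : injective x.
Hypothesis code_x : forall K i j, agree K (code i) (code j) -> agree K (x i) (x j).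
Hypothesis W_sym : forall i j n, W i j n -> W j i n.
Hypothesis W_irr : forall i n, ~ W i i n.
Hypothesis W_fin : forall i j, aa (fun n => ~ W i j n).
Hypothesis W_open : forall i j n, W i j n -> exists K, forall j',
  agree K (code j) (code j') -> W i j' n.
Hypothesis W_trans : forall i i' j j' n, W i i' n -> W j j' n -> W i j n \/ W i j' n.

(** Both alternatives allow finitely many pairs to receive distinct witnesses: this one by
    abundance, [exactly] because the number of witnesses is the same for all pairs. *)
Definition plenty : Prop := forall i j, i != j -> exists s,
  [/\ uniq s, split_level (x i) (x j) < size s
    & forall n, n \in s -> split_level (x i) (x j) <= n /\ W i j n].
Definition exactly (N r : nat) : Prop := 0 < r /\ forall i j, i != j -> exists s,
  [/\ uniq s, size s = r, N <= split_level (x i) (x j), forall n, N <= n -> W i j n <-> n \in s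
    & forall n, n \in s -> split_level (x i) (x j) <= n].

Variable N : nat.
Hypothesis W_many : plenty \/ exists r, exactly N r.

Let W_ex i j : i != j -> exists2 n, dl i j <= n & W i j n.
Proof.
move=> ij; case: W_many => [/(_ i j ij)[[|n s] [_ //= _ h]]|[r [r0 /(_ i j ij)[s]]]].
  by have [|? ?] := h n; [rewrite mem_head|exists n].
case: s r0 => [|n s] r0 [_ /= sr Nd hW hd]; first by rewrite -sr in r0.
have dn : dl i j <= n by apply: hd; rewrite mem_head.
by exists n => //; apply/hW; [exact: leq_trans dn|rewrite mem_head].
Qed.

(* In the exact case a clash [W (E a) (E' a) n], [W (E b) (E' b) n] would, by [W_trans],
   give [E a], [E' b] a witness beyond those of [E a], [E b]. *)
Let distinct_witnesses (k l : nat) (E E' : nat -> I) : l <= k -> N <= k ->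
  (forall a, a < l -> E a != E' a -> k <= dl (E a) (E' a)) ->
  (forall a b, a < l -> b < l -> a <> b -> E a != E b) ->
  (forall a b, a < l -> b < l -> a <> b -> forall n, k <= n -> ~ W (E a) (E b) n) ->
  (forall a b, a < l -> b < l -> a <> b -> forall n, n < k ->
     W (E a) (E b) n -> W (E a) (E' b) n) ->
  exists nu : nat -> nat,
    (forall a, a < l -> E a != E' a ->
       [/\ k <= nu a, dl (E a) (E' a) <= nu a & W (E a) (E' a) (nu a)]) /\
    (forall a b, a < l -> b < l -> E a != E' a -> E b != E' b -> nu a = nu b -> a = b).
Proof.
move=> lk Nk hdl hE hW hE'; case: W_many => [hp|[r [r0 hr]]]; last first.
  have /choice[nu hnu] : forall a, exists n, E a != E' a -> dl (E a) (E' a) <= n /\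
      W (E a) (E' a) n.
    move=> a; have [e|ne] := eqVneq (E a) (E' a); first by exists 0.
    by have [n h1 h2] := W_ex ne; exists n.
  exists nu; split=> [a al ne|a b al bl nea neb nab].
    have [h1 h2] := hnu a ne; split=> //; apply: leq_trans h1; exact: hdl.
  apply: contrapT => neab; have [da wa] := hnu a nea; have [db wb] := hnu b neb.
  have kn : k <= nu a by apply: leq_trans da; exact: hdl.
  rewrite -nab in wb; have [w|w] := W_trans wa wb; first exact: (hW _ _ al bl neab _ kn w).
  have [e|ne] := eqVneq (E a) (E' b); first by move: w; rewrite e => /W_irr.
  have [s [us ss Ns hs ds]] := hr _ _ (hE _ _ al bl neab).
  have [s' [us' ss' Ns' hs' _]] := hr _ _ ne.
  have Nn : N <= nu a := leq_trans Nk kn.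
  have sub : {subset s <= s'}.
    move=> n ns; have Nn' : N <= n := leq_trans Ns (ds n ns).
    have wn : W (E a) (E b) n by apply/hs.
    apply/hs' => //; apply: hE' => //; rewrite ltnNge; apply/negP => kn'.
    exact: (hW _ _ al bl neab _ kn').
  have [_ ee] : (size s = size s') * (s =i s').
    by apply: uniq_min_size; rewrite ?ss ?ss'.
  apply: (hW _ _ al bl neab _ kn); apply/hs => //.
  by rewrite ee; apply/hs'.
(* With plenty of witnesses choose greedily: a pair that splits at [k] or later has more than
   [k >= l] of them, and fewer than [l] are taken. *)
suff greedy m : m <= l -> exists nu : nat -> nat,
    (forall a, a < m -> E a != E' a ->
       [/\ k <= nu a, dl (E a) (E' a) <= nu a & W (E a) (E' a) (nu a)]) /\
    (forall a b, a < m -> b < m -> E a != E' a -> E b != E' b -> nu a = nu b -> a = b).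
  exact: greedy.
elim: m => [|m IH] ml; first by exists id.
have [nu [h1 h2]] := IH (ltnW ml).
have [e|ne] := eqVneq (E m) (E' m).
  exists nu; split=> [a|a b]; rewrite !ltnS leq_eqVlt.
    by case/orP => [/eqP->|/h1 //]; rewrite e eqxx.
  case/orP => [/eqP->|am]; first by rewrite e eqxx.
  rewrite leq_eqVlt => /orP[/eqP-> _|bm]; first by rewrite e eqxx.
  exact: h2.
have [s [us ds hs]] := hp _ _ ne.
have [n ns nn] : exists2 n, n \in s & n \notin mkseq nu m.
  apply: contrapT => h.
  have sub : {subset s <= mkseq nu m}.
    by move=> n ns; apply/negPn/negP => nn; apply: h; exists n.
  have := uniq_leq_size us sub; rewrite size_mkseq => sm.
  have := hdl m ml ne; move: ds sm lk ml; rewrite /dl; lia.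
have nuP b : b < m -> n != nu b.
  move=> bm; apply: contra nn => /eqP ->; apply/mapP; exists b => //.
  by rewrite mem_iota add0n bm.
exists (fun a => if a == m then n else nu a); split=> [a|a b].
  rewrite ltnS leq_eqVlt => /orP[/eqP-> _|am nea].
    rewrite eqxx; have [d1 d2] := hs n ns; split=> //; apply: leq_trans d1; exact: hdl.
  by rewrite ltn_eqF //; apply: h1.
rewrite !ltnS leq_eqVlt => /orP[/eqP->|am]; rewrite leq_eqVlt => /orP[/eqP->|bm] //.
- rewrite eqxx ltn_eqF // => _ _ e; by have := nuP b bm; rewrite e eqxx.
- rewrite eqxx (ltn_eqF am) => _ _ e; by have := nuP a am; rewrite e eqxx.
- by rewrite !ltn_eqF //; apply: h2.
Qed.

Variable chi : I -> I.

(* [i] is a condensation point of its fiber. *)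
Let good i := forall K, ~ countable [set j | chi j = chi i /\ agree K (code i) (code j)].

Let not_good_countable z : countable [set i | chi i = z /\ ~ good i].
Proof.
pose B (Kw : nat * seq C) := [set i | [/\ chi i = z, mkseq (code i) Kw.1 = Kw.2 &
  countable [set j | chi j = z /\ agree Kw.1 (code i) (code j)]]].
apply: (@countableS _ _ (\bigcup_(Kw in [set: nat * seq C]) B Kw)).
  move=> i [cz ng]; have [K hK] : exists K,
      countable [set j | chi j = chi i /\ agree K (code i) (code j)].
    by apply: contrapT => h; apply: ng => K hK; apply: h; exists K.
  by exists (K, mkseq (code i) K) => //; split=> //; rewrite -cz.
apply: bigcup_countable => // -[K w] _.
have [[i [iz iw ci]]|h] := pselect (exists i, B (K, w) i).
  apply: countableS ci => j [jz jw _]; split=> //; apply/agree_mkseq.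
  by rewrite iw jw.
by apply: countableS (@countable0 _) => i Bi; apply: h; exists i.
Qed.

Let good_uncountable i K : good i ->
  ~ countable [set j | [/\ good j, chi j = chi i & agree K (code i) (code j)]].
Proof.
move=> gi h; apply: (uncountableD (gi K) (not_good_countable (chi i))).
apply: countableS h => j [[ji aj] nB]; split=> //.
by apply: contrapT => ng; apply: nB.
Qed.

(** The labels are decided below [level]. Two promised indices in one fiber of [chi] are to have a
    disagreement, already labelled, on the branch attached to that fiber. *)
Record cond := Cond { level : nat; labels : nat -> option (seq bool); promises : seq I }.

Let witnessed (g : nat -> option (seq bool)) k i j :=
  exists n, [/\ n < k, dl i j <= n, W i j n & branch g (x (chi i)) n].

(** The bound on the number of promises serves twice. It leaves room for the greedy choice, and it
    makes levels grow with the promises; new labels then grow by [ext], whence finite fibers. *)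
Let valid (p : cond) := [/\ size (promises p) <= level p, N <= level p, uniq (promises p),
  forall i, i \in promises p -> good i &
  forall i j, i \in promises p -> j \in promises p -> i != j ->
    (forall n, level p <= n -> ~ W i j n) /\
    (chi i = chi j -> witnessed (labels p) (level p) i j)].

Let ext (q p : cond) := [/\ level p <= level q, agree (level p) (labels p) (labels q),
  {subset promises p <= promises q} &
  forall n t, level p <= n -> n < level q -> labels q n = Some t -> level p <= size t].

Let ext_refl p : ext p p.
Proof. by split=> // n t pn np; have := leq_ltn_trans pn np; rewrite ltnn. Qed.

Let ext_trans p q r : ext p q -> ext q r -> ext p r.
Proof.
move=> [l1 a1 s1 h1] [l2 a2 s2 h2]; split.
- exact: leq_trans l1.
- exact: agree_trans a2 (agreeW l2 a1).
- by move=> i /s2 /s1.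
- move=> n t rn np pn; have [nq|qn] := ltnP n (level q).
    by apply: (h2 n) => //; rewrite a1.
  by apply: leq_trans l2 _; exact: (h1 n).
Qed.

Let branch_agree k g g' y n : agree k g g' -> n < k -> branch g y n -> branch g' y n.
Proof. by move=> a nk; rewrite /branch a. Qed.

Let witnessed_sym g k i j : chi i = chi j -> witnessed g k i j -> witnessed g k j i.
Proof.
move=> cij [n [nk dn w b]]; exists n; split=> //; [|exact: W_sym|by rewrite -cij].
by rewrite /dl split_level_sym.
Qed.

Let witnessed_ext g g' k k' i j : k <= k' -> agree k g g' -> witnessed g k i j ->
  witnessed g' k' i j.
Proof.
move=> kk' a [n [nk dn w b]]; exists n; split=> //; first exact: leq_trans kk'.
exact: branch_agree a nk b.
Qed.

(* [L n z] says that [n] is to be put on the branch [x z]. *)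
Let amalgam (k : nat) g (E : seq I) (L : nat -> I -> Prop) (b : nat) : N <= k ->
  (forall i, i \in E -> good i) -> uniq E ->
  (forall n z, L n z -> k <= n < b) -> (forall n z z', L n z -> L n z' -> z = z') ->
  (forall i j, i \in E -> j \in E -> i != j -> chi i = chi j ->
     witnessed g k i j \/ exists n, [/\ L n (chi i), dl i j <= n & W i j n]) ->
  exists2 q, valid q & [/\ promises q = E, k <= level q, agree k g (labels q) &
    forall n t, k <= n -> labels q n = Some t -> k <= size t].
Proof.
move=> Nk gE uE Lb Lfun hE.
have /choice[lab hlab] : forall n, exists o,
    (forall z, L n z -> o = Some (mkseq (x z) k)) /\ (forall t, o = Some t -> size t = k).
  move=> n; have [[z Lz]|h] := pselect (exists z, L n z).
    exists (Some (mkseq (x z) k)); split=> [z' Lz'|t [<-]]; last by rewrite size_mkseq.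
    by rewrite (Lfun _ _ _ Lz Lz').
  by exists None; split=> // z Lz; case: h; exists z.
have [M hM] : aa (fun n => forall i, i \in E -> forall j, j \in E -> ~ W i j n).
  by apply: aa_all_seq => i _; apply: aa_all_seq => j _; apply: W_fin.
pose k' := maxn (maxn k b) (maxn M (size E)).
have kk' : k <= k' by rewrite /k'; lia.
exists (Cond k' (patch k g lab) E); last first.
  split=> //=; first exact: agree_patch.
  move=> n t kn; rewrite /patch ltnNge kn /= => /(hlab n).2 ->; exact: leqnn.
split=> //=; [by rewrite /k'; lia|exact: leq_trans kk'|].
move=> i j iE jE ij; split=> [n kn|cij].
  by apply: (hM n) => //; apply: leq_trans kn; rewrite /k'; lia.
have [w|[n [Ln dn w]]] := hE i j iE jE ij cij.
  exact: witnessed_ext kk' (agree_patch _ _) w.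
have /andP[kn nb] := Lb _ _ Ln.
exists n; split=> //; first by rewrite /k'; lia.
by rewrite /branch /patch ltnNge kn /= ((hlab n).1 _ Ln) size_mkseq eqxx.
Qed.

(** Below [K] enough of the codes is visible that a promised index may be replaced by one with the
    same code there: splittings and disagreements below the level survive. *)
Let precise (p : cond) K := [/\ level p <= K,
  forall i j, i \in promises p -> j \in promises p -> i != j -> dl i j < K,
  forall i j, i \in promises p -> j \in promises p -> chi i != chi j ->
    dl (chi i) (chi j) < K
  & forall i j j' n, i \in promises p -> j \in promises p -> n < level p -> W i j n ->
    agree K (code j) (code j') -> W i j' n].

Let precise_ex p : exists K, precise p K.
Proof.
set E := promises p.
have h1 : aa (fun K => forall i, i \in E -> forall j, j \in E -> dl i j < K).
  by apply: aa_all_seq => i _; apply: aa_all_seq => j _; exists (dl i j).+1.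
have h2 : aa (fun K => forall i, i \in E -> forall j, j \in E -> dl (chi i) (chi j) < K).
  by apply: aa_all_seq => i _; apply: aa_all_seq => j _; exists (dl (chi i) (chi j)).+1.
have h3 : aa (fun K => forall i, i \in E -> forall j, j \in E -> forall n, n < level p ->
    W i j n -> forall j', agree K (code j) (code j') -> W i j' n).
  apply: aa_all_seq => i _; apply: aa_all_seq => j _; apply: aa_ltn_all => n _.
  have [w|nw] := pselect (W i j n); last exact: aaT.
  have [K hK] := W_open w; exists K => K' KK' _ j' a; apply: hK; exact: agreeW a.
have [K hK] := aa_and (aa_and h1 h2) (aa_and h3 (aa_ge (level p))).
have [[a1 a2] [a3 a4]] := hK K (leqnn K).
exists K; split=> // [i j iE jE _|i j iE jE _|i j j' n iE jE np w a]; try exact: a1;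
  try exact: a2.
exact: (a3 i iE j jE n np w).
Qed.

Let transfer p K i j j' : precise p K -> i \in promises p -> j \in promises p -> i != j ->
  i != j' -> agree K (code j) (code j') -> witnessed (labels p) (level p) i j ->
  witnessed (labels p) (level p) i j'.
Proof.
move=> [pK hd _ hW] iE jE ij ij' a [n [np dn w b]]; exists n; split=> //; last exact: hW w a.
have nx : x i <> x j by move=> /x_inj e; rewrite e eqxx in ij.
have [_ nd] := split_levelP nx.
apply: leq_trans dn; apply: split_level_le; rewrite -(code_x a) //; exact: hd.
Qed.

Let P := {p : cond | valid p}.

Let cls (p : P) (c : nat * seq (option (seq bool)) * nat * seq (seq C) * seq (seq bool)) :=
  let: (k, g, K, codes, reals) := c in
  [/\ level (sval p) = k, mkseq (labels (sval p)) k = g, precise (sval p) K,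
      [seq mkseq (code i) K | i <- promises (sval p)] = codes
    & [seq mkseq (x (chi i)) K | i <- promises (sval p)] = reals].

Let cls_ex p : exists c, cls p c.
Proof.
have [K hK] := precise_ex (sval p).
by exists (level (sval p), mkseq (labels (sval p)) (level (sval p)), K,
  [seq mkseq (code i) K | i <- promises (sval p)],
  [seq mkseq (x (chi i)) K | i <- promises (sval p)]).
Qed.

(** Match the promises by position. Indices at different positions inherit a witness by [transfer];
    different indices at the same position get a new one above the level when they lie in one fiber,
    and [distinct_witnesses] keeps these from colliding. *)
Let cls_compat p q c : cls p c -> cls q c ->
  exists r : P, ext (sval r) (sval p) /\ ext (sval r) (sval q).
Proof.
case: p q c => [p vp] [q vq] [[[[k g] K] codes] reals] /= [pk pg pK pc pr] [qk qg qK qc qr].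
set E := promises p in pc pr; set E' := promises q in qc qr.
have ss : size E' = size E by rewrite -(size_map (fun i => mkseq (code i) K) E) pc -qc size_map.
have agg : agree k (labels p) (labels q) by apply/agree_mkseq; rewrite pg.
have [sp Np uE gE hE] := vp; have [sq Nq uE' gE' hE'] := vq.
rewrite -/E -/E' in sp sq uE uE' gE gE' hE hE'; rewrite pk in sp Np hE; rewrite qk in sq Nq hE'.
have [i0|E0] : (exists i0 : I, i0 \in E) \/ E = [::].
- by case: (E) => [|i s]; [right|left; exists i; rewrite mem_head].
- case: i0 => i0 _; pose e a := nth i0 E a; pose e' a := nth i0 E' a.
  have ecode a : a < size E -> agree K (code (e a)) (code (e' a)).
    move=> al; apply/agree_mkseq.
    have : nth [::] codes a = nth [::] codes a by [].
    by rewrite -{1}pc -qc !(nth_map i0) ?ss.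
  have ereal a : a < size E -> agree K (x (chi (e a))) (x (chi (e' a))).
    move=> al; apply/agree_mkseq.
    have : nth [::] reals a = nth [::] reals a by [].
    by rewrite -{1}pr -qr !(nth_map i0) ?ss.
  have eE a : a < size E -> e a \in E by move=> al; apply: mem_nth.
  have eE' a : a < size E -> e' a \in E' by move=> al; apply: mem_nth; rewrite ss.
  have ne a b : a < size E -> b < size E -> a <> b -> e a != e b.
    by move=> al bl ab; rewrite nth_uniq //; apply/eqP.
  have kK : k <= K by case: pK => h _ _ _; rewrite -pk.
  have [nu [nu1 nu2]] : exists nu : nat -> nat,
    (forall a, a < size E -> e a != e' a ->
       [/\ k <= nu a, dl (e a) (e' a) <= nu a & W (e a) (e' a) (nu a)]) /\
    (forall a b, a < size E -> b < size E -> e a != e' a -> e b != e' b -> nu a = nu b -> a = b).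
    apply: distinct_witnesses => //.
    + move=> a al nea; apply: leq_trans kK _; apply: agree_split_level.
        by move=> /x_inj ee; rewrite ee eqxx in nea.
      by apply: code_x; exact: ecode.
    + move=> a b al bl ab n kn; have [h _] := hE _ _ (eE a al) (eE b bl) (ne a b al bl ab).
      exact: h.
    + move=> a b al bl ab n nk w; case: pK => _ _ _ h.
      by apply: (h (e a) (e b)) => //; [exact: eE|exact: eE|rewrite pk|exact: ecode].
  pose L n z := exists a, [/\ a < size E, e a != e' a, chi (e a) = chi (e' a), n = nu a
    & z = chi (e a)].
  have [bd hbd] : exists b, forall a, a < size E -> nu a < b.
    exists (\max_(a < size E) nu a).+1 => a al.
    by rewrite ltnS; exact: (leq_bigmax (Ordinal al)).
  have mixed i j : i \in E -> j \in E' -> i != j -> chi i = chi j ->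
      witnessed (labels p) k i j \/ exists n, [/\ L n (chi i), dl i j <= n & W i j n].
    move=> iE jE' ij cij.
    have al : index i E < size E by rewrite index_mem.
    have bl : index j E' < size E by rewrite -ss index_mem.
    set a := index i E in al; set b := index j E' in bl.
    have ea : e a = i by rewrite /e nth_index.
    have eb : e' b = j by rewrite /e' nth_index.
    have [ab|ab] := eqVneq a b.
      right; rewrite -ab in eb.
      have nea : e a != e' a by rewrite ea eb.
      have [h1 h2 h3] := nu1 a al nea; rewrite ea eb in h2 h3.
      by exists (nu a); split=> //; exists a; rewrite ea eb.
    left; have abP : a <> b by apply/eqP.
    have nab := ne a b al bl abP.
    (* Reals attached to different fibers would split below [K], but the class records them up to
       [K]. *)
    have cab : chi (e a) = chi (e b).
      apply/eqP/negPn/negP => nc; case: pK => _ _ hd _.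
      have := hd _ _ (eE a al) (eE b bl) nc; rewrite ltnNge => /negP; apply.
      apply: agree_split_level; first by move=> /x_inj cc; rewrite cc eqxx in nc.
      by rewrite ea cij -eb; apply: agree_sym; exact: ereal.
    have [_ h] := hE _ _ (eE a al) (eE b bl) nab.
    have := h cab; rewrite -pk -[j]eb -[in X in _ -> X]ea => w.
    apply: (transfer pK _ _ nab) w; [exact: eE|exact: eE|by rewrite ea eb|exact: ecode].
  have [r vr [rE rk ra rt]] : exists2 r, valid r & [/\ promises r = undup (E ++ E'),
      k <= level r, agree k (labels p) (labels r) &
      forall n t, k <= n -> labels r n = Some t -> k <= size t].
    apply: (@amalgam k (labels p) (undup (E ++ E')) L bd) => //.
    + by move=> i; rewrite mem_undup mem_cat => /orP[/gE|/gE'].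
    + exact: undup_uniq.
    + by move=> n z [a [al nea _ -> _]]; have [h _ _] := nu1 a al nea; rewrite h hbd.
    + move=> n z z' [a [al nea _ na ->]] [b [bl neb _ nb ->]].
      by rewrite (nu2 a b al bl nea neb) // -na.
    + move=> i j; rewrite !mem_undup !mem_cat => /orP[iE|iE'] /orP[jE|jE'] ij cij.
      * by left; have [_] := hE i j iE jE ij; apply.
      * exact: mixed.
      * have ji : j != i by rewrite eq_sym.
        have [w|[n [Ln dn w]]] := mixed j i jE iE' ji (esym cij).
          by left; apply: witnessed_sym w.
        right; exists n; split; [by rewrite cij|by rewrite /dl split_level_sym|exact: W_sym].
      * left; have [_ h] := hE' i j iE' jE' ij.
        exact: witnessed_ext (leqnn k) (agree_sym agg) (h cij).
  exists (exist _ r vr); split; split=> //=; rewrite ?pk ?qk //.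
  + by move=> i iE; rewrite rE mem_undup mem_cat iE.
  + by move=> n t kn _; exact: rt.
  + exact: agree_trans (agree_sym agg) ra.
  + by move=> i iE'; rewrite rE mem_undup mem_cat iE' orbT.
  + by move=> n t kn _; exact: rt.
have E'0 : E' = [::] by apply: size0nil; rewrite ss E0.
exists (exist _ p vp); split; split=> //=; rewrite ?pk ?qk //.
- by move=> n t kn nk; have := leq_ltn_trans kn nk; rewrite ltnn.
- exact: agree_sym.
- by rewrite -/E' E'0.
- by move=> n t kn nk; have := leq_ltn_trans kn nk; rewrite ltnn.
Qed.

Let D (i0 : I) : set P := [set p | good i0 -> exists i,
  [/\ i \in promises (sval p), lt i0 i & chi i = chi i0]].

(** If the fiber has a promised index [j0], take the new index close to it, as [j0] is a
    condensation point. Witnesses of [j0] transfer, and only the pair formed with [j0] needs a new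
    one. *)
Let D_dense i0 (p : P) : exists2 q : P, D i0 q & ext (sval q) (sval p).
Proof.
case: p => p vp; have [gi|ngi] := pselect (good i0); last first.
  by exists (exist _ p vp).
set E := promises p; have [sE Np uE gE hE] := vp; rewrite -/E in sE uE gE hE.
have fresh (A : set I) : ~ countable A -> exists i, [/\ A i, lt i0 i & i \notin E].
  move=> uA.
  have [i [Ai /= iE] i0i] := omega1_unbounded hI i0 (uncountableD uA (countable_mem_seq E)).
  by exists i; split=> //; apply/negP.
suff [i [L [b [gi' ci i0i iE h]]]] : exists i (L : nat -> I -> Prop) b,
    [/\ good i, chi i = chi i0, lt i0 i, i \notin E &
    [/\ forall n z, L n z -> level p <= n < b, forall n z z', L n z -> L n z' -> z = z' &
     forall j, j \in E -> chi i = chi j -> witnessed (labels p) (level p) j i \/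
       exists n, [/\ L n (chi i), dl j i <= n & W j i n]]].
  have [h1 h2 h3] := h.
  have iE' j : j \in E -> j != i by move=> jE; apply: contraNneq iE => <-.
  have [//|||//|//||r vr [rE rk ra rt]] := @amalgam (level p) (labels p) (i :: E) L b.
  - by move=> j; rewrite inE => /orP[/eqP->|/gE].
  - by rewrite /= iE.
  - move=> j l; rewrite !inE => /orP[/eqP->|jE] /orP[/eqP->|lE] jl cjl.
    + by rewrite eqxx in jl.
    + have [w|[n [Ln dn w]]] := h3 l lE cjl.
        by left; apply: witnessed_sym w.
      by right; exists n; split=> //; [rewrite /dl split_level_sym|exact: W_sym].
    + have [w|[n [Ln dn w]]] := h3 j jE (esym cjl); first by left.
      by right; exists n; split=> //; rewrite cjl.
    + by left; have [_] := hE j l jE lE jl; apply.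
  exists (exist _ r vr) => [_|]; first by exists i; rewrite rE mem_head.
  split=> //=; first by move=> j jE; rewrite rE inE jE orbT.
  by move=> n t pn _; exact: rt.
have [[j0 [j0E cj0]]|nj] := pselect (exists j0, j0 \in E /\ chi j0 = chi i0); last first.
  have [i [[gi' ci _] i0i iE]] := fresh _ (good_uncountable (K := 0) gi).
  exists i, (fun _ _ => False), 0; split=> //; split=> // j jE cij; case: nj.
  by exists j; rewrite -cij.
have [K pK] := precise_ex p.
have [i [[gi' ci aij] i0i iE]] := fresh _ (good_uncountable (K := K) (gE j0 j0E)).
have j0i : j0 != i by apply: contraNneq iE => <-.
have [n0 dn0 w0] := W_ex j0i.
have pn0 : level p <= n0.
  apply: leq_trans dn0; have [pK' _ _ _] := pK; apply: leq_trans pK' _.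
  by apply: agree_split_level; [move=> /x_inj e; rewrite e eqxx in j0i|exact: code_x].
exists i, (fun n z => n = n0 /\ z = chi i), n0.+1; split=> //; first by rewrite ci cj0.
split=> [n z [-> _]|n z z' [_ ->] [_ ->] //|j jE cij]; first by rewrite pn0 ltnSn.
have [->|jj0] := eqVneq j j0; first by right; exists n0.
left; have ji : j != i by apply: contraNneq iE => <-.
apply: (transfer pK jE j0E jj0 ji aij).
by have [_] := hE j j0 jE j0E jj0; apply; rewrite -cij ci.
Qed.

(** The labels in the filter fit together to [g]. The promised indices of an uncountable fiber are
    unbounded in it by the dense sets [D], hence uncountable. *)
Lemma generic_family : ~ countable [set z | ~ countable [set i | chi i = z]] ->
  exists g, finite_fibers g /\ forall z, ~ countable [set i | chi i = z] ->
    exists2 Y : set I, ~ countable Y & forall i j, Y i -> Y j -> i <> j ->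
      exists n, [/\ split_level (x i) (x j) <= n, W i j n & branch g (x z) n].
Proof.
move=> uZ.
have v0 : valid (Cond N (fun=> None) [::]) by [].
have [G [[p0 Gp0] Gdir Gdense]] := @martin_preorder hMA P (fun q p => ext (sval q) (sval p))
  _ cls I D (fun p => ext_refl (sval p)) (fun p q r a b => ext_trans a b)
  (ex_intro _ (exist _ _ v0) Logic.I) cls_ex cls_compat (omega1_card_aleph1 hI) D_dense.
pose lev (p : P) := level (sval p); pose lab (p : P) := labels (sval p).
have /choice[g hg] : forall n, exists o,
    (forall p, G p -> n < lev p -> lab p n = o) /\
    (forall t, o = Some t -> exists2 p, G p & n < lev p).
  move=> n; have [[p [Gp np]]|h] := pselect (exists p, G p /\ n < lev p).
    exists (lab p n); split=> [q Gq nq|t _]; last by exists p.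
    have [r Gr [[_ a1 _ _] [_ a2 _ _]]] := Gdir p q Gp Gq.
    by rewrite /lab a1 // a2.
  by exists None; split=> // p Gp np; case: h; exists p.
have glab p : G p -> agree (lev p) (lab p) g by move=> Gp n np; exact: (hg n).1.
have uncountable_good z : ~ countable [set i | chi i = z] ->
    ~ countable [set i | chi i = z /\ good i].
  move=> uz h; apply: (uncountableD uz (not_good_countable z)).
  apply: countableS h => i [iz ng]; split=> //.
  by apply: contrapT => ngi; apply: ng.
have above (A B : set I) : ~ countable A -> countable B ->
    exists2 a, A a & forall b, B b -> ~ (b = a) /\ ~ lt a b.
  move=> uA cB; have [_ tot asym cnt _] := hI.
  have cB' : countable (\bigcup_(b in B) ([set b] `|` [set j | lt j b])).
    apply: bigcup_countable => // b _.
    apply: (@countableS _ _ (\bigcup_(k in [set: bool])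
      if k then [set b] else [set j | lt j b])).
      by move=> j [jb|jb]; [exists true|exists false].
    by apply: bigcup_countable => // -[] _ //; exact: countable1.
  have [a [Aa na]] := uncountable_ex (uncountableD uA cB'); exists a => // b Bb.
  by split=> h; apply: na; exists b => //; [left|right].
have large m : exists2 p, G p & m <= size (promises (sval p)).
  elim: m => [|m [p Gp mp]]; first by exists p0.
  have [z uz] := uncountable_ex uZ.
  have [a [az ga] nlt] := above _ _ (uncountable_good z uz)
    (countable_mem_seq (promises (sval p))).
  have [q Dq Gq] := Gdense a; have [i [iq ai _]] := Dq ga.
  have [r Gr [[_ _ sp _] [_ _ sq _]]] := Gdir p q Gp Gq.
  exists r => //.
  have [_ _ up _ _] := svalP p.
  have : uniq (i :: promises (sval p)).
    by rewrite /= up andbT; apply/negP => /nlt[_].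
  move=> /uniq_leq_size h; apply: leq_trans (h (promises (sval r)) _); first by [].
  by move=> j; rewrite inE => /orP[/eqP->|/sp //]; exact: sq.
exists g; split.
  move=> t; have [p Gp tp] := large (size t).+1.
  exists (lev p) => n pn /[dup] gn /(hg n).2[q Gq nq].
  have [r Gr [[pr _ _ hr] [qr aq _ _]]] := Gdir p q Gp Gq.
  have nr : n < lev r := leq_trans nq qr.
  have := hr n t pn nr; rewrite -/(lab r n) (glab r Gr n nr) => /(_ gn) pt.
  have [sl _ _ _ _] := svalP p.
  by have := leq_trans tp (leq_trans sl pt); rewrite ltnn.
move=> z uz.
exists [set i | [/\ chi i = z, good i & exists2 p, G p & i \in promises (sval p)]].
  move=> cY; have [a [az ga] nlt] := above _ _ (uncountable_good z uz) cY.
  have [q Dq Gq] := Gdense a; have [i [iq ai ci]] := Dq ga.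
  have [_ _ _ gq _] := svalP q.
  by have [|_] := nlt i; [split; [rewrite ci|exact: gq|exists q]|].
move=> i j [ci _ [p Gp ip]] [cj _ [q Gq jq]] ij.
have [r Gr [[_ _ sp _] [_ _ sq _]]] := Gdir p q Gp Gq.
have [_ _ _ _ hr] := svalP r.
have ijb : i != j by apply/eqP.
have [_ ] := hr i j (sp i ip) (sq j jq) ijb.
rewrite ci cj => /(_ erefl)[n [nr dn w b]]; exists n; split=> //.
by rewrite -ci; exact: branch_agree (glab r Gr) nr b.
Qed.

End GenericFamily.

(** For each pair with [m <= size t], one integer of [V m] beyond [size t] gets the label [t]. The
    inequality keeps the fibers finite, and long initial segments of a branch reach every [m]. *)
Lemma tree_meeting (V : nat -> nat -> Prop) : (forall m, io (V m)) ->
  exists g, finite_fibers g /\ forall x m, io (fun n => branch g x n /\ V m n).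
Proof.
move=> hV.
pose tm i : seq bool * nat := odflt ([::], 0) (@unpickle (seq bool * nat)%type i).
have [r hr] := @io_disjointify (fun i => V (tm i).2) (fun i => hV (tm i).2).
have /choice[u hu] : forall i, exists n, [/\ size (tm i).1 <= n, V (tm i).2 n & r n = i].
  by move=> i; have [n h1 [h2 h3]] := hr i (size (tm i).1); exists n.
pose pk t m := @pickle (seq bool * nat)%type (t, m).
have tmK t m : tm (pk t m) = (t, m) by rewrite /tm pickleK.
pose g n := if (n == u (r n)) && (pk (tm (r n)).1 (tm (r n)).2 == r n) &&
  ((tm (r n)).2 <= size (tm (r n)).1) then Some (tm (r n)).1 else None.
exists g; split=> [t|x m N].
  have h : aa (fun n => forall m, m < (size t).+1 -> n <> u (pk t m)).
    by apply: aa_ltn_all => m _; exists (u (pk t m)).+1 => n un e; rewrite -e ltnn in un.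
  apply: aaW h => n h; rewrite /g; case: ifP => // /andP[/andP[/eqP e1 /eqP e2] e3] [e4].
  by apply: (h (tm (r n)).2); rewrite ?ltnS -?e4 // e2.
pose k := maxn m N; set t := mkseq x k.
have [h1 h2 h3] := hu (pk t m); rewrite tmK in h1 h2.
have Nk : N <= size t by rewrite size_mkseq leq_maxr.
have mk : m <= size t by rewrite size_mkseq leq_maxl.
exists (u (pk t m)); first exact: leq_trans h1.
by split=> //; rewrite /branch /g h3 tmK !eqxx mk /= size_mkseq eqxx.
Qed.

Lemma uncountable_cantor : ~ countable [set: nat -> bool].
Proof.
move=> /countableE[f fi].
pose d n : bool := `[< forall x, f x = n -> x n = false >].
have := erefl (d (f d)); rewrite {1}/d; case: asboolP => [/(_ d erefl) -> //|].
by move=> nd /esym dF; apply: nd => x /(fi x d) -> .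
Qed.

(** * Coherent families of partial functions *)

Section Gluing.
Variables (R : realType) (hOCA : OCA_T R) (hMA : MA_aleph1_sigma_linked).
(** Values are functions of an integer, so that the same gluing serves coordinate maps and, as
    constant functions, maps of the integers. *)
Let pfun := ((nat -> bool) * (nat -> nat -> nat))%type.
Variable TT : set pfun.

Let W (p q : pfun) n := [/\ p.1 n, q.1 n & p.2 n <> q.2 n].

Hypothesis coherent : forall p q, TT p -> TT q -> aa (fun n => ~ W p q n).
Hypothesis rich : forall g, finite_fibers g -> forall Z : set (nat -> bool), ~ countable Z ->
  exists2 x, Z x & exists e, TT (branch g x, e).

Let code (p : pfun) n : bool * seq (seq nat) := (p.1 n, mkseq (fun i => mkseq (p.2 i) n) n).

Let codeP K p q : agree K.+1 (code p) (code q) ->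
  (forall n, n <= K -> p.1 n = q.1 n) /\ forall n m, n < K -> m < K -> p.2 n m = q.2 n m.
Proof.
move=> h; split=> [n nK|n m nK mK]; first by have [] := h n nK.
have [_ /agree_mkseq/(_ n nK)/agree_mkseq] := h K (ltnSn K); exact.
Qed.

Let W_sym p q n : W p q n -> W q p n.
Proof. by move=> [h1 h2 h3]; split=> //; exact: nesym. Qed.

Let W_open p q n : W p q n -> exists K, forall p' q', agree K (code p) (code p') ->
  agree K (code q) (code q') -> W p' q' n.
Proof.
move=> [pn qn nf].
have [m nm] : exists m, p.2 n m <> q.2 n m.
  by apply: contrapT => h; apply: nf; apply/funext => m; apply: contrapT => g; apply: h; exists m.
exists (maxn n m).+2 => p' q' /codeP[hp1 hp2] /codeP[hq1 hq2].
split; [by rewrite -hp1 //; lia|by rewrite -hq1 //; lia|].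
move=> e; apply: nm; rewrite hp2 ?hq2 ?e //; lia.
Qed.

Let many (k r : nat) (p q : pfun) := exists s,
  [/\ uniq s, size s = r & forall n, n \in s -> k <= n /\ W p q n].

Let many_sym k r p q : many k r p q -> many k r q p.
Proof. by move=> [s [h1 h2 h3]]; exists s; split=> // n /h3[? /W_sym]. Qed.

Let many_open k r p q : many k r p q -> exists K, forall p' q',
  agree K (code p) (code p') -> agree K (code q) (code q') -> many k r p' q'.
Proof.
move=> [s [h1 h2 h3]].
have [K hK] : aa (fun K => forall n, n \in s -> forall p' q', agree K (code p) (code p') ->
    agree K (code q) (code q') -> W p' q' n).
  apply: aa_all_seq => n /h3[_ /W_open[K hK]]; exists K => K' KK' p' q' a b.
  by apply: hK; [exact: agreeW a|exact: agreeW b].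
exists K => p' q' a b; exists s; split=> // n ns; have [kn _] := h3 n ns.
by split=> //; exact: (hK K (leqnn K) n ns).
Qed.

Let splits (k : nat) (x y : nat -> bool) := agree k x y /\ x k <> y k.

Let rigid (Y : set ((nat -> bool) * pfun)) :=
  (forall u v, Y u -> Y v -> u <> v -> exists2 k, splits k u.1 v.1 & many k k.+1 u.2 v.2) \/
  exists N r, 0 < r /\ forall u v, Y u -> Y v -> u <> v ->
    exists2 k, splits k u.1 v.1 & N <= k /\ exists s, [/\ uniq s, size s = r,
      forall n, n \in s -> k <= n & forall n, N <= n -> W u.2 v.2 n <-> n \in s].

Let no_rigid Y : ~ countable Y -> (forall u, Y u -> TT u.2) -> rigid Y -> False.
Proof.
move=> uY YT rY.
have sp u v : Y u -> Y v -> u <> v -> exists k, splits k u.1 v.1.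
  move=> Yu Yv uv; case: rY => [/(_ u v Yu Yv uv)[k h _]|[N [r [_ /(_ u v Yu Yv uv)[k h _]]]]];
  by exists k.
have [J [y [lt [hJ yinj yY]]]] := omega1_subset uY.
pose I : eqType := {classic J}.
pose x (i : I) := (y i).1.
have neq (i j : I) : i != j -> y i <> y j by move=> /eqP h /yinj.
have xinj : injective x.
  move=> i j e; apply/eqP/negPn/negP => /neq ij.
  by have [k [_]] := sp _ _ (yY i) (yY j) ij; rewrite -/(x i) e.
have splitE k (i j : I) : splits k (x i) (x j) -> split_level (x i) (x j) = k.
  move=> [a n]; apply/eqP; rewrite eqn_leq split_level_le //= agree_split_level //.
  by move=> e; rewrite e in n.
pose c (i : I) n := (x i n, code (y i).2 n).
pose WI (i j : I) := W (y i).2 (y j).2.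
have [chi hchi] := omega1_partition hJ.
have [N hN] : exists N, plenty x WI \/ exists r, exactly x WI N r.
  case: rY => [h|[N [r [r0 h]]]].
    exists 0; left => i j ij.
    have [k /splitE e [s [h1 h2 h3]]] := h _ _ (yY i) (yY j) (neq _ _ ij).
    by exists s; rewrite e h2.
  exists N; right; exists r; split=> // i j ij.
  have [k /splitE e [Nk [s [h1 h2 h3 h4]]]] := h _ _ (yY i) (yY j) (neq _ _ ij).
  by exists s; rewrite e.
have [||||||g [fg hg]] := @generic_family hMA I lt hJ _ c x WI xinj _ _ _ _ _ _ N hN chi hchi.
- by move=> K i j a n /a[].
- by move=> i j n; exact: W_sym.
- by move=> i n [_ _]; apply.
- by move=> i j; apply: coherent; exact: YT.
- move=> i j n /W_open[K hK]; exists K => j' a; apply: hK => // n' /a[_ e1 e2].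
  by rewrite /code e1 e2.
- move=> i i' j j' n [i1 i2 i3] [j1 j2 j3].
  have [e|ne] := pselect ((y i).2.2 n = (y j).2.2 n); last by left.
  by right; split=> // e'; apply: j3; rewrite -e.
set Z := [set z | _] in hchi.
have uZ : ~ countable (x @` Z).
  by apply: (uncountable_inj (f := x) hchi) => [z Zz|z z' _ _ /xinj //]; exists z.
have [_ [z Zz <-] [e Te]] := rich fg uZ.
have [Yz uYz hYz] := hg z Zz.
have hl i : Yz i -> exists lw, agree lw.1 (x i) (nth false lw.2) /\
    forall n, lw.1 <= n -> branch g (x z) n -> (y i).2.1 n -> e n = (y i).2.2 n.
  move=> _; have [l hl] := coherent Te (YT _ (yY i)).
  exists (l, mkseq (x i) l); split=> [n nl|n ln b pn]; first by rewrite nth_mkseq.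
  by apply: contrapT => ne; apply: (hl n ln).
have [i [j [[l w] [Yi Yj nij [/= ai hi] [/= aj hj]]]]] := uncountable_pair_rel uYz hl.
have [n [dn [pi pj ne] b]] := hYz i j Yi Yj nij.
(* The reals agree below [l], so they split at [l] or later; the disagreement [n] is not before the
   splitting, and there both functions follow [e]. *)
have ln : l <= n.
  apply: leq_trans dn; apply: agree_split_level; first by move/xinj.
  exact: agree_trans ai (agree_sym aj).
by apply: ne; rewrite -hi // -hj.
Qed.

Let sigma_coherent (S : set pfun) := exists Z : nat -> set pfun,
  (forall p, S p -> exists m, Z m p) /\
  forall m, exists N, forall p q n, Z m p -> Z m q -> N <= n -> ~ W p q n.

Let sigma_coherent_bigcup (S : set pfun) (Z : nat -> set pfun) :
  (forall p, S p -> exists m, Z m p) -> (forall m, sigma_coherent (Z m)) -> sigma_coherent S.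
Proof.
move=> SZ /choice[Z' hZ'].
exists (fun n => if @unpickle (nat * nat)%type n is Some mk then Z' mk.1 mk.2 else set0).
split=> [p /SZ[m /(hZ' m).1[k hk]]|n].
  by exists (@pickle (nat * nat)%type (m, k)); rewrite pickleK.
case: unpickle => [[m k]|]; first exact: (hZ' m).2.
by exists 0 => p q n' [].
Qed.

Let OCA_sub (S : set pfun) (K : nat -> pfun -> pfun -> Prop) :
  (forall k p q, K k p q -> K k q p) ->
  (forall k p q, K k p q -> exists l, forall p' q', agree l (code p) (code p') ->
     agree l (code q) (code q') -> K k p' q') ->
  (exists2 Y : set ((nat -> bool) * pfun), ~ countable Y & (forall u, Y u -> S u.2) /\
     forall u v, Y u -> Y v -> u <> v -> exists2 k, splits k u.1 v.1 & K k u.2 v.2) \/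
  (exists2 Z : nat -> set pfun, (forall p, S p -> exists m, Z m p) &
     forall m, exists k, forall p q, Z m p -> Z m q -> S p /\ S q /\ ~ K k p q).
Proof.
move=> Ksym Kopen; pose S' := {p | S p}.
have [||[Y uY hY]|[Z cZ hZ]] := @OCA_splitting R hOCA S' _ (fun p => code (sval p))
  (fun k p q => K k (sval p) (sval q)).
- by move=> k p q; exact: Ksym.
- by move=> k p q /Kopen[l hl]; exists l => p' q'; exact: hl.
- left; exists [set u | exists2 v, Y v & u = (v.1, sval v.2)].
    apply: (uncountable_inj (f := fun v => (v.1, sval v.2)) uY) => [v Yv|u v Yu Yv].
      by exists v.
    by case: u v {Yu Yv} => [u [p hp]] [v [q hq]] /= [-> e]; congr pair; exact: eq_exist.
  split=> [_ [v _ ->]|_ _ [u Yu ->] [v Yv ->] nuv]; first by case: v => v [].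
  have [|k [k1 k2 k3]] := hY u v Yu Yv; first by move=> e; apply: nuv; rewrite e.
  by exists k.
right; exists (fun m => [set p | exists2 q, Z m q & sval q = p]).
  by move=> p Sp; have [m hm] := cZ (exist _ p Sp); exists m; exists (exist _ p Sp).
move=> m; have [k hk] := hZ m; exists k => _ _ [p Zp <-] [q Zq <-].
by split; [exact: (svalP p)|split; [exact: (svalP q)|exact: hk]].
Qed.

(** Induction on the bound. A family homogeneous for the maximal number of disagreements has exactly
    that many and is rigid; otherwise each piece of the cover has fewer beyond a place of its
    own. *)
Let bounded_coherent r : forall (S : set pfun) N, S `<=` TT ->
  (forall p q s, S p -> S q -> uniq s -> (forall n, n \in s -> N <= n /\ W p q n) ->
     size s <= r) -> sigma_coherent S.
Proof.
elim: r => [|r IH] S N STT hS.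
  exists (fun=> S); split=> [p Sp|m]; first by exists 0.
  exists N => p q n Sp Sq Nn w; suff : 1 <= 0 by [].
  by apply: (hS p q [:: n]) => // n'; rewrite inE => /eqP->.
have [||[Y uY [YS hY]]|[Z SZ hZ]] := @OCA_sub S (fun k p q => many k r.+1 p q).
- by move=> k p q; exact: many_sym.
- by move=> k p q; exact: many_open.
- exfalso.
  (* Fixing [N] bits of the reals moves all splittings to [N] or later. *)
  have [w hw] : exists w, ~ countable [set u | Y u /\ mkseq u.1 N = w].
    by apply: (@uncountable_fiber _ (seq bool)) uY _ => u _; exists (mkseq u.1 N).
  apply: (no_rigid hw) => [u [/YS/STT //]|].
  right; exists N, r.+1; split=> // u v [Yu uw] [Yv vw] nuv.
  have [k kuv [s [us ss hs]]] := hY u v Yu Yv nuv.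
  have Nk : N <= k.
    rewrite leqNgt; apply/negP => kN; case: kuv => _; apply.
    by have /agree_mkseq/(_ k kN) : mkseq u.1 N = mkseq v.1 N by rewrite uw.
  exists k => //; split=> //; exists s; split=> // [n /hs[]//|n Nn]; split=> [wn|/hs[]//].
  apply: contrapT => ns; suff : size (n :: s) <= r.+1 by rewrite /= ss ltnn.
  apply: (hS u.2 v.2) => [||/=|n']; [exact: YS|exact: YS|by rewrite us andbT; apply/negP|].
  by rewrite inE => /orP[/eqP->//|/hs[kn' ?]]; split=> //; apply: leq_trans kn'.
apply: sigma_coherent_bigcup SZ _ => m; have [k hk] := hZ m.
apply: (IH _ k) => [p Zp|p q s Zp Zq us hs].
  by have [Sp _] := hk p p Zp Zp; exact: STT.
have [_ [_ nm]] := hk p q Zp Zq.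
rewrite leqNgt; apply/negP => rs; apply: nm; exists (take r.+1 s); split.
- exact: take_uniq.
- by rewrite size_takel.
- by move=> n /mem_take; exact: hs.
Qed.

Let TT_coherent : sigma_coherent TT.
Proof.
have [||[Y uY [YT hY]]|[Z TZ hZ]] := @OCA_sub TT (fun k p q => many k k.+1 p q).
- by move=> k p q; exact: many_sym.
- by move=> k p q; exact: many_open.
- by exfalso; apply: (no_rigid uY YT); left.
apply: sigma_coherent_bigcup TZ _ => m; have [k hk] := hZ m.
apply: (@bounded_coherent k _ k) => [p Zp|p q s Zp Zq us hs].
  by have [] := hk p p Zp Zp.
have [_ [_ nm]] := hk p q Zp Zq.
rewrite leqNgt; apply/negP => rs; apply: nm; exists (take k.+1 s); split.
- exact: take_uniq.
- by rewrite size_takel.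
- by move=> n /mem_take; exact: hs.
Qed.

Lemma glue : exists e : nat -> nat -> nat, forall p, TT p -> aa (fun n => p.1 n -> p.2 n = e n).
Proof.
have [Z [TZ hZ]] := TT_coherent; have /choice[N hN] := hZ.
have /choice[e he] : forall m, exists e : nat -> nat -> nat,
    forall p n, Z m p -> N m <= n -> p.1 n -> p.2 n = e n.
  move=> m; suff /choice[e he] : forall n, exists v,
      forall p, Z m p -> N m <= n -> p.1 n -> p.2 n = v by exists e => p n; exact: he.
  move=> n; have [[q [Zq Nn qn]]|h] := pselect (exists q, [/\ Z m q, N m <= n & q.1 n]).
    exists (q.2 n) => p Zp _ pn; apply: contrapT => ne.
    by apply: (hN m p q n Zp Zq Nn).
  by exists (fun=> 0) => p Zp Nn pn; case: h; exists p.
apply: contrapT => h.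
have /choice[p hp] : forall m, exists p, TT p /\ io (fun n => p.1 n /\ p.2 n <> e m n).
  move=> m; apply: contrapT => g; apply: h; exists (e m) => p Tp.
  apply: contrapT => /not_aa io; apply: g; exists p; split=> //.
  apply: ioW io => n hn; split; first by apply: contrapT => pn; apply: hn.
  by move=> en; apply: hn.
(* Every branch of [g] meets the failures of each [e m] infinitely often, so whichever piece
   contains the lifting on a branch is refuted on that branch. *)
have [g [fg hg]] := tree_meeting (fun m => (hp m).2).
have [x _ [e' Te']] := rich fg uncountable_cantor.
have [m Zm] := TZ _ Te'.
have := io_aa (hg x m) (aa_and (aa_ge (N m)) (coherent Te' (hp m).1)).
move=> /(_ 0)[n _ [[bn [pn ne]] [Nn nW]]].
by apply: nW; split=> //= e1; apply: ne; rewrite -e1 -(he m _ n Zm).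
Qed.

End Gluing.

(** A value taken infinitely often by [u] or [v] separates as a singleton. Otherwise both tend to
    infinity along [J], and [b] is the set of values of [u] on a sparse subsequence. *)
Lemma separate (J : nat -> Prop) (u v : nat -> nat) : io J -> (forall j, J j -> u j <> v j) ->
  exists b : nat -> bool, io (fun j => J j /\ b (u j) <> b (v j)).
Proof.
move=> hJ uv.
have [[m hm]|hm] := pselect (exists m, io (fun j => J j /\ (u j = m \/ v j = m))).
  exists (fun i => i == m); apply: ioW hm => j [Jj h]; split=> //.
  by have /eqP := uv j Jj; case: h => ->; rewrite eqxx; [rewrite eq_sym|]; case: eqP.
have far M : io (fun j => J j /\ (M <= u j /\ M <= v j)).
  have h : aa (fun j => forall m, m < M -> ~ (J j /\ (u j = m \/ v j = m))).
    by apply: aa_ltn_all => m _; apply: not_io => h; apply: hm; exists m.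
  apply: ioW (io_aa hJ h) => j [Jj g]; split=> //.
  by split; rewrite leqNgt; apply/negP => /g; apply; split=> //; [left|right].
have /choice[s hs] : forall M, exists j, M <= j /\ (J j /\ (M <= u j /\ M <= v j)).
  by move=> M; have [j] := far M M; exists j.
pose nx j := s (maxn j (maxn (u j) (v j))).+1.
pose p k := iter k nx (s 0).
pose m k := maxn (p k) (maxn (u (p k)) (v (p k))).
have pS k : [/\ m k < p k.+1, m k < u (p k.+1) & m k < v (p k.+1)].
  by rewrite /p /= -/(p k) /nx -/(m k); have [? [_ []]] := hs (m k).+1.
have pJ k : J (p k).
  case: k => [|k]; first by have [_ []] := hs 0.
  by rewrite /p /= -/(p k) /nx -/(m k); have [_ []] := hs (m k).+1.
have pm i k : i < k -> [/\ m i < p k, m i < u (p k) & m i < v (p k)].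
  elim: k => // k IH; rewrite ltnS leq_eqVlt => /orP[/eqP->|/IH]; first exact: pS.
  move=> [h _ _]; have {}h : m i < m k := leq_trans h (leq_maxl _ _).
  by have [a b c] := pS k; split; apply: ltn_trans h _.
exists (fun i => `[< exists k, i = u (p k) >]) => N; exists (p N).
  elim: N => // N IH; have [+ _ _] := pS N; rewrite /m; lia.
split; first exact: pJ.
case: asboolP => [_|[]]; last by exists N.
case: asboolP => // -[k e]; exfalso.
case: (ltngtP k N) => kN.
- by have [_ _ h] := pm _ _ kN; move: h; rewrite e /m; lia.
- by have [_ h _] := pm _ _ kN; move: h; rewrite -e /m; lia.
- by subst k; apply: (uv _ (pJ N)).
Qed.

(** * Global liftings *)

Section Global.
Variables (R : realType) (hOCA : OCA_T R) (hMA : MA_aleph1_sigma_linked).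

Lemma tree_dense (TT : set ((nat -> bool) * (nat -> nat -> nat))) (V : nat -> Prop) :
  (forall g, finite_fibers g -> forall Z : set (nat -> bool), ~ countable Z ->
     exists2 x, Z x & exists e, TT (branch g x, e)) ->
  io V -> exists2 p, TT p & io (fun n => p.1 n /\ V n).
Proof.
move=> rich hV; have [g [fg hg]] := tree_meeting (fun _ : nat => hV).
have [x _ [e Te]] := rich g fg _ uncountable_cantor.
by exists (branch g x, e) => //; exact: hg 0.
Qed.

(* Velickovic's theorem on the automorphisms of [P(N)/Fin]. *)
Lemma boolean_trivial alpha beta : boolean_mod_fin alpha -> boolean_mod_fin beta ->
  inverse_mod_fin beta alpha -> inverse_mod_fin alpha beta ->
  exists e : nat -> nat, forall b, aa (fun j => beta b j = b (e j)).
Proof.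
move=> ha hb k1 k2.
pose TT : set ((nat -> bool) * (nat -> nat -> nat)) :=
  fun p => exists e,
  p.2 = (fun j _ => e j) /\ forall b, aa (fun j => p.1 j -> beta b j = b (e j)).
have rich g : finite_fibers g -> forall Z : set (nat -> bool), ~ countable Z ->
    exists2 x, Z x & exists e, TT (branch g x, e).
  move=> fg Z uZ; have [x Zx [e he]] := boolean_on_branch hOCA fg ha hb k1 k2 uZ.
  by exists x => //; exists (fun j _ => e j), e.
have [|e0 he0] := glue hOCA hMA _ rich.
  move=> [A h] [A' h'] [e /= [-> he]] [e' /= [-> he']].
  apply: contrapT => /not_aa io1.
  have [|b hb'] := separate (u := e) (v := e') io1.
    by move=> j /contrapT[_ _ ne] ee; apply: ne; rewrite ee.
  apply: aa_io_false hb'; apply: aaW (aa_and (he b) (he' b)) => j [e1 e2] [/contrapT[Aj A'j _]].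
  by rewrite -e1 // -e2.
exists (fun j => e0 j 0) => b; apply: contrapT => /not_aa hV.
have [[A h] [e /= [he1 he2]] io1] := tree_dense rich hV.
apply: aa_io_false io1.
have Tp : TT (A, h) by exists e.
apply: aaW (aa_and (he2 b) (he0 _ Tp)) => j /= [e1 e2] [Aj].
by apply; rewrite e1 // -e2 // he1.
Qed.

Lemma coordinatewise_trivial (phi : (nat -> nat) -> nat -> nat)
  (phi_coord : forall (D : nat -> bool) a b, (forall n, D n -> a n = b n) ->
     aa (fun n => D n -> phi a n = phi b n)) :
  exists h : nat -> nat -> nat, forall a, aa (fun n => phi a n = h n (a n)).
Proof.
pose TT : set ((nat -> bool) * (nat -> nat -> nat)) :=
  fun p => forall a, aa (fun n => p.1 n -> phi a n = p.2 n (a n)).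
have rich g : finite_fibers g -> forall Z : set (nat -> bool), ~ countable Z ->
    exists2 x, Z x & exists e, TT (branch g x, e).
  move=> fg Z uZ; have [x Zx [h hh]] := coordinatewise_on_branch hOCA fg phi_coord uZ.
  by exists x => //; exists h.
have [|h hh] := glue hOCA hMA _ rich.
  move=> p q hp hq.
  (* A single [a] exhibits every difference between the two families of coordinate maps. *)
  have /choice[a ha] : forall n, exists m, p.2 n <> q.2 n -> p.2 n m <> q.2 n m.
    move=> n; apply: contrapT => h; have nn m : p.2 n m = q.2 n m.
      by apply: contrapT => g; apply: h; exists m.
    by apply: h; exists 0 => []; case; apply/funext.
  apply: aaW (aa_and (hp a) (hq a)) => n [e1 e2] [pn qn /ha]; apply.
  by rewrite -e1 // -e2.
exists h => a; apply: contrapT => /not_aa hV.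
have [p Tp io1] := tree_dense rich hV.
apply: aa_io_false io1; apply: aaW (aa_and (Tp a) (hh p Tp)) => n [e1 e2] [pn].
by apply; rewrite e1 // e2.
Qed.

End Global.

(** * Reduced products of fields *)

Import GRing.Theory.

Lemma countable_decode T (x0 : T) : countable [set: T] ->
  exists (c : T -> nat) (d : nat -> T), forall x, d (c x) = x.
Proof.
move=> /countableE[c ci].
have /choice[d hd] : forall m, exists x, forall y, c y = m -> y = x.
  move=> m; have [[y cy]|h] := pselect (exists y, c y = m).
    by exists y => z cz; apply: ci; rewrite // cy.
  by exists x0 => y cy; case: h; exists y.
by exists c, d => x; rewrite -(hd _ x erefl).
Qed.

(** Serves to choose, in all coordinates at once, a counterexample wherever there is one. *)
Lemma drinker T (x0 : T) (P : T -> Prop) : exists x, P x -> forall y, P y.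
Proof.
apply: contrapT => h; apply: (h); exists x0 => _ y; apply: contrapT => ny.
by apply: h; exists y => /ny.
Qed.

Lemma decode_family (F : nat -> fieldType) : (forall n, countable [set: F n]) ->
  exists cd : forall n, (F n -> nat) * (nat -> F n), forall n x, (cd n).2 ((cd n).1 x) = x.
Proof.
move=> hF.
have H n : exists cd : (F n -> nat) * (nat -> F n), forall x, cd.2 (cd.1 x) = x.
  by have [c [d h]] := countable_decode 0%R (hF n); exists (c, d).
by exists (fun n => sval (cid (H n))) => n; exact: (svalP (cid (H n))).
Qed.

(** * Ring maps modulo finite sets *)

Definition ring_mod_fin (F G : nat -> fieldType)
    (phi : (forall n, F n) -> forall n, G n) : Prop :=
  (forall a b, aa (fun n => a n = b n) -> aa (fun n => phi a n = phi b n)) /\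
  forall s (a : 'I_(ring_farity s) -> forall n, F n),
    aa (fun n => phi (fun n => ring_finterp (fun i => a i n)) n =
                 ring_finterp (fun i => phi (a i) n)).

Definition indicator (F : nat -> fieldType) (c : nat -> bool) n : F n := ((c n)%:R)%R.
Arguments indicator : clear implicits.

Section RingModFin.
Variables (F G : nat -> fieldType) (phi : (forall n, F n) -> forall n, G n).
Hypothesis hphi : ring_mod_fin phi.

Let phi_ext := hphi.1.

Lemma rmf_mul a b : aa (fun n => phi (fun j => (a j * b j)%R) n = (phi a n * phi b n)%R).
Proof. exact: (hphi.2 RMul (fun i => if i == ord0 then a else b)). Qed.

Lemma rmf_add a b : aa (fun n => phi (fun j => (a j + b j)%R) n = (phi a n + phi b n)%R).
Proof. exact: (hphi.2 RAdd (fun i => if i == ord0 then a else b)). Qed.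

Lemma rmf_opp a : aa (fun n => phi (fun j => (- a j)%R) n = (- phi a n)%R).
Proof. exact: (hphi.2 ROpp (fun=> a)). Qed.

Lemma rmf1 : aa (fun n => phi (fun j => 1%R) n = 1%R).
Proof.
have := hphi.2 ROne (fun=> fun=> 0%R); exact.
Qed.

Definition on_indicators (c : nat -> bool) n := phi (indicator F c) n == 1%R.

Lemma rmf_indicator c : aa (fun n => phi (indicator F c) n = indicator G (on_indicators c) n).
Proof.
have e : (fun j => (indicator F c j * indicator F c j)%R) = indicator F c.
  apply: functional_extensionality_dep => j.
  by rewrite /indicator; case: (c j); rewrite ?mulr1 ?mulr0.
apply: aaW (rmf_mul (indicator F c) (indicator F c)) => n; rewrite e /indicator /on_indicators.
have [->//|n1 /eqP] := eqVneq.
rewrite -subr_eq0 -{1}[phi _ n]mulr1 -mulrBr mulf_eq0 subr_eq0.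
by rewrite [1%R == _]eq_sym (negbTE n1) orbF => /eqP.
Qed.

Lemma on_indicators_boolean : boolean_mod_fin on_indicators.
Proof.
split=> [a b ab|a b|a].
- have /phi_ext : aa (fun n => indicator F a n = indicator F b n).
    by apply: aaW ab => n; rewrite /indicator => ->.
  by apply: aaW => n; rewrite /on_indicators => ->.
- have e : indicator F (fun j => a j && b j) = (fun j => (indicator F a j * indicator F b j)%R).
    apply: functional_extensionality_dep => j.
    by rewrite /indicator; case: (a j); case: (b j); rewrite /= ?mulr1 ?mulr0.
  have := aa_and (rmf_mul (indicator F a) (indicator F b))
    (aa_and (rmf_indicator a) (rmf_indicator b)).
  rewrite -e; apply: aaW => n [h [ha hb]]; rewrite {1}/on_indicators h ha hb /indicator.
  by do 2!case: on_indicators; rewrite /= ?mulr1 ?mulr0 ?eqxx // eq_sym oner_eq0.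
have e : indicator F (fun j => ~~ a j) = (fun j => (1 + - indicator F a j)%R).
  apply: functional_extensionality_dep => j.
  by rewrite /indicator; case: (a j); rewrite /= ?subrr ?subr0.
have := aa_and (rmf_add (fun=> 1%R) (fun j => - indicator F a j)%R)
  (aa_and (aa_and rmf1 (rmf_opp (indicator F a))) (rmf_indicator a)).
rewrite -e; apply: aaW => n [h [[h1 h2] h3]]; rewrite {1}/on_indicators h h1 h2 h3 /indicator.
by case: on_indicators; rewrite /= ?subrr ?subr0 ?eqxx // eq_sym oner_eq0.
Qed.

Lemma rmf_agree_on (D : nat -> bool) (a b : forall n, F n) : (forall n, D n -> a n = b n) ->
  aa (fun n => on_indicators D n -> phi a n = phi b n).
Proof.
move=> ab.
have e : (fun j => (indicator F D j * a j)%R) = (fun j => (indicator F D j * b j)%R).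
  apply: functional_extensionality_dep => j.
  by rewrite /indicator; case: (boolP (D j)) => [/ab->|]; rewrite /= ?mul0r.
have := aa_and (rmf_mul (indicator F D) a) (rmf_mul (indicator F D) b); rewrite -e.
by apply: aaW => n [-> +] /eqP h; rewrite h !mul1r.
Qed.

End RingModFin.

Lemma on_indicators_inverse (F G : nat -> fieldType) (phi : (forall n, F n) -> forall n, G n)
    (psi : (forall n, G n) -> forall n, F n) :
  ring_mod_fin phi -> ring_mod_fin psi ->
  (forall a, aa (fun n => psi (phi a) n = a n)) ->
  inverse_mod_fin (on_indicators psi) (on_indicators phi).
Proof.
move=> hphi hpsi phiK c.
have h := hpsi.1 _ _ (rmf_indicator hphi c).
apply: aaW (aa_and h (phiK (indicator F c))) => n [e1 e2].
rewrite {1}/on_indicators -e1 e2 /indicator.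
by case: (c n); rewrite /= ?eqxx // eq_sym oner_eq0.
Qed.

Section Rigidity.
Variables (R : realType) (hOCA : OCA_T R) (hMA : MA_aleph1_sigma_linked).
Variables (F G : nat -> fieldType).
Hypothesis hF : forall n, countable [set: F n].
Hypothesis hG : forall n, countable [set: G n].
Variables (phi : (forall n, F n) -> forall n, G n) (psi : (forall n, G n) -> forall n, F n).
Hypothesis hphi : ring_mod_fin phi.
Hypothesis hpsi : ring_mod_fin psi.
Hypothesis phiK : forall a, aa (fun n => psi (phi a) n = a n).
Hypothesis psiK : forall b, aa (fun n => phi (psi b) n = b n).

Let alpha := on_indicators phi.
Let beta := on_indicators psi.
Let halpha : boolean_mod_fin alpha := on_indicators_boolean hphi.
Let hbeta : boolean_mod_fin beta := on_indicators_boolean hpsi.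
Let alphaK : inverse_mod_fin beta alpha := on_indicators_inverse hphi hpsi phiK.
Let betaK : inverse_mod_fin alpha beta := on_indicators_inverse hpsi hphi psiK.

Section Reindexing.
Variable f : nat -> nat.
Hypothesis hf : forall c, aa (fun n => alpha c n = c (f n)).

(** If [f] identified pairs arbitrarily far out, some [b] would separate infinitely many of them;
    but [b] is almost equal to [alpha (beta b)], which factors through [f] almost everywhere. *)
Lemma reindexing_injective : exists N, forall n n', N <= n -> N <= n' -> f n = f n' -> n = n'.
Proof.
apply: contrapT => h.
have /choice[p hp] : forall k, exists p : nat * nat,
    [/\ k <= p.1, k <= p.2, f p.1 = f p.2 & p.1 <> p.2].
  move=> k; apply: contrapT => g; apply: h; exists k => n n' kn kn' e.
  by apply: contrapT => ne; apply: g; exists (n, n').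
have [||b hb] := @separate (fun=> True) (fun k => (p k).1) (fun k => (p k).2).
- by move=> N; exists N.
- by move=> j _; case: (hp j).
have [N hN] := aa_and (betaK b) (hf (beta b)).
have [k Nk [_]] := hb N; apply.
have [k1 k2 k3 _] := hp k.
have [e1 e2] := hN _ (leq_trans Nk k1); have [e3 e4] := hN _ (leq_trans Nk k2).
by rewrite -e1 -e3 e2 e4 k3.
Qed.

Lemma reindexing_onto : aa (fun m => exists n, f n = m).
Proof.
pose c m := ~~ `[< exists n, f n = m >].
have h : aa (fun n => alpha c n = false).
  by apply: aaW (hf c) => n ->; apply/negbF/asboolP; exists n.
apply: aaW (inverse_mod_fin_false hbeta alphaK h) => m /negbFE.
by move/asboolP.
Qed.

Lemma reindexing_aa P : aa P -> aa (fun n => P (f n)).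
Proof.
move=> h; pose c m := ~~ `[< P m >].
have /(bmf_ext halpha) h1 : aa (fun m => c m = false).
  by apply: aaW h => m Pm; apply/negbF/asboolP.
apply: aaW (aa_and (aa_and h1 (bmf_false halpha)) (hf c)) => n [[-> ->]].
by move=> /esym/negbFE/asboolP.
Qed.

(** [ext] places the element coded by [a n] at coordinate [f n]. After this shift and the coding of
    the fields, [phi] respects agreement on each set of integers, as [coordinatewise_trivial]
    demands. *)
Lemma coordinatewise_lift : exists h : forall n, F (f n) -> G n,
  forall a, aa (fun n => phi a n = h n (a (f n))).
Proof.
have [N fN] := reindexing_injective.
have [cF hcF] := decode_family hF; have [cG hcG] := decode_family hG.
have /choice[inv hinv] : forall j, exists n, forall m, N <= m -> f m = j -> n = m.
  move=> j; have [[m Nm mj]|h] := pselect (exists2 m, N <= m & f m = j).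
    by exists m => n Nn nj; apply: fN; rewrite // mj nj.
  by exists 0 => m Nm mj; case: h; exists m.
pose ext (a : nat -> nat) j : F j := (cF j).2 (a (inv j)).
have extE a n : N <= n -> ext a (f n) = (cF (f n)).2 (a n).
  by move=> Nn; rewrite /ext (hinv _ n).
have [|h hh] := @coordinatewise_trivial R hOCA hMA (fun a n => (cG n).1 (phi (ext a) n)).
  move=> D a b ab; pose D' j := D (inv j).
  have h : forall j, D' j -> ext a j = ext b j by move=> j /ab e; rewrite /ext e.
  apply: aaW (aa_and (aa_and (rmf_agree_on hphi h) (hf D')) (aa_ge N)) => n.
  by move=> [[h1 e] Nn] Dn; rewrite h1 // -/alpha e /D' (hinv _ n).
exists (fun n x => (cG n).2 (h n ((cF (f n)).1 x))) => a.
pose a' n := (cF (f n)).1 (a (f n)).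
pose D j := `[< exists2 n, N <= n & f n = j >].
have hD : forall j, D j -> a j = ext a' j.
  by move=> j /asboolP[n Nn <-]; rewrite extE // /a' hcF.
apply: aaW (aa_and (aa_and (rmf_agree_on hphi hD) (hf D)) (aa_and (aa_ge N) (hh a'))).
move=> n [[h1 h2] [Nn h3]]; rewrite -/(a' n) -h3 hcG h1 // -/alpha h2.
by apply/asboolP; exists n.
Qed.

End Reindexing.

Lemma rigid_mod_fin : exists (f : nat -> nat) (h : forall n, F (f n) -> G n) (N : nat),
  [/\ forall n n', N <= n -> N <= n' -> f n = f n' -> n = n',
      aa (fun m => exists2 n, N <= n & f n = m),
      forall n, N <= n -> @isomorphism _ (field_structure (F (f n))) (field_structure (G n)) (h n)
    & forall a, aa (fun n => phi a n = h n (a (f n)))].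
Proof.
(* The roles of [alpha] and [beta] are exchanged, so that [f] lifts [alpha]. *)
have [f hf] := boolean_trivial hOCA hMA hbeta halpha betaK alphaK.
have [h hh] := coordinatewise_lift hf.
have [N fN] := reindexing_injective hf.
have realize (x : forall n, F (f n)) :
    exists a : forall j, F j, forall n, N <= n -> a (f n) = x n.
  (* By injectivity beyond [N] at most one such [n] prescribes coordinate [j]; [ecast] carries [x n]
     along [f n = j]. *)
  suff H j : exists y : F j, forall n (e : f n = j), N <= n -> y = ecast i (F i) e (x n).
    exists (fun j => sval (cid (H j))) => n Nn.
    by rewrite (svalP (cid (H (f n))) n erefl).
  have [[m Nm <-]|g] := pselect (exists2 m, N <= m & f m = j).
    exists (x m) => n e Nn; have nm : n = m by exact: fN.
    by subst n; rewrite (eq_axiomK e).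
  by exists 0%R => n e Nn; case: g; exists n.
have hop s : aa (fun n => forall a : 'I_(ring_farity s) -> F (f n),
    h n (ring_finterp a) = ring_finterp (h n \o a)).
  apply: contrapT => /not_aa bad.
  pose H n := drinker (fun=> 0%R) (fun a : 'I_(ring_farity s) -> F (f n) =>
    h n (ring_finterp a) = ring_finterp (h n \o a)).
  pose a n := sval (cid (H n)); have ha n := svalP (cid (H n)).
  have ga i := cid (realize (fun n => a n i)).
  pose A i := sval (ga i); have hA i n : N <= n -> A i (f n) = a n i := svalP (ga i) n.
  have hAi : aa (fun n => forall i, phi (A i) n = h n (A i (f n))).
    have := @aa_all_seq _ (enum 'I_(ring_farity s)) (fun i n => phi (A i) n = h n (A i (f n)))
      (fun i _ => hh (A i)).
    by apply: aaW => n g i; apply: g; rewrite mem_enum.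
  apply: aa_io_false bad.
  have := aa_and (aa_and (hphi.2 s A) (hh (fun n => ring_finterp (fun i => A i n))))
    (aa_and hAi (aa_ge N)).
  apply: aaW => n [[e1 e2] [e3 Nn]]; apply; apply: ha; rewrite -/(a n).
  have -> : a n = fun i => A i (f n) by apply/funext => i; rewrite hA.
  by rewrite -e2 e1; congr ring_finterp; apply/funext => i; rewrite e3.
have hinj : aa (fun n => injective (h n)).
  apply: contrapT => /not_aa bad.
  have H n : exists p : F (f n) * F (f n),
      h n p.1 = h n p.2 /\ (p.1 = p.2 -> injective (h n)).
    have [hi|hi] := pselect (injective (h n)); first by exists (0%R, 0%R).
    apply: contrapT => g; apply: hi => x y e; apply: contrapT => ne.
    by apply: g; exists (x, y).
  pose p n := sval (cid (H n)); have hp n := svalP (cid (H n)).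
  have [a ha] := realize (fun n => (p n).1); have [b hb] := realize (fun n => (p n).2).
  have ab : aa (fun n => phi a n = phi b n).
    apply: aaW (aa_and (aa_and (hh a) (hh b)) (aa_ge N)) => n [[-> ->] Nn].
    by rewrite ha // hb //; case: (hp n).
  have {}ab : aa (fun n => a n = b n).
    by apply: aaW (aa_and (hpsi.1 _ _ ab) (aa_and (phiK a) (phiK b))) => n [+ [e1 e2]];
      rewrite e1 e2.
  apply: aa_io_false bad; apply: aaW (aa_and (reindexing_aa hf ab) (aa_ge N)) => n [e Nn].
  by apply; apply: (hp n).2; rewrite -/(p n) -ha // -hb.
have hsurj : aa (fun n => forall y, exists x, h n x = y).
  apply: contrapT => /not_aa bad.
  pose H n := drinker 0%R (fun y => exists x, h n x = y).
  pose b n := sval (cid (H n)); have hb n := svalP (cid (H n)).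
  apply: aa_io_false bad; apply: aaW (aa_and (psiK b) (hh (psi b))) => n [e1 e2]; apply.
  by apply: hb; exists (psi b (f n)); rewrite -e2 e1.
have [N' hN'] : aa (fun n => @isomorphism _ (field_structure (F (f n)))
    (field_structure (G n)) (h n)).
  have := aa_and (aa_and (hop RZero) (hop ROne))
    (aa_and (aa_and (hop ROpp) (hop RAdd)) (aa_and (hop RMul) (aa_and hinj hsurj))).
  apply: aaW => n [[o1 o2] [[o3 o4] [o5 [hi /choice[k hk]]]]]; split; last by case.
    by exists k => // x; apply: hi; rewrite hk.
  by case.
exists f, h, (maxn N N'); split=> //.
- by move=> n n'; rewrite !geq_max => /andP[Nn _] /andP[Nn' _]; exact: fN.
(* Raising the bound to [maxn N N'] loses only finitely many values of [f]. *)
- have g : aa (fun m => forall i, i < maxn N N' -> f i <> m).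
    by apply: aa_ltn_all => i _; exists (f i).+1 => m fm e; rewrite e ltnn in fm.
  apply: aaW (aa_and (reindexing_onto hf) g) => m [[n nm] gm]; exists n => //.
  by rewrite leqNgt; apply/negP => /gm.
- by move=> n; rewrite geq_max => /andP[_]; exact: hN'.
Qed.

End Rigidity.

(** * Isomorphisms of the reduced products *)

Local Notation fields F := (fun n => field_structure (F n)).
Local Notation fclass F := (@rclass ring_language Fin (fields F)).

Lemma fclassP (F : nat -> fieldType) (a b : forall n, F n) :
  fclass F a = fclass F b <-> aa (fun n => a n = b n).
Proof. by rewrite rclassP aa_finite. Qed.

Section Lift.
Variables (F G : nat -> fieldType) (Phi : rprod Fin (fields F) -> rprod Fin (fields G)).

Definition lift (a : forall n, F n) : forall n, G n := rrepr (Phi (fclass F a)).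

Lemma liftP a : fclass G (lift a) = Phi (fclass F a).
Proof. exact: rreprK. Qed.

Lemma lift_ring_mod_fin :
  (forall s (a : 'I_(ring_farity s) -> rprod Fin (fields F)),
     Phi (@finterp ring_language _ s a) = @finterp ring_language _ s (Phi \o a)) ->
  ring_mod_fin lift.
Proof.
move=> hPhi; split=> [a b /fclassP e|s a]; first by rewrite /lift e; exact: aaT.
apply/fclassP; rewrite liftP.
transitivity (Phi (@finterp ring_language (rprod Fin (fields F)) s (fun i => fclass F (a i)))).
  by congr Phi; apply/esym; exact: rprod_finterpE.
rewrite hPhi; transitivity (@finterp ring_language (rprod Fin (fields G)) s
  (fun i => fclass G (lift (a i)))); last exact: rprod_finterpE.
apply: (congr1 (@finterp ring_language (rprod Fin (fields G)) s)).
by apply/funext => i /=; rewrite liftP.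
Qed.

End Lift.

Section Isomorphism.
Variables (R : realType) (hOCA : OCA_T R) (hMA : MA_aleph1_sigma_linked).
Variables F G : nat -> fieldType.
Hypothesis hF : forall n, countable [set: F n].
Hypothesis hG : forall n, countable [set: G n].

Lemma isomorphism_rigid (Phi : rprod Fin (fields F) -> rprod Fin (fields G)) :
  isomorphism Phi ->
  exists (f : nat -> nat) (h : forall n, F (f n) -> G n) (N : nat),
  [/\ forall n n', N <= n -> N <= n' -> f n = f n' -> n = n',
      aa (fun m => exists2 n, N <= n & f n = m),
      forall n, N <= n -> @isomorphism _ (field_structure (F (f n))) (field_structure (G n)) (h n)
    & forall a, aa (fun n => lift Phi a n = h n (a (f n)))].
Proof.
move=> [[Psi PhiK PsiK] Phi_op _].
have Psi_op s (b : 'I_(ring_farity s) -> rprod Fin (fields G)) :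
    Psi (@finterp ring_language _ s b) = @finterp ring_language _ s (Psi \o b).
  apply: (can_inj PhiK); rewrite Phi_op PsiK; congr (@finterp ring_language _ s _).
  by apply/funext => i /=; rewrite PsiK.
have LK (a : forall n, F n) : aa (fun n => lift Psi (lift Phi a) n = a n).
  by apply/fclassP; rewrite !liftP PhiK.
have LK' (b : forall n, G n) : aa (fun n => lift Phi (lift Psi b) n = b n).
  by apply/fclassP; rewrite !liftP PsiK.
exact: (rigid_mod_fin hOCA hMA hF hG (lift_ring_mod_fin Phi_op) (lift_ring_mod_fin Psi_op)).
Qed.

Lemma isomorphism_trivial (Phi : rprod Fin (fields F) -> rprod Fin (fields G)) :
  isomorphism Phi -> trivial_hom Phi.
Proof.
move=> /isomorphism_rigid[f [h [N [_ _ hN hh]]]].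
exists f, h; split=> [a|L0 _].
  by rewrite -liftP; apply/fclassP; exact: hh.
apply/aa_finite; exists N => n /hN[_ h1 h2]; split=> [s _ a|[]]; exact: h1.
Qed.

Lemma isomorphic_obvious :
  isomorphic (rprod Fin (fields F)) (rprod Fin (fields G)) ->
  obviously_isomorphic (fields F) (fields G).
Proof.
move=> [Phi /isomorphism_rigid[f [h [N [finj fonto hN _]]]]].
exists [set n | N <= n], [set m | exists2 n, N <= n & f n = m], f; split.
- by apply/aa_finite; exact: aa_ge.
- exact/aa_finite.
- split=> [n Nn|n n'|m [n Nn <-]]; first by exists n.
    by rewrite !inE; exact: finj.
  by exists n.
- by move=> n /hN ?; exists (h n).
Qed.

End Isomorphism.

Lemma obvious_isomorphic (F G : nat -> fieldType) :
  obviously_isomorphic (fields F) (fields G) ->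
  isomorphic (rprod Fin (fields F)) (rprod Fin (fields G)).
Proof.
move=> [A [B [f [fA fB [fun_f inj_f surj_f] hf]]]].
have {}fA : aa A by apply/aa_finite.
have {}fB : aa B by apply/aa_finite.
have {}inj_f n n' : A n -> A n' -> f n = f n' -> n = n' by move=> *; apply: inj_f; rewrite ?inE.
have H n : exists h : F (f n) -> G n,
    A n -> @isomorphism _ (field_structure (F (f n))) (field_structure (G n)) h.
  by have [/hf[h hh]|nA] := pselect (A n); [exists h|exists (fun=> 0%R)].
pose h n := sval (cid (H n)).
have hh n : A n -> @isomorphism _ (field_structure (F (f n))) (field_structure (G n)) (h n).
  exact: (svalP (cid (H n))).
pose phi (a : forall n, F n) n : G n := h n (a (f n)).
have phi_ext a b : aa (fun n => a n = b n) -> aa (fun n => phi a n = phi b n).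
  move=> [K hK].
  (* Injectivity on [A] means that each [i < K] is a value at most once, so [f n >= K] for almost
     all [n]. *)
  have g : aa (fun n => forall i, i < K -> A n -> f n <> i).
    apply: aa_ltn_all => i _.
    have [[m Am mi]|g] := pselect (exists2 m, A m & f m = i).
      by exists m.+1 => n mn An ni; rewrite (inj_f n m) ?ltnn // ?mi in mn.
    by exists 0 => n _ An ni; apply: g; exists n.
  apply: aaW (aa_and fA g) => n [An gn]; rewrite /phi hK // leqNgt.
  by apply/negP => /gn; exact.
pose Phi (x : rprod Fin (fields F)) : rprod Fin (fields G) := fclass G (phi (rrepr x)).
have PhiE a : Phi (fclass F a) = fclass G (phi a).
  by apply/fclassP; apply: phi_ext; apply/fclassP; exact: rreprK.
have Phi_inj : injective Phi.
  move=> x y; rewrite -(rreprK x) -(rreprK y) !PhiE => /fclassP[K hK]; apply/fclassP.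
  have g : aa (fun m => forall i, i < K -> f i <> m).
    by apply: aa_ltn_all => i _; exists (f i).+1 => m fm e; rewrite e ltnn in fm.
  apply: aaW (aa_and fB g) => m [/surj_f[n An <-] gm].
  have Kn : K <= n by rewrite leqNgt; apply/negP => /gm.
  by have [/bij_inj hi _ _] := hh n An; apply: hi; exact: hK.
have Phi_surj y : exists x, Phi x = y.
  pose b : forall n, G n := rrepr y.
  have Hm m : exists x : F m, forall n (e : m = f n), A n -> h n (ecast i (F i) e x) = b n.
    have [[n An <-]|g] := pselect (exists2 n, A n & f n = m).
      have [[k _ hk] _ _] := hh n An; exists (k (b n)) => n' e An'.
      by have nn : n' = n by [exact: inj_f]; subst n'; rewrite (eq_axiomK e).
    by exists 0%R => n e An; case: g; exists n.
  exists (fclass F (fun m => sval (cid (Hm m)))); rewrite PhiE -(rreprK y); apply/fclassP.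
  by apply: aaW fA => n An; exact: (svalP (cid (Hm (f n))) n erefl An).
exists Phi; split; last by case.
  by have [Psi PsiK] := choice Phi_surj; exists Psi => // x; apply: Phi_inj; rewrite PsiK.
move=> s a; pose a' i := rrepr (a i).
have ea : a = fun i => fclass F (a' i) by apply/funext => i; rewrite rreprK.
have := @rprod_finterpE ring_language Fin (fields F) s a'; rewrite -ea => ->.
have -> : Phi \o a = fun i => fclass G (phi (a' i)).
  by apply/funext => i /=; rewrite -PhiE rreprK.
have -> := @rprod_finterpE ring_language Fin (fields G) s (fun i => phi (a' i)).
rewrite PhiE; apply/fclassP; apply: aaW fA => n An.
by have [_ h2 _] := hh n An; exact: h2.
Qed.

Theorem theorem1p2 (R : realType) (F G : nat -> fieldType)
    (hOCA : OCA_T R) (hMA : MA_aleph1_sigma_linked)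
    (hF : forall n, countable [set: F n])
    (hG : forall n, countable [set: G n]) :
  let MF := fun n => field_structure (F n) in
  let MG := fun n => field_structure (G n) in
  [/\ isomorphic (rprod Fin MF) (rprod Fin MG) <-> obviously_isomorphic MF MG,
      forall Phi : rprod Fin MF -> rprod Fin MF,
        isomorphism Phi -> trivial_hom Phi
    & forall Phi : rprod Fin MF -> rprod Fin MG,
        isomorphism Phi -> trivial_hom Phi].
Proof.
move=> MF MG; split.
- split; [exact: (isomorphic_obvious hOCA hMA hF hG)|exact: obvious_isomorphic].
- by move=> Phi; exact: (isomorphism_trivial hOCA hMA hF hF).
- by move=> Phi; exact: (isomorphism_trivial hOCA hMA hF hG).
Qed.
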